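(* As $N\to\infty$, $$\frac1N\log\left[\frac1{N!}\sum_{\sigma\in\mathcal{S}_N}\exp\left(-\frac1\epsilon\sum_{i=1}^Nc(X_i,Y_{\sigma_i})\right)\right]\ \longrightarrow\ -\frac1\epsilon\,\mathbf{C}_\epsilon(P,Q)\quad\text{in probability}.$$
   Context: Let $P,Q$ be probability measures on $\mathbb{R}^d$, $\epsilon>0$, and $c:\mathbb{R}^d\times\mathbb{R}^d\to[0,\infty)$ a continuous cost function with $c(x,y)=0$ if and only if $x=y$. Let $\Pi(P,Q)$ be the set of probability measures on $\mathbb{R}^d\times\mathbb{R}^d$ with marginals $P$ and $Q$, and $$\mathbf{C}_\epsilon(P,Q):=\min_{\nu\in\Pi(P,Q)}\left[\int c\,d\nu+\epsilon\,\mathrm{KL}(\nu\mid P\otimes Q)\right],$$ where $\mathrm{KL}(\nu\mid P\otimes Q)=\int\log\frac{d\nu}{d(P\otimes Q)}\,d\nu$ if $\nu\ll P\otimes Q$ and $+\infty$ otherwise. The minimizer $\mu_\epsilon$ (the Schrödinger bridge) has density with respect to $P\otimes Q$ of the form $$\xi(x,y)=\exp\left[-\frac1\epsilon\big(c(x,y)-a_\epsilon(x)-b_\epsilon(y)\big)\right]$$ for some measurable functions $a_\epsilon,b_\epsilon$. Define $\mathcal{A}:L^2(P)\to L^2(Q)$ and its adjoint $\mathcal{A}^*$ by $(\mathcal{A}f)(y)=\int f(x)\xi(x,y)\,dP(x)$, $(\mathcal{A}^*g)(x)=\int g(y)\xi(x,y)\,dQ(y)$. Standing assumptions on this $\xi$: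 (i) $\xi\in L^2(P\otimes Q)$; consequently $\mathcal{A}$ is compact and $\mathcal{A}^*\mathcal{A}$, $\mathcal{A}\mathcal{A}^*$ have eigenvalues $s_k^2$, $k\ge0$, with $s_0=1$ (eigenfunction $\mathbf{1}$) and $0\le s_k\le1$. (ii) Spectral gap: $s_k\le s_1<1$ for all $k\ge1$. $X_1,X_2,\dots$ are i.i.d. from $P$, $Y_1,Y_2,\dots$ are i.i.d. from $Q$, the two sequences are independent, and $\mathcal{S}_N$ is the set of permutations of $\{1,\dots,N\}$. *)

(* Defs.v *)
From HB Require Import structures.
From mathcomp Require Import all_boot all_order all_algebra all_fingroup.
From mathcomp Require Import all_classical all_reals all_analysis.

Set Implicit Arguments.
Unset Strict Implicit.
Unset Printing Implicit Defensive.
Import Order.TTheory GRing.Theory Num.Theory.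
Import numFieldNormedType.Exports.

Local Open Scope classical_set_scope.
Local Open Scope charge_scope.
Local Open Scope ring_scope.

(* 'rV[R]_d carries its Borel sigma-algebra. *)
HB.instance Definition _ (R : realType) (d : nat) :=
  @isMeasurable.Build (sigma_display (@open 'rV[R]_d)) 'rV[R]_d
    <<s @open 'rV[R]_d >>
    (@sigma_algebra0 _ setT _) (@sigma_algebraC _ _)
    (@sigma_algebra_bigcup _ setT _).

Section entropic_transport.
Context {R : realType}.

(* The Radon-Nikodym derivative is finite, and positive nu-a.e., so that
   [ln (fine _)] is its logarithm nu-a.e. *)
Definition KL {d} {T : measurableType d} (nu mu : probability T R) : \bar R :=
  if `[< nu `<< mu >] then
    (\int[nu]_z (ln (fine (('d (charge_of_finite_measure nu) '/d mu) z)))%:E)%E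
  else +oo%E.

Context {d1 d2} {T1 : measurableType d1} {T2 : measurableType d2}.
Implicit Types (P : probability T1 R) (Q : probability T2 R).
Implicit Types (nu : probability (T1 * T2)%type R) (c : T1 * T2 -> R).

Definition coupling P Q : set (probability (T1 * T2)%type R) :=
  [set nu | (forall A, measurable A -> nu (fst @^-1` A) = P A) /\
            (forall B, measurable B -> nu (snd @^-1` B) = Q B)].

Definition entropic_objective (eps : R) c P Q nu : \bar R :=
  (\int[nu]_z (c z)%:E + eps%:E * KL nu (P \x Q)%E)%E.

Definition entropic_cost (eps : R) c P Q : \bar R :=
  ereal_inf [set entropic_objective eps c P Q nu | nu in coupling P Q].

Definition schrodinger_bridge (eps : R) c P Q nu : Prop :=
  coupling P Q nu /\ entropic_objective eps c P Q nu = entropic_cost eps c P Q.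

Definition schrodinger_density (eps : R) c (a : T1 -> R) (b : T2 -> R)
    (z : T1 * T2) : R :=
  expR (- eps^-1 * (c z - a z.1 - b z.2)).

(* On the null set of points where the integral diverges, Rintegral returns 0
   or an arbitrary real; elements of L^2 are considered up to a.e. equality. *)
Definition opA P (xi : T1 * T2 -> R) (f : T1 -> R) : T2 -> R :=
  fun y => \int[P]_x (f x * xi (x, y)).

Definition opA_adj Q (xi : T1 * T2 -> R) (g : T2 -> R) : T1 -> R :=
  fun x => \int[Q]_y (g y * xi (x, y)).

End entropic_transport.

(* [lam] lists the nonzero eigenvalues of the (self-adjoint) operator [S] on
   L^2(mu), each repeated according to its multiplicity, with orthonormal
   eigenfunctions [e]; terms [lam k = 0] are padding, so that finite rank
   (e.g. finitely supported mu) is allowed and [e k] is then irrelevant.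
   The last clause says that no nonzero eigenvalue, and no dimension of its
   eigenspace, is missing from the list. *)
Definition eigenvalue_list {R : realType} {d} {T : measurableType d}
    (mu : probability T R) (S : (T -> R) -> (T -> R))
    (lam : nat -> R) (e : nat -> T -> R) : Prop :=
  [/\ forall k, lam k != 0 ->
        e k \in Lfun mu 2%:E /\ {ae mu, forall x, S (e k) x = lam k * e k x},
      forall j k, lam j != 0 -> lam k != 0 ->
        \int[mu]_x (e j x * e k x) = (j == k)%:R
    & forall (f : T -> R) (r : R), f \in Lfun mu 2%:E -> r != 0 ->
        {ae mu, forall x, S f x = r * f x} ->
        (forall k, lam k != 0 -> \int[mu]_x (f x * e k x) = 0) ->
        {ae mu, forall x, f x = 0}].

Section sampling.
Context {R : realType} {d d'} {Om : measurableType d} {T : measurableType d'}.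
Variable Pr : probability Om R.
Implicit Types X Y : nat -> {mfun Om >-> T}.

Definition mutually_independent X : Prop :=
  forall (J : seq nat) (A : nat -> set T), uniq J ->
    (forall j, measurable (A j)) ->
    (Pr (\bigcap_(j in [set` J]) (X j @^-1` A j)) =
     \prod_(j <- J) Pr (X j @^-1` A j))%E.

Definition iid_from X (P : probability T R) : Prop :=
  mutually_independent X /\
  forall i A, measurable A -> distribution Pr (X i) A = P A.

Definition generated_sigma X : set (set Om) :=
  <<s [set E | exists i A, measurable A /\ E = X i @^-1` A] >>.

Definition independent_sequences X Y : Prop :=
  forall E F, generated_sigma X E -> generated_sigma Y F ->
    (Pr (E `&` F) = Pr E * Pr F)%E.

Definition cvg_in_probability (Z : nat -> Om -> R) (l : R) : Prop :=
  forall delta : R, 0 < delta ->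
    Pr [set w | delta < `|Z N w - l|] @[N --> \oo] --> 0%E.

End sampling.

Definition log_permutation_average {R : realType} {T : Type}
    (eps : R) (c : T * T -> R) (N : nat) (x y : nat -> T) : R :=
  N%:R^-1 * ln ((N`!)%:R^-1 *
    \sum_(s : 'S_N) expR (- eps^-1 * \sum_(i < N) c (x i, y (s i)))).

(* Main.v *)
(** Write exp(-c/eps) = xi * exp(-(a+b)/eps). A permutation uses every X_i and
    every Y_j once, so the quantity equals
      (1/N) log D_N - (1/eps) (1/N) sum_i (a(X_i) + b(Y_i)),
    where D_N is the average over permutations s of prod_i xi(X_i, Y_(s i)).

    The second term obeys the weak law of large numbers: xi being in L^2, a and
    b are integrable, and C_eps = int a dP + int b dQ.

    For the first term, E D_N = 1 and Markov's inequality give the upper bound.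
    For the lower bound, xi is almost constant on the cells A_k x B_l of a fine
    partition of a large set K x L. Let zeta be the kernel obtained from xi by
    making it rank one on K x L with the same marginals. The chi-square
    distance chi of zeta to 1 is small, and expanding prod (1 + (zeta - 1))
    over subsets bounds the variance of D_N(zeta) by chi / (1 - chi); so
    D_N(zeta) >= 1/2 with high probability, and by Chernoff bounds almost all
    of it comes from permutations with typical cell counts. Rearranging such a
    permutation inside K x L leaves its zeta-product unchanged, while its
    xi-product is compared with the zeta-product times the product of the cell
    ratios w(k, l). The average of the latter over rearrangements depends only
    on the cell counts, and is at least exp(-delta N) by a change of measure to
    the coupling with density w. *)
From HB Require Import structures.
Require Import Defs.
From mathcomp Require Import all_boot all_order all_algebra all_fingroup.
From mathcomp Require Import all_classical all_reals all_analysis.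
From mathcomp Require Import measurable_realfun.
From mathcomp Require Import ring lra.

Set Implicit Arguments.
Unset Strict Implicit.
Unset Printing Implicit Defensive.
Import Order.TTheory GRing.Theory Num.Theory.
Import numFieldNormedType.Exports.

Local Open Scope ring_scope.

(** * Counting permutations *)

(** A second moment computation fails for [xi] itself: it yields a geometric series in the
    chi-square distance of the kernel to 1, and for a kernel merely in L^2 this distance may exceed
    1. Flattening cures this: row and column masses are at most 1, so the rank-one part is at most
    1/m on K x L, where m is the mass of K x L, and the complement carries little of the L^2 norm.
    The price is a factor exp(delta N) with delta arbitrarily small, harmless on the logarithmic
    scale.

    The cells are cut out by thresholds on the coordinates, which control c by uniform continuity,
    and on the values of a and b, which are only measurable.

    The marginal integrals of [xi] equal 1 only almost everywhere. They are made exact beforehand,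
    so that integrating out one coordinate works for every value of the others.

    The other obstacle is the integrability of a and b separately. A finite cost bounds a + b under
    the bridge only, and a sum of two non-integrable functions can be integrable through
    cancellation along a coupling. The L^2 bound on [xi] limits the mass that the bridge can put
    where such cancellation takes place. *)

Section counting.

(** Such a permutation is determined by its restrictions to [A] and to the complement of [A], each a
    permutation of that set. *)
Lemma card_perm_stabilizing_set (U : finType) (A : {set U}) :
  (#|[set t : {perm U} | t @: A == A]| <= (#|A|)`! * (#|U| - #|A|)`!)%N.
Proof.
pose f (t : {perm U}) := (restr_perm A t, restr_perm (~: A) t).
have stabA (t : {perm U}) : t @: A == A -> t \in ('N(A | 'P))%g.
  move=> /eqP tA; apply/astabsP => x /=; rewrite apermE -{1}tA.
  by rewrite (mem_imset _ _ perm_inj).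
have stabCA (t : {perm U}) : t @: A == A -> t \in ('N(~: A | 'P))%g.
  by move=> tA; rewrite astabsC stabA.
have injf : {in [set t : {perm U} | t @: A == A] &, injective f}.
  move=> s t; rewrite !inE => sA tA [] e1 e2; apply/permP => x.
  have [xA|xA] := boolP (x \in A).
    by rewrite -(restr_permE (stabA _ sA) xA) e1 (restr_permE (stabA _ tA) xA).
  have {}xA : x \in ~: A by rewrite inE.
  by rewrite -(restr_permE (stabCA _ sA) xA) e2 (restr_permE (stabCA _ tA) xA).
rewrite -(card_in_imset injf).
have <- : #|~: A| = (#|U| - #|A|)%N by rewrite -(cardsC A) addKn.
rewrite -!card_perm -cardX; apply: subset_leq_card; apply/fintype.subsetP => -[p q].
by case/imsetP => t _ [-> ->]; apply/andP; split; exact: restr_perm_on.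
Qed.

(** Composing with the inverse of [s] carries these permutations injectively to stabilizers of [A].
    They are the [t] whose edges over [A] meet the same columns as those of [s], the only ones
    correlated with [s] in the variance computation. *)
Lemma card_perm_same_image N (s : 'S_N) (A : {set 'I_N}) :
  (#|[set t : 'S_N | t @: A == s @: A]| <= (#|A|)`! * (N - #|A|)`!)%N.
Proof.
have injs : injective (fun t : 'S_N => (t * s^-1)%g) by exact: mulIg.
rewrite -(card_imset _ injs) -[X in (X - _)%N]card_ord.
apply: leq_trans (card_perm_stabilizing_set A); apply: subset_leq_card.
apply/fintype.subsetP => _ /imsetP[t + ->]; rewrite !inE => /eqP tA.
have -> : (t * s^-1)%g @: A = (s^-1)%g @: (t @: A).
  by rewrite -imset_comp; apply: eq_imset => x; rewrite /= permM.
rewrite tA -imset_comp; apply/eqP; rewrite -[RHS]imset_id.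
by apply: eq_imset => x; rewrite /= permK.
Qed.

(** There are C(N, k) subsets of size k, and C(N, k) k! (N - k)! = N!. What remains is the geometric
    series of [x] without its constant term, the empty set being excluded. *)
Lemma sum_subsets_geometric_le (R : realFieldType) N (x : R) : 0 <= x -> x < 1 ->
  \sum_(A : {set 'I_N} | A != finset.set0) ((#|A|)`! * (N - #|A|)`!)%:R * x ^+ #|A|
    <= N`!%:R * (x / (1 - x)).
Proof.
move=> x0 x1.
pose F k : R := if k == 0%N then 0 else (k`! * (N - k)`!)%:R * x ^+ k.
have cN (A : {set 'I_N}) : (#|A| < N.+1)%N by rewrite ltnS -[leqRHS]card_ord max_card.
have -> : \sum_(A : {set 'I_N} | A != finset.set0) ((#|A|)`! * (N - #|A|)`!)%:R * x ^+ #|A|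
    = \sum_(A : {set 'I_N}) F #|A|.
  rewrite big_mkcond /=; apply: eq_bigr => A _.
  by rewrite /F cards_eq0; case: eqP.
rewrite (partition_big (fun A : {set 'I_N} => inord #|A| : 'I_N.+1) predT)//=.
have -> : \sum_(k < N.+1) \sum_(A : {set 'I_N} | inord #|A| == k) F #|A|
    = \sum_(k < N.+1) 'C(N, k)%:R * F k.
  apply: eq_bigr => k _.
  have eqk (A : {set 'I_N}) : (inord #|A| == k) = (#|A| == k).
    by rewrite -val_eqE /= inordK.
  under eq_bigl do rewrite eqk.
  rewrite (eq_bigr (fun=> F k)) => [|A /eqP -> //].
  rewrite sumr_const [RHS]mulr_natl; congr (_ *+ _).
  by have := card_draws 'I_N k; rewrite card_ord => <-; apply: eq_card => A; rewrite !inE.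
rewrite big_ord_recl {1}/F /= mulr0 add0r.
have -> : \sum_(k < N) 'C(N, lift ord0 k)%:R * F (lift ord0 k)
    = N`!%:R * (x * \sum_(k < N) x ^+ k).
  rewrite !mulr_sumr; apply: eq_bigr => k _.
  by rewrite /F lift0 /= mulrA -natrM bin_fact ?ltn_ord// -exprS.
rewrite ler_wpM2l// ler_wpM2l//.
rewrite -[leRHS]mul1r ler_pdivlMr ?subr_gt0//.
by rewrite mulrC -opprB mulNr -subrX1 opprB lerBlDr lerDl exprn_ge0.
Qed.

End counting.

(** * Typical labels and labeled permanents *)

Section relabeling.
Variables (U F : finType) (I : {set U}).
Implicit Types kap : U -> F.

Definition label_count kap k := #|[set i in I | kap i == k]|.

Lemma label_count_perm kap (r : {perm U}) k : perm_on I r ->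
  label_count (kap \o r) k = label_count kap k.
Proof.
move=> rI; rewrite /label_count -[RHS](card_imset _ (@perm_inj _ (r^-1)%g)).
apply: eq_card => i; rewrite !inE; apply/idP/imsetP => [/andP[iI kr]|[j]].
  by exists (r i); rewrite ?permK// inE perm_closed// iI.
rewrite inE => /andP[jI kj] ->; rewrite /= permKV kj andbT.
by rewrite -(perm_closed _ rI) permKV.
Qed.

(* A permutation maximizing the agreement works: otherwise a transposition of
   two positions where the labelings disagree would increase it. *)
Lemma relabeling_exists kap kap' : exists2 r : {perm U}, perm_on I r &
  forall k, (#|[set i in I | (kap i == k) && (kap' (r i) != k)]|
             <= label_count kap k - label_count kap' k)%N.
Proof.
pose good (r : {perm U}) := [set i in I | kap' (r i) == kap i].
have [r rI rmax] : exists2 r : {perm U}, perm_on I r &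
    forall t : {perm U}, perm_on I t -> (#|good t| <= #|good r|)%N.
  case: (@arg_maxnP _ (1%g : {perm U}) (perm_on I) (fun t => #|good t|)) => [|r rI rmax].
    exact: perm_on1.
  by exists r.
exists r => // k.
set D := [set i in I | _].
have [->|[i iD]] := set_0Vmem D; first by rewrite cards0.
have noj j : j \in I -> kap' (r j) == k -> kap j == k.
  move=> jI rjk; apply: contraT => kjk.
  move: iD; rewrite inE => /and3P[iI kik rik].
  have ij : i != j by apply: contraNneq kjk => <-.
  have tijI : perm_on I (tperm i j).
    apply: fintype.subset_trans (tperm_on i j) _.
    by apply/fintype.subsetP => x; rewrite !inE => /orP[]/eqP ->.
  have tI : perm_on I (tperm i j * r)%g by rewrite perm_onM.
  have := rmax _ tI; rewrite leqNgt => /negP[].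
  apply: proper_card; apply/fintype.properP; split.
    apply/fintype.subsetP => x; rewrite !inE => /andP[xI xr]; rewrite xI permM.
    case: tpermP xr => [->|->|//].
      by rewrite (eqP kik) (negbTE rik).
    by rewrite (eqP rjk) eq_sym (negbTE kjk).
  exists i; rewrite !inE iI ?permM ?tpermL ?(eqP kik)//.
(* By [noj], every position where [kap' \o r] takes the value [k] has label [k] under [kap]. These
   positions and the mismatches are therefore disjoint parts of the class of [k]. *)
rewrite leq_subRL; last first.
  rewrite -(label_count_perm kap' k rI) /label_count subset_leq_card//.
  apply/fintype.subsetP => j; rewrite !inE => /andP[jI jk]; rewrite jI /=.
  exact: noj.
rewrite -(label_count_perm kap' k rI) -cardsUI.
rewrite [X in (_ + X)%N](_ : _ = 0%N) ?addn0; last first.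
  apply/eqP; rewrite cards_eq0; apply/eqP/setP => j; rewrite !inE.
  by case: eqP => //; rewrite !andbF.
apply: subset_leq_card; apply/fintype.subsetP => j; rewrite !inE.
by case/orP => [/andP[jI /(noj _ jI) ->]|/and3P[-> -> _]]; rewrite ?jI.
Qed.

End relabeling.

Section labeled_permanent.
Variables (R : realType) (U F G : finType) (I : {set U}) (w : F -> G -> R).
Implicit Types (kap : U -> F) (lam : U -> G).

(** The permanent of the matrix w(kap i, lam j) with i, j in [I]. Summing over permutations of [U]
    supported on [I], rather than over those of a type of size #|I|, lets [I] vary with the
    permutation that is rearranged. *)
Definition labeled_permanent kap lam : R :=
  \sum_(t : {perm U} | perm_on I t) \prod_(i in I) w (kap i) (lam (t i)).

(** A permanent is invariant under permutations of its rows and of its columns; the substitution is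
    t -> r^-1 t s. Consequently only the label counts on [I] matter. *)
Lemma labeled_permanent_perm kap lam (r s : {perm U}) :
  perm_on I r -> perm_on I s ->
  labeled_permanent (kap \o r) (lam \o s) = labeled_permanent kap lam.
Proof.
move=> rI sI; rewrite /labeled_permanent.
rewrite [RHS](reindex_inj (mulgI r^-1)%g) [RHS](reindex_inj (mulIg s))/=.
have rVI : perm_on I r^-1%g by exact: perm_onV.
apply: eq_big => t.
  apply/idP/idP => [tI|h]; first by rewrite !perm_onM.
  have -> : t = (r * (r^-1 * (t * s)) * s^-1)%g by rewrite mulKVg mulgK.
  by apply: perm_onM; [exact: perm_onM|exact: perm_onV].
move=> tI; rewrite [RHS](reindex_inj (@perm_inj _ r)) /=.
apply: eq_big => i; first by rewrite perm_closed.
by move=> iI; rewrite !permM permK.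
Qed.

(** In each product, a changed row label or a changed column label affects one factor, and two
    values of [w] differ by a factor of at most exp(2h). *)
Lemma labeled_permanent_change (h : R) kap lam kap' lam' : 0 <= h ->
  (forall k l, expR (- h) <= w k l <= expR h) ->
  expR (- (2 * h * (#|[set i in I | kap i != kap' i]| +
                    #|[set i in I | lam i != lam' i]|)%:R)) * labeled_permanent kap' lam'
  <= labeled_permanent kap lam.
Proof.
move=> h0 hw; have w0 k l : 0 <= w k l.
  by have /andP[+ _] := hw k l; apply: le_trans; exact: expR_ge0.
rewrite mulr_sumr; apply: ler_sum => t tI.
pose bad i := (kap i != kap' i) || (lam (t i) != lam' (t i)).
apply: (@le_trans _ _ (\prod_(i in I) ((if bad i then expR (- (2 * h)) else 1) *
                                        w (kap' i) (lam' (t i))))).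
  rewrite big_split /= ler_wpM2r ?prodr_ge0//.
  rewrite -big_mkcondr /= prodr_const -expRM_natl.
  rewrite ler_expR mulrN lerN2 [leLHS]mulrC ler_wpM2l ?mulr_ge0//.
  rewrite ler_nat.
  have -> : #|[set i in I | lam i != lam' i]| = #|[set i in I | lam (t i) != lam' (t i)]|.
    rewrite -[RHS](card_imset _ (@perm_inj _ t)); apply: eq_card => i.
    rewrite !inE; apply/idP/imsetP => [/andP[iI il]|[j]].
      exists (t^-1 i)%g; rewrite ?permKV// inE permKV il andbT.
      by rewrite -(perm_closed _ tI) permKV.
    by rewrite inE => /andP[jI jl] ->; rewrite perm_closed// jI.
  rewrite -cardsUI; apply: leq_trans (leq_addr _ _); apply: subset_leq_card.
  apply/fintype.subsetP => i; rewrite !inE => /andP[-> /orP[->|->]] //.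
  by rewrite orbT.
apply: ler_prod => i iI; apply/andP; split.
  by rewrite mulr_ge0//; case: ifP => // _; exact: expR_ge0.
case: ifPn => [_|]; last by rewrite negb_or !negbK mul1r => /andP[/eqP-> /eqP->].
have /andP[+ _] := hw (kap i) (lam (t i)); apply: le_trans.
have /andP[_ wh] := hw (kap' i) (lam' (t i)).
rewrite (le_trans (ler_wpM2l (expR_ge0 _) wh))// -expRD ler_expR; lra.
Qed.

End labeled_permanent.

(** One has e^x <= 1 / (1 - x), and (1 - x)(1 + x + 2x^2) = 1 + x^2 (1 - 2x) is at least 1. *)
Lemma expR_le_quadratic (R : realType) (x : R) : x <= 2^-1 ->
  expR x <= 1 + x + 2 * x ^+ 2.
Proof.
move=> x2; have x1 : 0 < 1 - x by lra.
have h := expR_ge1Dx (- x).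
rewrite -[x in expR x]opprK expRN.
apply: (@le_trans _ _ (1 - x)^-1); first by rewrite lef_pV2 ?posrE// ?expR_gt0.
by rewrite -[leLHS]mul1r ler_pdivrMr//; nra.
Qed.

Section chernoff.
Variables (R : realType) (U H : finType) (I : {set U}) (m : U -> H -> R).
Variables (B : pred H) (b : R).
Hypotheses (m0 : forall i h, 0 <= m i h) (m1 : forall i, \sum_h m i h = 1).
Hypothesis mB : forall i, i \in I -> \sum_(h | B h) m i h = b.

(** Exponential moments for independent indicators, the product measure being a finite sum over
    labelings. Positions outside [I] sum to 1 and disappear. *)
Lemma finite_chernoff (gam : R) : 0 <= gam -> gam <= 2 ->
  \sum_(f : {ffun U -> H} |
      #|I|%:R * b + gam * #|I|%:R <= #|[set i in I | B (f i)]|%:R) \prod_i m i (f i)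
  <= expR (- (gam ^+ 2 / 8 * #|I|%:R)).
Proof.
(* The exponent per position is 2 t^2 - gam t, minimal at t = gam / 4 with value - gam^2 / 8. The
   bound gam <= 2 keeps [t] in the range of [expR_le_quadratic]. *)
move=> g0 g2; set n := #|I|; pose t := gam / 4.
have t0 : 0 <= t by rewrite /t; lra.
pose c (f : {ffun U -> H}) : R := #|[set i in I | B (f i)]|%:R.
pose th := n%:R * b + gam * n%:R.
apply: (@le_trans _ _ (\sum_(f : {ffun U -> H}) expR (t * (c f - th)) * \prod_i m i (f i))).
  rewrite big_mkcond /=; apply: ler_sum => f _.
  have pf : 0 <= \prod_i m i (f i) by apply: prodr_ge0.
  case: ifPn => [thc|_]; last by rewrite mulr_ge0// expR_ge0.
  rewrite -[leLHS]mul1r ler_wpM2r// -expR0 ler_expR mulr_ge0// subr_ge0.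
  exact: thc.
have E (f : {ffun U -> H}) : expR (t * (c f - th)) * \prod_i m i (f i) =
    expR (- (t * th)) *
    \prod_i (m i (f i) * (if (i \in I) && B (f i) then expR t else 1)).
  rewrite big_split /= mulrBr expRD mulrAC [LHS]mulrC; congr (_ * _).
  rewrite mulrC; congr (_ * _).
  rewrite -big_mkcond /= prodr_const -expRM_natl mulrC /c; congr (expR (_%:R * _)).
  by apply: eq_card => i; rewrite !inE.
under eq_bigr do rewrite E.
rewrite -mulr_sumr -(bigA_distr_bigA (fun i h => m i h * (if (i \in I) && B h then expR t else 1))).
have {}E i : \sum_h m i h * (if (i \in I) && B h then expR t else 1) <=
    if i \in I then expR (b * t + 2 * t ^+ 2) else 1.
  case: ifPn => iI /=; last by under eq_bigr do rewrite mulr1; rewrite m1.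
  have b0 : 0 <= b by rewrite -(mB iI); apply: sumr_ge0.
  have b1 : b <= 1.
    rewrite -(mB iI) -(m1 i) [leRHS](bigID B)/= lerDl; exact: sumr_ge0.
  have -> : \sum_h m i h * (if B h then expR t else 1) = 1 + b * (expR t - 1).
    transitivity (\sum_h m i h + \sum_(h | B h) m i h * (expR t - 1)).
      rewrite [X in _ + X]big_mkcond/= -big_split/=.
      by apply: eq_bigr => h _; case: ifP => _; ring.
    by rewrite m1 -mulr_suml mB.
  apply: le_trans (expR_ge1Dx _).
  have t2 : t <= 2^-1 by rewrite /t; lra.
  have := expR_le_quadratic t2; set e := expR t => he.
  have : b * (e - 1) <= b * (t + 2 * t ^+ 2) by apply: ler_wpM2l => //; lra.
  have : b * (2 * t ^+ 2) <= 1 * (2 * t ^+ 2) by apply: ler_wpM2r => //; nra.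
  rewrite mulrDr; lra.
have : \prod_i \sum_h m i h * (if (i \in I) && B h then expR t else 1) <=
    \prod_i (if i \in I then expR (b * t + 2 * t ^+ 2) else 1).
  apply: ler_prod => i _; rewrite E andbT; apply: sumr_ge0 => h _.
  by rewrite mulr_ge0//; case: ifP => // _; exact: expR_ge0.
rewrite -big_mkcond/= prodr_const -expRM_natl => hp.
apply: le_trans (ler_wpM2l (expR_ge0 _) hp) _.
rewrite -expRD ler_expR /th -/n.
by rewrite le_eqVlt; apply/orP; left; apply/eqP; rewrite /t; field.
Qed.

End chernoff.

Section typical_labelings.
Variables (R : realType) (F G : finType) (p : F -> R) (q : G -> R) (w : F -> G -> R).
Hypotheses (p0 : forall k, 0 <= p k) (q0 : forall l, 0 <= q l).
Hypotheses (p1 : \sum_k p k = 1) (q1 : \sum_l q l = 1).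
Hypotheses (w0 : forall k l, 0 <= w k l).
Hypotheses (wq : forall k, 0 < p k -> \sum_l q l * w k l = 1).
Hypotheses (wp : forall l, 0 < q l -> \sum_k p k * w k l = 1).

Definition typical_labels (U : finType) (I : {set U}) (gam : R) (kap : U -> F) (lam : U -> G) :=
  [forall k, `|(label_count I kap k)%:R - #|I|%:R * p k| <= gam * #|I|%:R] &&
  [forall l, `|(label_count I lam l)%:R - #|I|%:R * q l| <= gam * #|I|%:R].

(** The Boolean passes to the complementary event, so that upper tails alone give two-sided
    bounds. *)
Let row_event (e : (F + G) * bool) (h : F * G) : bool :=
  (match e.1 with inl k => h.1 == k | inr l => h.2 == l end) (+) e.2.

Let row_prob (e : (F + G) * bool) : R :=
  let b := match e.1 with inl k => p k | inr l => q l end in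
  if e.2 then 1 - b else b.

Let coupling_mass (h : F * G) : R := p h.1 * q h.2 * w h.1 h.2.

Let sum_mass_row k : \sum_(h : F * G | h.1 == k) coupling_mass h = p k.
Proof.
rewrite (reindex_onto (fun l => (k, l)) snd) /=; last by move=> [? ?] /= /eqP ->.
rewrite (eq_bigl predT) => [|l]; last by rewrite /= !eqxx.
have [pk|] := boolP (0 < p k).
  transitivity (p k * \sum_l q l * w k l); last by rewrite wq ?mulr1.
  by rewrite mulr_sumr; apply: eq_bigr => l _; rewrite /coupling_mass /= mulrA.
rewrite lt_neqAle p0 andbT negbK => /eqP pk0.
by rewrite -pk0 big1// => l _; rewrite /coupling_mass /= -pk0 !mul0r.
Qed.

Let sum_mass_col l : \sum_(h : F * G | h.2 == l) coupling_mass h = q l.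
Proof.
rewrite (reindex_onto (fun k => (k, l)) fst) /=; last by move=> [? ?] /= /eqP ->.
rewrite (eq_bigl predT) => [|k]; last by rewrite /= !eqxx.
have [ql|] := boolP (0 < q l).
  transitivity (q l * \sum_k p k * w k l); last by rewrite wp ?mulr1.
  by rewrite mulr_sumr; apply: eq_bigr => k _; rewrite /coupling_mass /=; ring.
rewrite lt_neqAle q0 andbT negbK => /eqP ql0.
by rewrite -ql0 big1// => k _; rewrite /coupling_mass /= -ql0 mulr0 mul0r.
Qed.

Let sum_mass : \sum_h coupling_mass h = 1.
Proof.
rewrite (partition_big fst predT) //= -p1; apply: eq_bigr => k _.
exact: sum_mass_row.
Qed.

Let sum_row_event e : \sum_(h | row_event e h) coupling_mass h = row_prob e.
Proof.
suff E : \sum_(h | row_event (e.1, false) h) coupling_mass h = row_prob (e.1, false).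
  case: e E => kl [] // E.
  have -> : row_prob (kl, true) = 1 - row_prob (kl, false) by [].
  rewrite -E -sum_mass [X in _ = X - _](bigID (row_event (kl, false))) [RHS]addrAC subrr add0r.
  by apply: eq_bigl => h; rewrite /row_event /= addbT addbF.
case: e => -[k|l] e2; rewrite /row_event /row_prob /=.
  by rewrite -sum_mass_row; apply: eq_bigl => h; rewrite addbF.
by rewrite -sum_mass_col; apply: eq_bigl => h; rewrite addbF.
Qed.

(* Sample the labels in pairs from the coupling p k * q l * w k l: they are
   typical with large probability. As p (x) q is exchangeable, the density
   prod w may be averaged over permutations, which gives the permanent. *)
Lemma typical_labels_exist (U : finType) (I : {set U}) (gam : R) :
  0 < gam -> gam <= 2 ->
  (2 * (#|F| + #|G|))%:R * expR (- (gam ^+ 2 / 8 * #|I|%:R)) <= 4^-1 ->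
  exists (kap : U -> F) (lam : U -> G), typical_labels I gam kap lam /\
    2^-1 <= (#|I|)`!%:R^-1 * labeled_permanent I w kap lam.
Proof.
move=> g0 g2 hn.
(* [W0] is the exchangeable law p x q at every position. [W1] uses the coupling at the positions of
   [I] and keeps p x q elsewhere, so both have total mass 1. *)
pose W0 (f : {ffun U -> F * G}) : R := \prod_i (p (f i).1 * q (f i).2).
pose W1 (f : {ffun U -> F * G}) : R :=
  \prod_i (if i \in I then coupling_mass (f i) else p (f i).1 * q (f i).2).
pose typ (f : {ffun U -> F * G}) := typical_labels I gam (fst \o f) (snd \o f).
pose lp (f : {ffun U -> F * G}) := labeled_permanent I w (fst \o f) (snd \o f).
have W00 f : 0 <= W0 f by apply: prodr_ge0 => i _; rewrite mulr_ge0.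
have W10 f : 0 <= W1 f.
  by apply: prodr_ge0 => i _; case: ifP => _; rewrite /coupling_mass ?mulr_ge0.
have pq1 : \sum_(h : F * G) p h.1 * q h.2 = 1.
  transitivity ((\sum_k p k) * \sum_l q l); last by rewrite p1 q1 mulr1.
  by rewrite big_distrlr pair_big.
have sW0 : \sum_f W0 f = 1.
  rewrite /W0 -(bigA_distr_bigA (fun _ h => p h.1 * q h.2)) /=.
  by rewrite big1// => i _; rewrite pq1.
have sW1 : \sum_f W1 f = 1.
  rewrite /W1 -(bigA_distr_bigA (fun i h => if i \in I then coupling_mass h else p h.1 * q h.2)) /=.
  by rewrite big1// => i _; case: (i \in I); rewrite ?sum_mass ?pq1.
(* Union bound over the 2 (|F| + |G|) events, each controlled by [finite_chernoff] with the same
   exponent. *)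
have atyp : \sum_(f | ~~ typ f) W1 f <= 4^-1.
  pose up e (f : {ffun U -> F * G}) := #|I|%:R * row_prob e + gam * #|I|%:R <=
    #|[set i in I | row_event e (f i)]|%:R.
  apply: le_trans hn.
  apply: (@le_trans _ _ (\sum_(e : (F + G) * bool) \sum_(f | up e f) W1 f)).
    rewrite (exchange_big_dep predT)//= big_mkcond /=; apply: ler_sum => f _.
    case: ifPn => [nt|_]; last by apply: sumr_ge0.
    suff [e ue] : exists e, up e f by rewrite (bigD1 e)//= lerDl sumr_ge0.
    have cK kl : (#|[set i in I | row_event (kl, true) (f i)]|%:R : R) =
        #|I|%:R - #|[set i in I | row_event (kl, false) (f i)]|%:R.
      rewrite -(cardsID [set i | row_event (kl, false) (f i)] I) natrD.
      rewrite (_ : I :&: _ = [set i in I | row_event (kl, false) (f i)]); last first.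
        by apply/setP => i; rewrite !inE.
      rewrite [RHS]addrAC subrr add0r; congr (_%:R); apply: eq_card => i; rewrite !inE andbC.
      by rewrite /row_event /= addbT addbF.
    have tail kl (x : R) : x = row_prob (kl, false) ->
        gam * #|I|%:R < `|#|[set i in I | row_event (kl, false) (f i)]|%:R - #|I|%:R * x| ->
        exists e, up e f.
      move=> ->; rewrite lter_normr => /orP[h|h].
        by exists (kl, false); rewrite /up; lra.
      exists (kl, true); rewrite /up cK (_ : row_prob (kl, true) = 1 - row_prob (kl, false))//.
      lra.
    move: nt; rewrite negb_and !negb_forall => /orP[/existsP[k]|/existsP[l]];
      rewrite -ltNge => h.
      apply: (tail (inl k) (p k)) => //; move: h; congr (_ < `|_%:R - _|).
      by apply: eq_card => i; rewrite !inE /row_event addbF.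
    apply: (tail (inr l) (q l)) => //; move: h; congr (_ < `|_%:R - _|).
    by apply: eq_card => i; rewrite !inE /row_event addbF.
  apply: (@le_trans _ _ (\sum_(e : (F + G) * bool) expR (- (gam ^+ 2 / 8 * #|I|%:R)))).
    apply: ler_sum => e _; rewrite /up /W1.
    apply: (@finite_chernoff _ _ _ I
      (fun i h => if i \in I then coupling_mass h else p h.1 * q h.2)); rewrite ?(ltW g0)//.
    - by move=> i h; case: ifP => _; rewrite /coupling_mass ?mulr_ge0.
    - by move=> i; case: (i \in I); rewrite ?sum_mass ?pq1.
    - move=> i iI; rewrite -sum_row_event; apply: eq_bigr => h _; by rewrite iI.
  by rewrite sumr_const card_prod card_sum card_bool mulnC -[leLHS]mulr_natl.
(* For each [t] supported on [I], moving the second labels along [t] preserves typicality and turns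
   [W1] into [W0] times the product of w(kap i, lam (t i)) over [I]. Summing over the |I|! such [t]
   produces the permanent. *)
have key : \sum_(f | typ f) W0 f * lp f = (#|I|)`!%:R * \sum_(f | typ f) W1 f.
  rewrite /lp /labeled_permanent.
  under eq_bigr do rewrite mulr_sumr.
  rewrite exchange_big /=.
  transitivity (\sum_(t | perm_on I t) \sum_(f | typ f) W1 f); last first.
    rewrite sumr_const card_perm mulr_natl; congr (_ *+ _).
  apply: eq_bigr => t tI.
  pose tw (u : {perm U}) (f : {ffun U -> F * G}) := [ffun i => ((f i).1, (f (u i)).2)].
  have twK u : cancel (tw u) (tw u^-1%g).
    by move=> f; apply/ffunP => i; rewrite !ffunE /= permKV -surjective_pairing.
  rewrite [RHS](reindex_inj (can_inj (twK t))) /=.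
  have twp (u : {perm U}) f : (fst \o tw u f) = fst \o f /\ (snd \o tw u f) = (snd \o f) \o u.
    by split; apply/funext => i; rewrite /= ffunE.
  apply: eq_big => [f|f _].
    rewrite /typ /typical_labels; have [-> ->] := twp t f; congr (_ && _).
    by apply: eq_forallb => l; rewrite label_count_perm.
  transitivity (\prod_i (p (f i).1 * q (f (t i)).2) * \prod_(i in I) w (f i).1 (f (t i)).2).
    congr (_ * _); rewrite /W0 !big_split /=; congr (_ * _).
    by rewrite (reindex_inj (@perm_inj _ t)).
  rewrite [X in _ * X]big_mkcond /= -big_split /=; apply: eq_bigr => i _.
  by rewrite ffunE; case: ifP => _; rewrite ?mulr1.
(* If all typical permanents were below |I|! / 2, then [key] would bound the typical part of [W1] by
   1/2, although it is at least 3/4. *)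
apply: contrapT => nex.
have small f : typ f -> lp f <= (#|I|)`!%:R * 2^-1.
  move=> tf; rewrite leNgt; apply/negP => lpf; apply: nex.
  exists (fst \o f), (snd \o f); split => //.
  by rewrite ler_pdivlMl ?ltr0n ?fact_gt0// ltW.
have : (#|I|)`!%:R * \sum_(f | typ f) W1 f <= (#|I|)`!%:R * 2^-1.
  rewrite -key; apply: (@le_trans _ _ (\sum_(f | typ f) W0 f * ((#|I|)`!%:R * 2^-1))).
    by apply: ler_sum => f tf; rewrite ler_wpM2l// small.
  rewrite -mulr_suml -[leRHS]mul1r ler_wpM2r ?mulr_ge0//.
  by rewrite -sW0 [leRHS](bigID typ)/= lerDl sumr_ge0.
rewrite ler_pM2l ?ltr0n ?fact_gt0//.
have : \sum_(f | typ f) W1 f + \sum_(f | ~~ typ f) W1 f = 1.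
  by rewrite -sW1 [RHS](bigID typ).
lra.
Qed.

End typical_labelings.

Lemma expRN_le_inv (R : realType) (x : R) : 0 <= x -> expR (- x) <= (1 + x)^-1.
Proof.
move=> x0; rewrite expRN lef_pV2 ?posrE ?expR_gt0 ?expR_ge1Dx//; lra.
Qed.

(** One typical labeling with permanent at least |I|! / 2 is known. Any other typical labeling
    agrees with it, up to rearrangement, outside O(gam |I|) positions, and each of these costs at
    most a constant factor. *)
Lemma labeled_permanent_ge (R : realType) (F G : finType) (p : F -> R) (q : G -> R)
    (w : F -> G -> R) (del : R) :
  (forall k, 0 < p k) -> (forall l, 0 < q l) ->
  \sum_k p k = 1 -> \sum_l q l = 1 -> (forall k l, 0 < w k l) ->
  (forall k, \sum_l q l * w k l = 1) -> (forall l, \sum_k p k * w k l = 1) -> 0 < del ->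
  exists gam : R, 0 < gam /\ exists n0 : nat,
    forall (U : finType) (I : {set U}) (kap : U -> F) (lam : U -> G), (n0 <= #|I|)%N ->
      typical_labels p q I gam kap lam ->
      expR (- (del * #|I|%:R)) <= (#|I|)`!%:R^-1 * labeled_permanent I w kap lam.
Proof.
move=> p0 q0 p1 q1 w0 wq wp d0.
pose h := \sum_(e : F * G) `|ln (w e.1 e.2)|.
have h0 : 0 <= h by apply: sumr_ge0.
have hw k l : expR (- h) <= w k l <= expR h.
  have : `|ln (w k l)| <= h.
    by rewrite /h (bigD1 (k, l))//= lerDl sumr_ge0.
  by rewrite ler_norml -(ler_expR (- h)) -(ler_expR _ h) lnK ?posrE /= ?w0.
pose M : R := (#|F| + #|G|)%:R; have M0 : 0 <= M by [].
(* At most 2 M gam n labels change, at a cost of 2h each in the exponent. With h M <= K and gam <=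
   del / (8 K) the total 4 h M gam n is at most del n / 2. The added ones keep [K] positive. *)
pose K := (h + 1) * (M + 1).
have K1 : 1 <= K by rewrite /K; nra.
pose gam := Num.min 1 (del / (8 * K)).
have g0 : 0 < gam by rewrite lt_min ltr01 divr_gt0// mulr_gt0//; lra.
have g1 : gam <= 1 by rewrite ge_min lexx.
have gK : gam * (8 * K) <= del.
  by rewrite -ler_pdivlMr; [rewrite /gam ge_min lexx orbT|lra].
(* The first summand makes 2 M exp(- gam^2 n / 8) at most 1/4, as [typical_labels_exist] demands.
   The second makes exp(- del n / 2) at most 1/2, which absorbs the factor 1/2 of that lemma. *)
pose bnd := 64 * M / gam ^+ 2 + 2 / del.
have bnd0 : 0 <= bnd.
  by rewrite addr_ge0// divr_ge0 ?mulr_ge0// ?exprn_ge0// ltW.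
exists gam; split => //; exists (Num.bound bnd) => U I kap lam nI typ.
set n : R := #|I|%:R.
have nb : bnd <= n.
  by rewrite (le_trans (ltW (archi_boundP bnd0)))// ler_nat.
have n0 : 0 <= n by [].
have nb1 : 64 * M <= n * gam ^+ 2.
  rewrite -ler_pdivrMr ?exprn_gt0//; apply: le_trans nb.
  by rewrite lerDl divr_ge0// ltW.
have nb2 : 2 <= n * del.
  rewrite -ler_pdivrMr//; apply: le_trans nb.
  by rewrite lerDr; apply: divr_ge0; [exact: mulr_ge0|exact: sqr_ge0].
have hn : (2 * (#|F| + #|G|))%:R * expR (- (gam ^+ 2 / 8 * n)) <= 4^-1.
  have x0 : 0 <= gam ^+ 2 / 8 * n by rewrite !mulr_ge0// ?exprn_ge0// ltW.
  apply: (@le_trans _ _ ((2 * M) * (1 + gam ^+ 2 / 8 * n)^-1)).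
    by rewrite natrM ler_wpM2l// ?mulr_ge0// expRN_le_inv.
  by rewrite ler_pdivrMr; nra.
have [kap' [lam' [typ' h2]]] := typical_labels_exist (fun k => ltW (p0 k)) (fun l => ltW (q0 l))
  p1 q1 (fun k l => ltW (w0 k l)) (fun k _ => wq k) (fun l _ => wp l) (I := I) g0
  (le_trans g1 (ler1n _ 2)) hn.
have close (F' : finType) (p' : F' -> R) (k k' : U -> F') :
    (forall x, `|(label_count I k x)%:R - n * p' x| <= gam * n) ->
    (forall x, `|(label_count I k' x)%:R - n * p' x| <= gam * n) ->
    exists2 r : {perm U}, perm_on I r &
      (#|[set i in I | k i != k' (r i)]|%:R : R) <= #|F'|%:R * (2 * gam * n).
  move=> hk hk'; have [r rI hr] := relabeling_exists I k k'; exists r => //.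
  have -> : #|[set i in I | k i != k' (r i)]| =
      (\sum_(x : F') #|[set i in I | (k i == x) && (k' (r i) != x)]|)%N.
    rewrite -sum1_card (partition_big k predT)//=; apply: eq_bigr => x _.
    rewrite -sum1_card; apply: eq_bigl => i; rewrite !inE -andbA; congr (_ && _).
    by rewrite andbC; case: eqP => //= ->; rewrite eq_sym.
  rewrite natr_sum; apply: (@le_trans _ _ (\sum_(x : F') 2 * gam * n)); last first.
    by rewrite sumr_const [leRHS]mulr_natl.
  apply: ler_sum => x _.
  have g2 : 0 <= 2 * gam * n by rewrite !mulr_ge0// ltW.
  apply: (@le_trans _ _ (label_count I k x - label_count I k' x)%:R); first by rewrite ler_nat.
  have [lek|/ltnW lek] := leqP (label_count I k x) (label_count I k' x).
    by rewrite (eqP (_ : (_ - _ == 0)%N)) ?subn_eq0.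
  rewrite natrB//.
  by move: (hk x) (hk' x); rewrite !ler_norml => /andP[? ?] /andP[? ?]; lra.
move: typ typ' => /andP[/forallP t1 /forallP t2] /andP[/forallP t1' /forallP t2'].
have [r rI hr] := close F p kap kap' t1 t1'.
have [s sI hs] := close G q lam lam' t2 t2'.
rewrite -(labeled_permanent_perm w kap' lam' rI sI) in h2.
have := labeled_permanent_change I kap lam (kap' \o r) (lam' \o s) h0 hw.
set D := (_ + _)%:R => hD.
have fI : 0 < ((#|I|)`!%:R : R)^-1 by rewrite invr_gt0 ltr0n fact_gt0.
apply: le_trans (ler_wpM2l (ltW fI) hD); rewrite mulrCA.
apply: le_trans (ler_wpM2l (expR_ge0 _) h2).
have e2 : expR (- (del * n / 2)) <= 2^-1.
  apply: le_trans (expRN_le_inv _) _; first by nra.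
  by rewrite lef_pV2 ?posrE//; lra.
apply: le_trans (ler_wpM2l (expR_ge0 _) e2).
rewrite -expRD ler_expR.
suff : 2 * h * D <= del * n / 2 by lra.
have DM : D <= M * (2 * gam * n) by rewrite /D /M !natrD mulrDl; exact: lerD.
apply: (@le_trans _ _ (2 * h * (M * (2 * gam * n)))); first by rewrite ler_wpM2l// mulr_ge0.
have hK : h * M <= K by rewrite /K; nra.
have : h * M * (4 * gam * n) <= K * (4 * gam * n).
  by rewrite ler_wpM2r// !mulr_ge0// ltW.
have : gam * (8 * K) * n <= del * n by rewrite ler_wpM2r.
lra.
Qed.

(** * Rearranging a permutation inside its block *)

Section block_resampling.
Variables (R : realType) (N : nat).

(** For fixed [t], left multiplication by [t] permutes the [s] whose block supports [t], and leaves
    their blocks unchanged. Each [s] occurs with |I s|! such [t], which the weight compensates. *)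
Lemma sum_perm_average (I : 'S_N -> {set 'I_N}) (f : 'S_N -> R) :
  (forall s t : 'S_N, perm_on (I s) t -> I (t * s)%g = I s) ->
  \sum_s f s = \sum_s (#|I s|)`!%:R^-1 * \sum_(t : 'S_N | perm_on (I s) t) f (t * s)%g.
Proof.
move=> hI.
have hIV s t : perm_on (I (t^-1 * s)%g) t = perm_on (I s) t.
  apply/idP/idP => h.
    by have := hI _ _ h; rewrite mulKVg => ->.
  by rewrite hI// perm_onV.
under [RHS]eq_bigr do rewrite mulr_sumr big_mkcond /=.
rewrite exchange_big /=.
transitivity (\sum_(t : 'S_N) \sum_s
    if perm_on (I s) t then (#|I s|)`!%:R^-1 * f s else 0); last first.
  apply: eq_bigr => t _; rewrite [LHS](reindex_inj (mulgI t))/=.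
  apply: eq_bigr => s _; rewrite -{1}(hIV (t * s)%g) mulKg.
  by case: ifPn => // h; rewrite hI.
rewrite exchange_big /=; apply: eq_bigr => s _.
rewrite -big_mkcond /= sumr_const card_perm -mulrnAl -mulr_natl mulfV ?mul1r//.
Qed.

Variables (F G : finType) (xi ze : 'I_N -> 'I_N -> R) (ki : 'I_N -> option F)
  (li : 'I_N -> option G) (k0 : F) (l0 : G) (w : F -> G -> R) (u v : 'I_N -> R).
Variables (th del : R) (good : pred 'S_N).
Hypotheses (xi0 : forall i j, 0 <= xi i j) (ze0 : forall i j, 0 <= ze i j).
Hypotheses (w0 : forall k l, 0 <= w k l) (th0 : 0 <= th) (del0 : 0 <= del).
Hypothesis off_block : forall i j, ~~ (ki i && li j) -> xi i j = ze i j.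
Hypothesis block : forall i j k l, ki i = Some k -> li j = Some l ->
  expR (- th) * w k l * ze i j <= xi i j.
Hypothesis block_prod : forall i j, ki i -> li j -> ze i j = u i * v j.

Definition block_rows (s : 'S_N) : {set 'I_N} := [set i | ki i && li (s i)].

Hypothesis goodP : forall s, good s ->
  expR (- (del * #|block_rows s|%:R)) <= (#|block_rows s|)`!%:R^-1 *
   labeled_permanent (block_rows s) w (fun i => odflt k0 (ki i)) (fun i => odflt l0 (li (s i))).

(* Rearranging s inside its block does not change the product of the rank-one
   part of ze, and averages the cell weights into a labeled permanent. *)
Lemma perm_sum_block_ge :
  expR (- ((th + del) * N%:R)) * \sum_(s : 'S_N | good s) \prod_i ze i (s i)
    <= \sum_(s : 'S_N) \prod_i xi i (s i).
Proof.
rewrite (@sum_perm_average block_rows); last first.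
  move=> s t tI; apply/setP => i; rewrite !inE permM.
  have [iI|iI] := boolP (i \in block_rows s); last by rewrite (out_perm tI).
  have : t i \in block_rows s by rewrite (perm_closed _ tI).
  by move: iI; rewrite !inE => /andP[-> ->] /andP[_ ->].
rewrite [leLHS]mulr_sumr big_mkcond /=; apply: ler_sum => s _.
have fI : 0 <= ((#|block_rows s|)`!%:R : R)^-1 by rewrite invr_ge0.
case: ifPn => [gs|_]; last first.
  by rewrite mulr_ge0//; apply: sumr_ge0 => t _; exact: prodr_ge0.
set I := block_rows s.
pose n : R := #|I|%:R.
have nN : n <= N%:R by rewrite ler_nat -[leqRHS]card_ord max_card.
apply: (@le_trans _ _ ((expR (- (th * n)) * \prod_i ze i (s i)) *
    ((#|I|)`!%:R^-1 * labeled_permanent I w (fun i => odflt k0 (ki i))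
      (fun i => odflt l0 (li (s i)))))).
  have := goodP gs; rewrite -/I -/n => h.
  apply: le_trans (ler_wpM2l _ h); last by rewrite mulr_ge0 ?expR_ge0// prodr_ge0.
  rewrite mulrAC -expRD ler_wpM2r ?prodr_ge0// ler_expR -opprD lerN2 -mulrDl.
  by rewrite ler_wpM2l// addr_ge0.
rewrite mulrCA ler_wpM2l// /labeled_permanent mulr_sumr; apply: ler_sum => t tI.
have Iin i : i \in I -> ki i /\ li (s i) by rewrite inE => /andP[].
rewrite (bigID (mem I)) [leRHS](bigID (mem I)) /=.
have -> : \prod_(i < N | i \notin I) xi i ((t * s)%g i) = \prod_(i < N | i \notin I) ze i (s i).
  apply: eq_bigr => i iI; rewrite permM (out_perm tI)//.
  by apply: off_block; move: iI; rewrite inE.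
rewrite [X in X <= _](_ : _ = (expR (- (th * n)) * \prod_(i in I) ze i (s i) *
   \prod_(i in I) w (odflt k0 (ki i)) (odflt l0 (li (s (t i))))) *
   \prod_(i < N | i \notin I) ze i (s i)); last by ring.
rewrite ler_wpM2r ?prodr_ge0//.
have -> : \prod_(i in I) ze i (s i) = \prod_(i in I) ze i (s (t i)).
  transitivity (\prod_(i in I) u i * \prod_(i in I) v (s i)).
    by rewrite -big_split /=; apply: eq_bigr => i /Iin[? ?]; rewrite block_prod.
  rewrite [X in _ * X](reindex_inj (@perm_inj _ t)) /=.
  rewrite [X in _ * X](eq_bigl (mem I)) => [|i]; last by rewrite /= perm_closed.
  rewrite -big_split /=; apply: eq_bigr => i iI; rewrite block_prod//; first by case: (Iin i iI).
  by have /Iin[] : t i \in I by rewrite perm_closed.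
have -> : expR (- (th * n)) = \prod_(i in I) expR (- th).
  by rewrite prodr_const -expRM_natl mulrN mulrC.
rewrite -!big_split /=; apply: ler_prod => i iI.
rewrite !mulr_ge0 ?expR_ge0//= permM.
have [ki_ _] := Iin i iI.
have [_ li_] : ki (t i) /\ li (s (t i)) by apply: Iin; rewrite perm_closed.
rewrite mulrAC.
case ek : (ki i) ki_ => [k|//] _; case el : (li (s (t i))) li_ => [l|//] _ /=.
exact: block.
Qed.

End block_resampling.

Local Open Scope classical_set_scope.

(** * Resampling a coordinate of an independent family *)

Section measurable_bool.
Context {d} {T : measurableType d} (f : T -> bool).
Hypothesis mf : measurable_fun setT f.

Lemma measurable_bool_set : measurable [set x | f x].
Proof. by have := mf measurableT (_ : measurable [set true]); rewrite setTI; apply. Qed.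

Lemma measurable_negb_set : measurable [set x | ~~ f x].
Proof.
rewrite (_ : [set x | _] = ~` [set x | f x]); first exact: measurableC measurable_bool_set.
by apply/seteqP; split => x /= /negP.
Qed.

End measurable_bool.

Section real_integrals.
Context {R : realType} {d} {S : measurableType d} (mu : {measure set S -> \bar R}).
Implicit Types f g : S -> R.

Lemma ge0_integral_addr f g : measurable_fun setT f -> measurable_fun setT g ->
  (forall x, 0 <= f x) -> (forall x, 0 <= g x) ->
  (\int[mu]_x (f x + g x)%:E = \int[mu]_x (f x)%:E + \int[mu]_x (g x)%:E)%E.
Proof.
move=> mf mg f0 g0; under eq_integral do rewrite EFinD.
by rewrite ge0_integralD// => *; rewrite ?lee_fin//; exact/measurable_EFinP.
Qed.

Lemma ge0_integral_scaler k f : 0 <= k -> measurable_fun setT f -> (forall x, 0 <= f x) ->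
  (\int[mu]_x (k * f x)%:E = k%:E * \int[mu]_x (f x)%:E)%E.
Proof.
move=> k0 mf f0; under eq_integral do rewrite EFinM.
by rewrite ge0_integralZl// => *; rewrite ?lee_fin//; exact/measurable_EFinP.
Qed.

End real_integrals.

Section configurations.
Context {d} {T : measurableType d} {I : eqType}.

Definition cylinders : set (set (I -> T)) :=
  [set E | exists (J : seq I) (A : I -> set T), [/\ uniq J,
     (forall j, measurable (A j)) &
     E = \bigcap_(j in [set` J]) [set z | A j (z j)]]].

(** The product sigma-algebra on I -> T. It is generated by [cylinders], a pi-system, so that laws
    of families can be compared on rectangles. *)
Definition config : measurableType _ := g_sigma_algebraType cylinders.

Definition update (z : config) (i : I) (x : T) : config :=
  fun j => if j == i then x else z j.

Lemma update_eq z i x : update z i x i = x.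
Proof. by rewrite /update eqxx. Qed.

Lemma update_neq z i x j : j != i -> update z i x j = z j.
Proof. by rewrite /update => /negbTE ->. Qed.

Lemma setI_cylinders : setI_closed cylinders.
Proof.
move=> E1 E2 [J1 [A1 [uJ1 mA1 ->]]] [J2 [A2 [uJ2 mA2 ->]]].
exists (undup (J1 ++ J2)), (fun j => (if j \in J1 then A1 j else setT) `&`
                                     (if j \in J2 then A2 j else setT)); split.
- exact: undup_uniq.
- by move=> j; apply: measurableI; case: ifP.
- apply/seteqP; split=> [z [h1 h2] j _|z h].
    by split; case: ifP => // ?; [exact: h1|exact: h2].
  split=> j jJ; have /h : [set` undup (J1 ++ J2)] j.
  + by rewrite /= mem_undup mem_cat jJ.
  + by case=> + _; rewrite (jJ : j \in J1).
  + by rewrite /= mem_undup mem_cat (jJ : j \in J2) orbT.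
  + by case=> _; rewrite (jJ : j \in J2).
Qed.

Lemma measurable_coord (i : I) : measurable_fun [set: config] (fun z : config => z i).
Proof.
move=> _ A mA; rewrite setTI; apply: sub_sigma_algebra.
exists [:: i], (fun=> A); split => //; apply/seteqP; split => [z Az j|z].
  by rewrite /= inE => /eqP ->.
by apply; rewrite /= inE.
Qed.

Lemma measurable_config {d'} {S : measurableType d'} (f : S -> config) :
  (forall i, measurable_fun setT (fun s => f s i)) -> measurable_fun setT f.
Proof.
move=> mf; refine (@measurability _ _ S config setT f cylinders erefl _).
move=> _ [_ [J [A [uJ mA ->]]] <-]; rewrite setTI.
have -> : f @^-1` (\bigcap_(j in [set` J]) [set z | A j (z j)]) =
    \bigcap_(j in [set` J]) ((fun s => f s j) @^-1` A j) by [].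
apply: fin_bigcap_measurable => // j _.
by rewrite -[X in measurable X]setTI; exact: mf.
Qed.

Lemma measurable_update {d'} {S : measurableType d'} (i : I) (f : S -> config) (g : S -> T) :
  measurable_fun setT f -> measurable_fun setT g ->
  measurable_fun setT (fun s => update (f s) i (g s)).
Proof.
move=> mf mg; apply: measurable_config => j; rewrite /update.
case: (j == i) => //.
exact: (measurableT_comp (measurable_coord j) mf).
Qed.

End configurations.
Arguments config {d} T I.

Section resampling.
Context {R : realType} {d d'} {Om : measurableType d} {T : measurableType d'}.
Context {I : eqType}.
Variables (Pr : probability Om R) (Z : Om -> config T I) (law : I -> probability T R).

(** Independence and the marginal laws are kept in one formula, so that two samples with different
    laws form a single family. *)
Definition independent_family := (forall i, measurable_fun setT (fun w => Z w i)) /\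
  forall (J : seq I) (A : I -> set T), uniq J -> (forall j, measurable (A j)) ->
    (Pr [set w | forall j, j \in J -> A j (Z w j)] = \prod_(j <- J) law j (A j))%E.

Hypothesis indepZ : independent_family.

Lemma measurable_family : measurable_fun setT Z.
Proof. by apply: measurable_config; exact: indepZ.1. Qed.

Lemma measurable_resample i :
  measurable_fun setT (fun s : T * Om => update (Z s.2) i s.1).
Proof.
apply: measurable_update => //.
exact: (measurableT_comp measurable_family).
Qed.

(** On a cylinder both image measures factor into the same product of marginal masses, whether or
    not [i] is among its indices; as cylinders form a pi-system, the measures coincide. The moment
    computations use independence through this replacement of one coordinate by a fresh draw. *)
Lemma resample_measure i (A : set (config T I)) : measurable A ->
  pushforward (law i \x Pr)%E (fun s => update (Z s.2) i s.1) A = pushforward Pr Z A.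
Proof.
move=> mA.
pose Z' : {mfun Om >-> config T I} :=
  HB.pack Z (isMeasurableFun.Build _ _ _ _ Z measurable_family).
pose Zi : {mfun (T * Om)%type >-> config T I} :=
  HB.pack (fun s : T * Om => update (Z s.2) i s.1)
    (isMeasurableFun.Build _ _ _ _ _ (measurable_resample i)).
refine (@measure_unique _ R (config T I) (@cylinders _ T I) (fun=> setT) erefl _ _ _
  (pushforward (law i \x Pr)%E Zi) (pushforward Pr Z') _ _ A mA).
- exact: setI_cylinders.
- move=> _; exists [::], (fun=> setT); split => //.
  by apply/seteqP; split.
- by apply/seteqP; split => // z _; exists 0%N.
- move=> _ [J [B [uJ mB ->]]].
  rewrite [RHS](_ : _ = (\prod_(j <- J) law j (B j))%E); last first.
    by rewrite -indepZ.2.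
  rewrite [LHS](_ : _ = (law i \x Pr)%E ((fun s : T * Om => update (Z s.2) i s.1) @^-1`
        (\bigcap_(j in [set` J]) [set z | B j (z j)])))//.
  pose J' := rem i J.
  have -> : (fun s : T * Om => update (Z s.2) i s.1) @^-1`
        (\bigcap_(j in [set` J]) [set z | B j (z j)]) =
      (if i \in J then B i else setT) `*` [set w | forall j, j \in J' -> B j (Z w j)].
    apply/seteqP; split => [[x w] /= h|[x w] /= [h1 h2]] /=.
      split.
        by case: ifP => // iJ; have := h i iJ; rewrite /= /update eqxx.
      move=> j; rewrite /J' (mem_rem_uniq _ uJ) !inE => /andP[ji jJ].
      by have := h j jJ; rewrite /= /update (negbTE ji).
    move=> j jJ /=; rewrite /update; case: eqP => [ji|/eqP ji].
      have iJ : i \in J by rewrite -ji; exact: jJ.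
      by move: h1; rewrite iJ ji.
    by apply: h2; rewrite /J' (mem_rem_uniq _ uJ) !inE ji.
  have mZJ : measurable [set w | forall j, j \in J' -> B j (Z w j)].
    have -> : [set w | forall j, j \in J' -> B j (Z w j)] =
        \bigcap_(j in [set` J']) ((fun w => Z w j) @^-1` B j) by [].
    apply: fin_bigcap_measurable => // j _.
    by rewrite -[X in measurable X]setTI; exact: indepZ.1.
  rewrite product_measure1E//; last by case: ifP.
  have uJ' : uniq J' by exact: rem_uniq.
  transitivity (law i (if i \in J then B i else setT) * \prod_(j <- J') law j (B j))%E.
    by congr (_ * _)%E; exact: indepZ.2.
  have [iJ|iJ] := boolP (i \in J).
    by rewrite [RHS](perm_big _ (perm_to_rem iJ)) /= big_cons.
  by rewrite /J' rem_id// probability_setT mul1e.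
- move=> _; rewrite [X in (X < _)%E](_ : _ = (law i \x Pr)%E setT)//.
  rewrite -setXTT product_measure1E//.
  apply: (@le_lt_trans _ _ (1 * 1)%E); last by rewrite mule1 ltry.
  by apply: lee_pmul; rewrite ?measure_ge0//; exact: probability_le1.
Unshelve. all: exact: measurable_funP.
Qed.

Lemma ge0_expectation_resample (i : I) (F : config T I -> \bar R) :
  measurable_fun [set: config T I] F -> (forall z, 0 <= F z)%E ->
  (\int[Pr]_w F (Z w) = \int[Pr]_w \int[law i]_x F (update (Z w) i x))%E.
Proof.
move=> mF F0.
pose Z' : {mfun Om >-> config T I} :=
  HB.pack Z (isMeasurableFun.Build _ _ _ _ Z measurable_family).
pose Zi : {mfun (T * Om)%type >-> config T I} :=
  HB.pack (fun s : T * Om => update (Z s.2) i s.1)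
    (isMeasurableFun.Build _ _ _ _ _ (measurable_resample i)).
have := @ge0_integral_pushforward _ _ _ _ R Z' (measurable_funP Z') Pr setT F measurableT mF.
rewrite preimage_setT => <-; last by move=> z _.
transitivity (\int[pushforward (law i \x Pr)%E Zi]_y F y)%E.
  by apply: eq_measure_integral => A mA _; exact/esym/resample_measure.
rewrite (@ge0_integral_pushforward _ _ _ _ R Zi (measurable_funP Zi) _ setT F)// preimage_setT.
rewrite fubini_tonelli2//.
- exact: measurableT_comp.
- by move=> s; exact: F0.
Unshelve. all: exact: measurable_funP.
Qed.

(** After resampling, Fubini integrates coordinate [i] first and finds 0 for every value of the
    others. Integrability on the product space is inherited because the two image measures agree. *)
Lemma expectation_resample_eq0 (i : I) (F : config T I -> R) :
  measurable_fun [set: config T I] F -> Pr.-integrable setT (fun w => (F (Z w))%:E) ->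
  (forall w, \int[law i]_x (F (update (Z w) i x))%:E = 0)%E ->
  (\int[Pr]_w (F (Z w))%:E = 0)%E.
Proof.
move=> mF iF F0.
pose Z' : {mfun Om >-> config T I} :=
  HB.pack Z (isMeasurableFun.Build _ _ _ _ Z measurable_family).
pose Zi : {mfun (T * Om)%type >-> config T I} :=
  HB.pack (fun s : T * Om => update (Z s.2) i s.1)
    (isMeasurableFun.Build _ _ _ _ _ (measurable_resample i)).
have mEF : measurable_fun setT (EFin \o F) by exact/measurable_EFinP.
have := @integral_pushforward _ _ _ _ R Z' (measurable_funP Z') Pr setT (EFin \o F) mEF.
rewrite preimage_setT => /(_ iF measurableT) <-.
transitivity (\int[pushforward (law i \x Pr)%E Zi]_y (EFin \o F) y)%E.
  by apply: eq_measure_integral => A mA _; exact/esym/resample_measure.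
have iFi : (law i \x Pr)%E.-integrable setT (EFin \o F \o Zi).
  apply/integrableP; split; first exact: measurableT_comp.
  case/integrableP : iF => _; apply: le_lt_trans.
  have <- := @ge0_integral_pushforward _ _ _ _ R Zi (measurable_funP Zi) (law i \x Pr)%E setT
    (abse \o (EFin \o F)) measurableT; last 2 first.
    by apply: measurableT_comp.
    by move=> *; exact: abse_ge0.
  rewrite (eq_measure_integral (pushforward Pr Z')); last first.
    by move=> A mA _; exact: resample_measure.
  rewrite (@ge0_integral_pushforward _ _ _ _ R Z' (measurable_funP Z'))//.
    exact: measurableT_comp.
  by move=> *; exact: abse_ge0.
rewrite (integral_pushforward (measurable_funP Zi) mEF _ measurableT) ?preimage_setT//.
rewrite -integral21_prod_meas1//.
by rewrite -(integral0 Pr setT); apply: eq_integral => w _; exact: F0.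
Unshelve. all: exact: measurable_funP.
Qed.

End resampling.

Section two_samples.
Context {R : realType} {d d'} {Om : measurableType d} {T : measurableType d'}.
Variables (Pr : probability Om R) (P Q : probability T R).

(* Coordinate inl i carries the i-th draw from P, inr j the j-th draw from Q. *)
Definition two_sample_law (i : nat + nat) : probability T R :=
  if i is inl _ then P else Q.

Variable (Z : Om -> config T (nat + nat)%type).
Hypothesis indepZ : independent_family Pr Z two_sample_law.

Lemma measurable_edge {d1} {U : measurableType d1} (i j : nat) (g : T * T -> U) :
  measurable_fun setT g ->
  measurable_fun [set: config T (nat + nat)%type] (fun z => g (z (inl i), z (inr j))).
Proof.
move=> mg; apply: (measurableT_comp mg).
by apply: measurable_fun_pair; exact: measurable_coord.
Qed.

Lemma ge0_expectation_resample2 (i j : nat) (F : config T (nat + nat)%type -> \bar R) :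
  measurable_fun [set: config T (nat + nat)%type] F -> (forall z, 0 <= F z)%E ->
  (\int[Pr]_w F (Z w) =
   \int[Pr]_w \int[(P \x Q)%E]_p F (update (update (Z w) (inr j) p.2) (inl i) p.1))%E.
Proof.
move=> mF F0; rewrite (ge0_expectation_resample indepZ (inl i) mF F0).
pose F2 (z : config T (nat + nat)%type) := (\int[P]_x F (update z (inl i) x))%E.
have mF2 : measurable_fun [set: config T (nat + nat)%type] F2.
  apply: (@measurable_fun_fubini_tonelli_G _ _ T (config T (nat + nat)%type) R P
    (fun p => F (update p.2 (inl i) p.1))) => //.
  by apply: (measurableT_comp mF); exact: measurable_update.
have F20 z : (0 <= F2 z)%E by apply: integral_ge0.
rewrite (ge0_expectation_resample indepZ (inr j) mF2 F20).
apply: eq_integral => w _; rewrite /F2 fubini_tonelli2//.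
apply: (measurableT_comp mF); apply: measurable_update => //.
exact: measurable_update.
Qed.

(** Distinct edges (i, s i) of a permutation share neither row nor column. Resampling the two
    endpoints of one edge therefore leaves the other factors unchanged and splits off one
    integral. *)
Lemma expectation_prod_edges N (s : 'S_N) (g : 'I_N -> T * T -> R) (r : seq 'I_N) :
  (forall i, measurable_fun setT (g i)) -> (forall i z, 0 <= g i z) -> uniq r ->
  (\int[Pr]_w (\prod_(i <- r) g i (Z w (inl (val i)), Z w (inr (val (s i)))))%:E =
   \prod_(i <- r) \int[(P \x Q)%E]_z (g i z)%:E)%E.
Proof.
move=> mg g0; elim: r => [_|i r IH /= /andP[ir ur]].
  rewrite big_nil; under eq_integral do rewrite big_nil.
  by rewrite integral_cst// mul1e; exact: probability_setT.
rewrite big_cons -IH//.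
pose G (z : config T (nat + nat)%type) :=
  \prod_(i <- r) g i (z (inl (val i)), z (inr (val (s i)))).
have mG : measurable_fun [set: config T (nat + nat)%type] G.
  by apply: measurable_prod => k _; exact: measurable_edge.
have G0 z : 0 <= G z by apply: prodr_ge0.
pose F (z : config T (nat + nat)%type) :=
  (g i (z (inl (val i)), z (inr (val (s i)))) * G z)%:E.
have -> : (\int[Pr]_w (\prod_(j <- (i :: r)) g j (Z w (inl (val j)), Z w (inr (val (s j)))))%:E =
   \int[Pr]_w F (Z w))%E.
  by apply: eq_integral => w _; rewrite big_cons.
rewrite (ge0_expectation_resample2 (val i) (val (s i))); last 2 first.
- apply/measurable_EFinP; apply: measurable_funM => //; exact: measurable_edge.
- by move=> z; rewrite lee_fin mulr_ge0.
rewrite -ge0_integralZl//; last 3 first.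
- by apply/measurable_EFinP; apply: (measurableT_comp mG); exact: measurable_family indepZ.
- by move=> w _; rewrite lee_fin; exact: (G0 (Z w)).
- by apply: integral_ge0 => z _; rewrite lee_fin.
apply: eq_integral => w _; rewrite muleC -ge0_integralZl//; last 3 first.
- exact/measurable_EFinP.
- by move=> z _; rewrite lee_fin.
- by rewrite lee_fin; exact: (G0 (Z w)).
apply: eq_integral => -[x y] _; rewrite /F -EFinM mulrC /=.
congr (_ * _)%:E; last by rewrite update_eq update_neq// update_eq.
rewrite /G; apply: eq_big_seq => k kr.
have ki : k != i by apply: contraNneq ir => <-.
have inlk : inl (val k) != inl (val i) :> nat + nat.
  by apply: contraNneq ki => -[/val_inj ->].
have inrk : inr (val (s k)) != inr (val (s i)) :> nat + nat.
  by apply: contraNneq ki => -[/val_inj/perm_inj ->].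
by rewrite !update_neq.
Qed.

End two_samples.

(** * Moments and deviations of permutation averages *)

(** The permanent of the matrix g(x_i, y_j) divided by N!. *)
Definition perm_average {R : realType} {T : Type} (g : T * T -> R) N (x y : nat -> T) : R :=
  (N`!)%:R^-1 * \sum_(s : 'S_N) \prod_(i < N) g (x i, y (s i)).

Section second_moment.
Context {R : realType} {d d'} {Om : measurableType d} {T : measurableType d'}.
Variables (Pr : probability Om R) (P Q : probability T R).
Variable (Z : Om -> config T (nat + nat)%type).
Hypothesis indepZ : independent_family Pr Z (two_sample_law P Q).
Variables (ze : T * T -> R) (chi : R).
Hypotheses (mze : measurable_fun setT ze) (ze0 : forall z, 0 <= ze z).
Hypothesis zeP : forall y, (\int[P]_x (ze (x, y))%:E = 1)%E.
Hypothesis zeQ : forall x, (\int[Q]_y (ze (x, y))%:E = 1)%E.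
Hypothesis ze2 : (\int[(P \x Q)%E]_z ((ze z - 1) ^+ 2)%:E = chi%:E)%E.
Hypothesis chi1 : chi < 1.

Let chi0 : 0 <= chi.
Proof.
by rewrite -lee_fin -ze2; apply: integral_ge0 => z _; rewrite lee_fin sqr_ge0.
Qed.

Let eta z := ze z - 1.

Let meta : measurable_fun setT eta.
Proof. by apply: measurable_funB => //. Qed.

(** [C] stands for the factors that do not involve the integrated coordinate. *)
Let eta_centered (mu : probability T R) (f : T -> R) (C : R) :
  measurable_fun setT f -> (forall x, 0 <= f x) -> (\int[mu]_x (f x)%:E = 1)%E ->
  (\int[mu]_x ((f x - 1) * C)%:E = 0)%E.
Proof.
move=> mf f0 f1.
have fi : mu.-integrable setT (EFin \o f).
  apply/integrableP; split; first exact/measurable_EFinP.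
  under eq_integral do rewrite /= ger0_norm//.
  by rewrite f1 ltry.
have ci : mu.-integrable setT (EFin \o (fun=> 1 : R)) by exact: finite_measure_integrable_cst.
have i1 : (\int[mu]_x (1%R)%:E = 1%E)%E.
  by rewrite integral_cst// mul1e; exact: probability_setT.
under eq_integral do rewrite EFinM.
rewrite integralZr//; last first.
  by have := integrableB measurableT fi ci; apply: eq_integrable => // x _; rewrite /= EFinB.
under eq_integral do rewrite EFinB.
by rewrite integralB_EFin// f1 i1 subee// mul0e.
Qed.

Variable N : nat.
Let K := ('S_N * {set 'I_N})%type.
(** The term of the subset [k.2] in the expansion of the product of 1 + eta over the edges of the
    permutation [k.1]. *)
Let E (k : K) (z : config T (nat + nat)%type) : R :=
  \prod_(i in k.2) eta (z (inl (val i)), z (inr (val (k.1 i)))).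

Let measurable_E k : measurable_fun [set: config T (nat + nat)%type] (E k).
Proof.
have -> : E k = fun z => \prod_(i <- enum k.2) eta (z (inl (val i)), z (inr (val (k.1 i)))).
  by apply/funext => z; rewrite big_enum.
by apply: measurable_prod => i _; exact: measurable_edge.
Qed.

Let measurable_EZ k : measurable_fun setT (E k \o Z).
Proof. exact: (measurableT_comp (measurable_E k) (measurable_family indepZ)). Qed.

Let E_update_row_notin (k : K) (i : 'I_N) x z : i \notin k.2 ->
  E k (update z (inl (val i)) x) = E k z.
Proof.
move=> iA; apply: eq_bigr => j jA; rewrite !update_neq//.
by apply: contraNneq iA => -[/val_inj <-].
Qed.

Let E_update_row_in (k : K) (i : 'I_N) x z : i \in k.2 -> E k (update z (inl (val i)) x) =
  eta (x, z (inr (val (k.1 i)))) *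
    \prod_(j in k.2 | j != i) eta (z (inl (val j)), z (inr (val (k.1 j)))).
Proof.
move=> iA; rewrite /E (bigD1 i)//= update_eq update_neq//; congr (_ * _).
by apply: eq_bigr => j /andP[_ ji]; rewrite !update_neq.
Qed.

Let E_update_col_notin (k : K) (j : 'I_N) x z : j \notin k.1 @: k.2 ->
  E k (update z (inr (val j)) x) = E k z.
Proof.
move=> jA; apply: eq_bigr => i iA; rewrite !update_neq//.
by apply: contraNneq jA => -[/val_inj <-]; exact: imset_f.
Qed.

Let E_update_col_in (k : K) (i : 'I_N) x z : i \in k.2 -> E k (update z (inr (val (k.1 i))) x) =
  eta (z (inl (val i)), x) *
    \prod_(j in k.2 | j != i) eta (z (inl (val j)), z (inr (val (k.1 j)))).
Proof.
move=> iA; rewrite /E (bigD1 i)//= update_eq update_neq//; congr (_ * _).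
apply: eq_bigr => j /andP[_ ji]; rewrite !update_neq//.
by apply: contraNneq ji => -[/val_inj/perm_inj <-].
Qed.

Let expectation_E2 (k : K) : (\int[Pr]_w (E k (Z w) ^+ 2)%:E = (chi ^+ #|k.2|)%:E)%E.
Proof.
have := expectation_prod_edges indepZ k.1 (g := fun=> fun z => eta z ^+ 2) (r := enum k.2)
  (fun=> measurable_funX 2 meta) (fun _ _ => sqr_ge0 _) (enum_uniq _).
under eq_integral do rewrite big_enum/= prodrXl.
move=> ->; rewrite (eq_bigr (fun=> chi%:E)) => [|? _]; last exact: ze2.
by rewrite big_enum /= prodEFin prodr_const.
Qed.

Let integrable_E2 (k : K) : Pr.-integrable setT (fun w => (E k (Z w) ^+ 2)%:E).
Proof.
apply/integrableP; split.
  by apply/measurable_EFinP; apply: measurable_funX; exact: measurable_EZ.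
under eq_integral do rewrite /= ger0_norm ?sqr_ge0//.
by rewrite expectation_E2 ltry.
Qed.

Let integrable_EE (k l : K) : Pr.-integrable setT (fun w => (E k (Z w) * E l (Z w))%:E).
Proof.
apply: (le_integrable measurableT _ _
  (integrableD measurableT (integrable_E2 k) (integrable_E2 l))).
  by apply/measurable_EFinP; apply: measurable_funM; exact: measurable_EZ.
move=> w _; rewrite /= lee_fin normrM.
set x := E k (Z w); set y := E l (Z w).
rewrite [leRHS]ger0_norm ?addr_ge0 ?sqr_ge0//.
rewrite -(real_normK (num_real x)) -(real_normK (num_real y)).
move: `|x| `|y| (normr_ge0 x) (normr_ge0 y) => a b a0 b0.
have := sqr_ge0 (a - b); have := mulr_ge0 a0 b0; lra.
Qed.

Let expectation_EE_le (k l : K) : k.2 = l.2 ->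
  (\int[Pr]_w (E k (Z w) * E l (Z w))%:E <= (chi ^+ #|k.2|)%:E)%E.
Proof.
move=> kl.
apply: (@le_trans _ _ (\int[Pr]_w (2^-1%:E * ((E k (Z w) ^+ 2)%:E + (E l (Z w) ^+ 2)%:E)))%E).
  apply: le_integral => //.
    by apply: integrableZl => //; exact: integrableD.
  move=> w _; rewrite -EFinD -EFinM lee_fin.
  have := sqr_ge0 (E k (Z w) - E l (Z w)); nra.
rewrite integralZl//; last exact: integrableD.
rewrite integralD// !expectation_E2 kl -EFinD -EFinM lee_fin; lra.
Qed.

(* Some coordinate occurs in one product only, and eta is centered in it. *)
Let expectation_EE0 (k l : K) : (k.2 != l.2) || (k.1 @: k.2 != l.1 @: l.2) ->
  (\int[Pr]_w (E k (Z w) * E l (Z w))%:E = 0)%E.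
Proof.
(* By symmetry, the coordinate that occurs in one product only may be taken in the product of
   [k]. *)
wlog [i ik] : k l / exists i, i \in k.2 /\ (i \notin l.2 \/ k.1 i \notin l.1 @: l.2).
  move=> W kl.
  have [[i [ik il]]|[i [il ik]]] :
      (exists i, i \in k.2 /\ (i \notin l.2 \/ k.1 i \notin l.1 @: l.2)) \/
      (exists i, i \in l.2 /\ (i \notin k.2 \/ l.1 i \notin k.1 @: k.2)).
    have [kl2|] := eqVneq k.2 l.2; last first.
      rewrite finset.eqEsubset negb_and => /orP[] /fintype.subsetPn[i iA iB]; [left|right];
        by exists i; split => //; left.
    (* With equal row sets the two images have the same cardinality, so distinct images give a
       column met by [k] and not by [l]. *)
    move: kl; rewrite kl2 eqxx /= => kl.
    left; have : ~~ (k.1 @: l.2 \subset l.1 @: l.2).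
      apply: contra kl => sub; rewrite finset.eqEcard sub /=.
      by rewrite !(card_imset _ perm_inj).
    move=> /fintype.subsetPn[_ /imsetP[i il ->] il']; exists i; split => //; right => //.
  - by apply: W => //; exists i.
  - under eq_integral do rewrite mulrC.
    by apply: W; [exists i|rewrite eq_sym [X in _ || ~~ X]eq_sym].
move=> _; case: ik => ik [il|il].
  apply: (@expectation_resample_eq0 _ _ _ _ _ _ _ _ _ indepZ (inl (val i))
    (fun z => E k z * E l z)).
  - exact: measurable_funM.
  - exact: integrable_EE.
  - move=> w; under eq_integral do rewrite E_update_row_in// E_update_row_notin// -mulrA.
    apply: (eta_centered (f := fun x => ze (x, _))) => //.
    exact: measurable_fun_pair1.
apply: (@expectation_resample_eq0 _ _ _ _ _ _ _ _ _ indepZ (inr (val (k.1 i)))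
  (fun z => E k z * E l z)).
- exact: measurable_funM.
- exact: integrable_EE.
- move=> w; under eq_integral do rewrite E_update_col_in// E_update_col_notin// -mulrA.
  apply: (eta_centered (f := fun y => ze (_, y))) => //.
  exact: measurable_fun_pair2.
Qed.

Let sum_pairs (f : K -> R) : \sum_(k : K | k.2 != finset.set0) f k =
  \sum_(s : 'S_N) \sum_(A : {set 'I_N} | A != finset.set0) f (s, A).
Proof. by rewrite pair_big_dep; apply: eq_big => -[]. Qed.

Let perm_averageE (z : config T (nat + nat)%type) :
  perm_average ze N (z \o inl) (z \o inr) - 1 =
  (N`!)%:R^-1 * \sum_(k : K | k.2 != finset.set0) E k z.
Proof.
have NN : (N`!)%:R != 0 :> R by rewrite pnatr_eq0 -lt0n fact_gt0.
rewrite [X in _ - X](_ : 1 = (N`!)%:R^-1 * \sum_(s : 'S_N) (1 : R)); last first.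
  by rewrite sumr_const card_Sn mulVf.
rewrite -mulrBr -sumrB; congr (_ * _).
rewrite sum_pairs.
apply: eq_bigr => s _.
have -> : \prod_(i < N) ze ((z \o inl) (i : nat), (z \o inr) (s i : nat)) =
    \sum_(A : {set 'I_N}) E (s, A) z.
  rewrite (eq_bigr (fun i : 'I_N => eta (z (inl (val i)), z (inr (val (s i)))) + 1)); last first.
    by move=> i _; rewrite /eta subrK.
  rewrite bigA_distr; apply: eq_bigr => A _.
  by rewrite /E -big_mkcond.
rewrite (bigD1 finset.set0)//= [X in X + _ - _](_ : _ = 1) 1?addrAC ?subrr ?add0r//.
by rewrite /E big_pred0// => i; rewrite inE.
Qed.

Let integrable_sum_EFin (h : K -> Om -> R) :
  (forall k, Pr.-integrable setT (fun w => (h k w)%:E)) ->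
  Pr.-integrable setT (fun w => (\sum_(k : K | k.2 != finset.set0) h k w)%:E).
Proof.
move=> ih; rewrite (_ : (fun w => _) =
    fun w => (\sum_(k : K | k.2 != finset.set0) (h k w)%:E)%E); last first.
  by apply/funext => w; rewrite sumEFin.
exact: integrable_sum.
Qed.

Let expectation_sum_EFin (h : K -> Om -> R) :
  (forall k, Pr.-integrable setT (fun w => (h k w)%:E)) ->
  (\int[Pr]_w (\sum_(k : K | k.2 != finset.set0) h k w)%:E =
   \sum_(k : K | k.2 != finset.set0) \int[Pr]_w (h k w)%:E)%E.
Proof.
by move=> ih; under eq_integral do rewrite -sumEFin; rewrite integral_sum.
Qed.

(** Two terms (s, A) and (t, B) are correlated only if A = B and s(A) = t(A), and then by at most
    chi^|A|. For given s and A, [card_perm_same_image] counts the admissible t; the sum over A is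
    geometric, and the N! choices of s together with the N! of that sum cancel the square of 1 /
    N!. *)
Lemma perm_average_variance :
  (\int[Pr]_w ((perm_average ze N (Z w \o inl) (Z w \o inr) - 1) ^+ 2)%:E
     <= (chi / (1 - chi))%:E)%E.
Proof.
pose c : R := (N`!)%:R^-1.
have f0 : 0 < (N`!)%:R :> R by rewrite ltr0n fact_gt0.
pose S := [seq k <- index_enum K | k.2 != finset.set0].
have -> : (\int[Pr]_w ((perm_average ze N (Z w \o inl) (Z w \o inr) - 1) ^+ 2)%:E =
    (c ^+ 2)%:E * \sum_(k : K | k.2 != finset.set0) \sum_(l : K | l.2 != finset.set0)
      \int[Pr]_w (E k (Z w) * E l (Z w))%:E)%E.
  under eq_integral do rewrite perm_averageE exprMn [X in _ * X]expr2 big_distrlr /= EFinM.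
  rewrite integralZl//; last first.
    by apply: integrable_sum_EFin => k; exact: integrable_sum_EFin.
  congr (_ * _)%E; rewrite expectation_sum_EFin; last first.
    by move=> k; exact: integrable_sum_EFin.
  by apply: eq_bigr => k _; exact: expectation_sum_EFin.
pose b (k l : K) : R :=
  if (k.2 == l.2) && (k.1 @: k.2 == l.1 @: k.2) then chi ^+ #|k.2| else 0.
apply: (@le_trans _ _ ((c ^+ 2)%:E * \sum_(k : K | k.2 != finset.set0)
    \sum_(l : K | l.2 != finset.set0) (b k l)%:E)%E).
  rewrite lee_wpmul2l ?lee_fin ?sqr_ge0//; apply: lee_sum => k _; apply: lee_sum => l _.
  rewrite /b; have [kl /=|kl] := eqVneq k.2 l.2; last first.
    by rewrite expectation_EE0// kl.
  case: ifPn => [_|kl']; first exact: expectation_EE_le.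
  by rewrite expectation_EE0// -kl kl' orbT.
under eq_bigr do rewrite sumEFin.
rewrite sumEFin -EFinM lee_fin.
have bl (k : K) : k.2 != finset.set0 -> \sum_(l : K | l.2 != finset.set0) b k l <=
    ((#|k.2|)`! * (N - #|k.2|)`!)%:R * chi ^+ #|k.2|.
  move=> k0; rewrite sum_pairs.
  rewrite (eq_bigr (fun t : 'S_N => (t @: k.2 == k.1 @: k.2)%:R * chi ^+ #|k.2|)); last first.
    move=> t _; rewrite (bigD1 k.2)//= big1 => [|A /andP[_ Ak]]; last first.
      by rewrite /b /= eq_sym (negbTE Ak).
    by rewrite /b /= eqxx /= addr0 eq_sym; case: eqP; rewrite ?mul1r ?mul0r.
  rewrite -mulr_suml ler_wpM2r ?exprn_ge0//.
  rewrite -natr_sum ler_nat; apply: leq_trans (card_perm_same_image k.1 k.2).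
  by rewrite -sum1_card [leqRHS]big_mkcond /=; apply: leq_sum => t _; rewrite inE; case: eqP.
apply: (@le_trans _ _ (c ^+ 2 * \sum_(k : K | k.2 != finset.set0)
    ((#|k.2|)`! * (N - #|k.2|)`!)%:R * chi ^+ #|k.2|)).
  by rewrite ler_wpM2l ?sqr_ge0//; exact: ler_sum.
rewrite sum_pairs.
have hA := sum_subsets_geometric_le N chi0 chi1.
apply: (@le_trans _ _ (c ^+ 2 * \sum_(s : 'S_N) (N`!%:R * (chi / (1 - chi))))).
  by rewrite ler_wpM2l ?sqr_ge0//; apply: ler_sum.
rewrite sumr_const card_Sn -[X in _ * X]mulr_natl /c.
have fn : (N`!)%:R != 0 :> R by rewrite gt_eqF.
move: (chi / (1 - chi)) (N`!)%:R fn => y f fn.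
by rewrite le_eqVlt; apply/orP; left; apply/eqP; field.
Qed.

End second_moment.

Lemma markov_le {R : realType} {d} {T : measurableType d} (mu : probability T R)
    (f : T -> R) (a : R) (m : \bar R) : measurable_fun setT f -> (forall x, 0 <= f x) -> 0 < a ->
  (\int[mu]_x (f x)%:E <= a%:E * m)%E ->
  (mu [set x | (a <= f x)%R] <= m)%E.
Proof.
move=> mf f0 a0 hm.
set A := [set x | a <= f x].
have mA : measurable A.
  by rewrite -[X in measurable X]setTI; exact: measurable_fun_ler.
suff h : (a%:E * mu A <= a%:E * m)%E by rewrite lee_pmul2l in h.
apply: le_trans hm; rewrite -integral_cst//.
apply: (@le_trans _ _ (\int[mu]_(x in A) (f x)%:E)%E).
  apply: ge0_le_integral => //.
  - by move=> x _; rewrite lee_fin ltW.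
  - exact/measurable_EFinP/measurable_funTS.
apply: ge0_subset_integral => //; first exact/measurable_EFinP.
by move=> x _; rewrite lee_fin.
Qed.

Section moments.
Context {R : realType} {d d'} {Om : measurableType d} {T : measurableType d'}.
Variables (Pr : probability Om R) (P Q : probability T R).
Variable (Z : Om -> config T (nat + nat)%type).
Hypothesis indepZ : independent_family Pr Z (two_sample_law P Q).

Lemma expectation_prod_perm (g : T * T -> R) (m : R) N (s : 'S_N) :
  measurable_fun setT g -> (forall z, 0 <= g z) ->
  (\int[(P \x Q)%E]_z (g z)%:E = m%:E)%E ->
  (\int[Pr]_w (\prod_(i < N) g (Z w (inl (val i)), Z w (inr (val (s i)))))%:E = (m ^+ N)%:E)%E.
Proof.
move=> mg g0 gm.
have := expectation_prod_edges indepZ s (g := fun=> g) (r := index_enum 'I_N)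
  (fun=> mg) (fun _ => g0) (index_enum_uniq _).
by rewrite gm prodEFin prodr_const card_ord.
Qed.

Lemma measurable_prod_perm (g : T * T -> R) N (s : 'S_N) : measurable_fun setT g ->
  measurable_fun setT
    (fun w => \prod_(i < N) g ((Z w \o inl) (val i), (Z w \o inr) (val (s i)))).
Proof.
move=> mg; apply: measurable_prod => i _.
exact: (measurableT_comp (measurable_edge _ _ mg) (measurable_family indepZ)).
Qed.

Lemma measurable_perm_average (g : T * T -> R) N : measurable_fun setT g ->
  measurable_fun setT (fun w => perm_average g N (Z w \o inl) (Z w \o inr)).
Proof.
move=> mg; apply: measurable_funM => //; apply: measurable_sum => s.
exact: measurable_prod_perm.
Qed.

Lemma expectation_perm_average (g : T * T -> R) (m : R) N :
  measurable_fun setT g -> (forall z, 0 <= g z) ->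
  (\int[(P \x Q)%E]_z (g z)%:E = m%:E)%E ->
  (\int[Pr]_w (perm_average g N (Z w \o inl) (Z w \o inr))%:E = (m ^+ N)%:E)%E.
Proof.
move=> mg g0 gm; rewrite /perm_average.
have f0 : 0 <= (N`!)%:R^-1 :> R by rewrite invr_ge0.
under eq_integral do rewrite EFinM.
rewrite ge0_integralZl//; last 2 first.
- by apply/measurable_EFinP; apply: measurable_sum => s; exact: measurable_prod_perm.
- by move=> w _; rewrite lee_fin; apply: sumr_ge0 => s _; exact: prodr_ge0.
under eq_integral do rewrite -sumEFin.
rewrite ge0_integral_sum//; last 2 first.
- by move=> s; apply/measurable_EFinP; exact: measurable_prod_perm.
- by move=> s w _; rewrite lee_fin; exact: prodr_ge0.
under eq_bigr do rewrite (expectation_prod_perm _ mg g0 gm).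
rewrite sumEFin sumr_const card_Sn -EFinM -[X in (_ * X)%:E]mulr_natl mulKf//.
Qed.

Lemma perm_average_upper_tail (g : T * T -> R) (del : R) N :
  measurable_fun setT g -> (forall z, 0 <= g z) -> (\int[(P \x Q)%E]_z (g z)%:E = 1)%E ->
  (Pr [set w | (expR (del * N%:R) <= perm_average g N (Z w \o inl) (Z w \o inr))%R]
     <= (expR (- (del * N%:R)))%:E)%E.
Proof.
move=> mg g0 g1; apply: markov_le.
- exact: measurable_perm_average.
- by move=> w; rewrite mulr_ge0 ?invr_ge0//; apply: sumr_ge0 => s _; exact: prodr_ge0.
- exact: expR_gt0.
- by rewrite (expectation_perm_average _ mg g0 g1) expr1n -EFinM -expRD subrr expR0.
Qed.

Section deviations.
Variables (ze : T * T -> R) (B : T * T -> bool) (b : R).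
Hypotheses (mze : measurable_fun setT ze) (ze0 : forall z, 0 <= ze z).
Hypothesis ze1 : (\int[(P \x Q)%E]_z (ze z)%:E = 1)%E.
Hypothesis mB : measurable [set z | B z].
Hypothesis zeB : (\int[(P \x Q)%E]_(z in [set z | B z]) (ze z)%:E = b%:E)%E.

Definition deviating_average (th : R) N (x y : nat -> T) : R :=
  (N`!)%:R^-1 * \sum_(s : 'S_N | th <= #|finset (fun i : 'I_N => B (x i, y (s i)))|%:R)
     \prod_(i < N) ze (x i, y (s i)).

Let mtilt (u : R) : measurable_fun setT (fun z => ze z * (if B z then u else 1)).
Proof.
apply: measurable_funM => //; apply: measurable_fun_ifT => //.
by apply: (measurable_fun_bool true); rewrite setTI.
Qed.

Lemma measurable_deviating_average th N :
  measurable_fun setT (fun w => deviating_average th N (Z w \o inl) (Z w \o inr)).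
Proof.
apply: measurable_funM => //.
under eq_fun do rewrite big_mkcond.
apply: measurable_sum => s; apply: measurable_fun_ifT => //; last exact: measurable_prod_perm.
apply: measurable_fun_ler => //.
rewrite [X in measurable_fun _ X](_ : _ = fun w => \sum_(i < N)
  (if B ((Z w \o inl) (val i), (Z w \o inr) (val (s i))) then 1 else 0 : R)); last first.
  apply/funext => w; rewrite -sum1_card natr_sum [LHS]big_mkcond /=.
  by apply: eq_bigr => i _; rewrite inE.
apply: measurable_sum => i; apply: measurable_fun_ifT => //.
apply: (measurableT_comp (measurable_edge _ _ _) (measurable_family indepZ)).
by apply: (measurable_fun_bool true); rewrite setTI.
Qed.

(** Weight by the product of [ze] along a fixed permutation: its edges become independent and fall
    in [B] with probability [b]. Chernoff's method applies, with gam / 4 chosen as in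
    [finite_chernoff]. *)
Lemma expectation_deviating_average (gam : R) N : 0 <= gam -> gam <= 2 ->
  (\int[Pr]_w (deviating_average (N%:R * b + gam * N%:R) N (Z w \o inl) (Z w \o inr))%:E
    <= (expR (- (gam ^+ 2 / 8 * N%:R)))%:E)%E.
Proof.
move=> g0 g2; pose t := gam / 4; have t0 : 0 <= t by rewrite /t; lra.
have t2 : t <= 2^-1 by rewrite /t; lra.
pose th := N%:R * b + gam * N%:R.
pose g z := ze z * (if B z then expR t else 1).
have g_ge0 z : 0 <= g z by rewrite mulr_ge0//; case: ifP => // _; exact: expR_ge0.
have mg : measurable_fun setT g by exact: mtilt.
have f0 : 0 <= (N`!)%:R^-1 :> R by rewrite invr_ge0.
have b0 : 0 <= b.
  by rewrite -lee_fin -zeB; apply: integral_ge0 => z _; rewrite lee_fin.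
have b1 : b <= 1.
  rewrite -lee_fin -zeB -ze1; apply: ge0_subset_integral => //; first exact/measurable_EFinP.
  by move=> z _; rewrite lee_fin.
(* The tilt is 1 + (e^t - 1) times the indicator of [B], so one edge has mean 1 + b (e^t - 1). *)
have gm : (\int[(P \x Q)%E]_z (g z)%:E = (1 + b * (expR t - 1))%:E)%E.
  have e1 : 0 <= expR t - 1 by rewrite subr_ge0 -expR0 ler_expR.
  pose zB := (EFin \o ze) \_ [set z | B z].
  have zBE z : zB z = if B z then (ze z)%:E else 0%E.
    by rewrite /zB patchE mem_setE.
  have -> : (\int[(P \x Q)%E]_z (g z)%:E =
      \int[(P \x Q)%E]_z ((ze z)%:E + (expR t - 1)%:E * zB z))%E.
    apply: eq_integral => z _; rewrite /g zBE.
    case: (B z); last by rewrite mule0 adde0 mulr1.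
    by rewrite -EFinM -EFinD; congr (_%:E); ring.
  have mzB : measurable_fun setT zB.
    by apply/(measurable_restrictT _ mB)/measurable_funTS/measurable_EFinP.
  have zB0 z : (0 <= zB z)%E by rewrite zBE; case: ifP => //; rewrite lee_fin.
  rewrite ge0_integralD//; last 4 first.
  - by move=> z _; rewrite lee_fin.
  - exact/measurable_EFinP.
  - by move=> z _; rewrite mule_ge0// lee_fin.
  - exact: emeasurable_funM.
  rewrite ge0_integralZl// ?lee_fin//.
  by rewrite -integral_mkcond zeB ze1 -EFinM -EFinD mulrC.
have mG : measurable_fun setT (fun w => perm_average g N (Z w \o inl) (Z w \o inr)).
  exact: measurable_perm_average.
apply: (@le_trans _ _ (\int[Pr]_w ((expR (- (t * th)))%:E *
    (perm_average g N (Z w \o inl) (Z w \o inr))%:E))%E).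
  apply: ge0_le_integral => //.
  - by move=> w _; rewrite lee_fin mulr_ge0//; apply: sumr_ge0 => s _; exact: prodr_ge0.
  - by apply/measurable_EFinP; exact: measurable_deviating_average.
  - by apply: emeasurable_funM => //; exact/measurable_EFinP.
  (* Where the count reaches [th], the factor exp(t (count - th)) is at least 1; the remaining
     permutations contribute nonnegative terms. *)
  - move=> w _; rewrite -EFinM lee_fin mulrCA ler_wpM2l// mulr_sumr big_mkcond.
    apply: ler_sum => s _; rewrite /g big_split /= -big_mkcond /= prodr_const -expRM_natl.
    set c := #|_|; rewrite (_ : #|_| = c); last by apply: eq_card => i; rewrite !inE.
    have pz : 0 <= \prod_(i < N) ze (Z w (inl (val i)), Z w (inr (val (s i)))).
      exact: prodr_ge0.
    rewrite mulrCA -expRD; case: ifPn => [thc|_]; last by rewrite mulr_ge0// expR_ge0.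
    rewrite -[leLHS]mulr1 ler_wpM2l// -[leLHS]expR0 ler_expR; move: thc; rewrite -/th => thc.
    have : 0 <= t * (c%:R - th) by rewrite mulr_ge0 ?subr_ge0.
    lra.
rewrite ge0_integralZl//; last 2 first.
- exact/measurable_EFinP.
- by move=> w _; rewrite lee_fin mulr_ge0//; apply: sumr_ge0 => s _; exact: prodr_ge0.
rewrite (expectation_perm_average _ mg g_ge0 gm) -EFinM lee_fin.
have hb : (1 + b * (expR t - 1)) ^+ N <= expR (b * t + 2 * t ^+ 2) ^+ N.
  have et : 0 <= expR t - 1 by rewrite subr_ge0 -expR0 ler_expR.
  have q := expR_le_quadratic t2; have e1 := expR_ge1Dx (b * t + 2 * t ^+ 2).
  have h1 : b * (expR t - 1) <= b * (t + 2 * t ^+ 2) by apply: ler_wpM2l => //; lra.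
  have h2 : b * (2 * t ^+ 2) <= 1 * (2 * t ^+ 2).
    by apply: ler_wpM2r => //; rewrite mulr_ge0// sqr_ge0.
  have h3 : 0 <= b * (expR t - 1) by rewrite mulr_ge0.
  apply: lerXn2r; rewrite ?nnegrE ?expR_ge0//; first lra.
  by apply: le_trans e1; move: h1; rewrite mulrDr; lra.
apply: le_trans (ler_wpM2l (expR_ge0 _) hb) _.
rewrite -expRM_natl -expRD ler_expR le_eqVlt; apply/orP; left; apply/eqP.
by rewrite /th /t; field.
Qed.

End deviations.
End moments.

(** * Truncation and the weak law of large numbers *)

Section tails.
Context {R : realType} {d} {T : measurableType d} (mu : probability T R).

(** Dominated convergence: at each point the cut-off function vanishes once the level exceeds its
    value. A positive [M] is requested so that later constants can be divided by it. *)
Lemma integral_large_values (f : T -> R) (e : R) : measurable_fun setT f ->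
  (forall x, 0 <= f x) -> (\int[mu]_x (f x)%:E < +oo)%E -> 0 < e ->
  exists M : nat, (0 < M)%N /\ (\int[mu]_x (if f x <= M%:R then 0 else f x)%:E <= e%:E)%E.
Proof.
move=> mf f0 foo e0.
pose g (n : nat) x := (if f x <= n%:R then 0 else f x)%:E : \bar R.
have mg n : measurable_fun setT (g n).
  apply/measurable_EFinP; apply: measurable_fun_ifT => //.
  exact: measurable_fun_ler.
have fi : mu.-integrable setT (EFin \o f).
  apply/integrableP; split; first exact/measurable_EFinP.
  by under eq_integral do rewrite /= ger0_norm//.
have [] := @dominated_convergence _ _ _ mu setT measurableT g (cst 0%E) (EFin \o f) mg
  (measurable_cst _) _ fi _.
- apply: aeW => x _; apply: cvg_near_cst; near=> n; rewrite /g.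
  suff -> : f x <= n%:R by [].
  near: n; exists (Num.bound (f x)) => // n /= hn.
  by rewrite (le_trans (ltW (archi_boundP (f0 x))))// ler_nat.
- apply: aeW => x n _; rewrite /g; case: ifP => _; rewrite /= ?normr0 ?lee_fin//.
  by rewrite ger0_norm.
move=> _ _; rewrite integral0 => /fine_cvgP[fin /cvgrPdist_le/(_ e e0)].
move=> near1.
have [n [[/= ufin ule] n0]] := filter_ex (filterI (filterI fin near1) (nbhs_infty_gt 0)).
exists n; split => //.
rewrite -(fineK ufin) lee_fin; move: ule; rewrite /= sub0r normrN.
by apply: le_trans; exact: ler_norm.
Unshelve. all: by end_near. Qed.

End tails.

Section weak_law.
Context {R : realType} {d d'} {Om : measurableType d} {T : measurableType d'}.
Variables (Pr : probability Om R) (P Q : probability T R).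
Variable (Z : Om -> config T (nat + nat)%type).
Hypothesis indepZ : independent_family Pr Z (two_sample_law P Q).
Local Notation mu := (P \x Q)%E.

Definition pair_sum (h : T * T -> R) N w := \sum_(i < N) h (Z w (inl (val i)), Z w (inr (val i))).

Lemma measurable_pair_sum h N : measurable_fun setT h -> measurable_fun setT (pair_sum h N).
Proof.
move=> mh; apply: measurable_sum => i.
exact: (measurableT_comp (measurable_edge _ _ mh) (measurable_family indepZ)).
Qed.

Lemma ge0_expectation_pair_sum (h : T * T -> R) N :
  measurable_fun setT h -> (forall z, 0 <= h z) ->
  (\int[Pr]_w (pair_sum h N w)%:E = N%:R%:E * \int[mu]_z (h z)%:E)%E.
Proof.
move=> mh h0; rewrite /pair_sum.
under eq_integral do rewrite -sumEFin.
rewrite ge0_integral_sum//; last 2 first.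
- move=> i; apply/measurable_EFinP.
  exact: (measurableT_comp (measurable_edge _ _ mh) (measurable_family indepZ)).
- by move=> i w _; rewrite lee_fin.
rewrite (eq_bigr (fun=> \int[mu]_z (h z)%:E)%E) => [|i _]; last first.
  transitivity (\prod_(j <- [:: i]) \int[mu]_z (h z)%:E)%E; last by rewrite big_seq1.
  rewrite -(expectation_prod_edges indepZ (1 : 'S_N)%g (g := fun=> h))//.
  by apply: eq_integral => w _; rewrite big_seq1 perm1.
by rewrite mule_natl big_const_ord iter_addr_0.
Qed.

(** The pairs (X_i, Y_i) are the edges of the identity permutation, so the exponential moment of
    their sum factors by [expectation_prod_perm]. *)
Lemma chernoff_bound (h : T * T -> R) (M gam : R) N :
  measurable_fun setT h -> (forall z, `|h z| <= M) -> (\int[mu]_z (h z)%:E = 0)%E ->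
  0 < gam -> gam <= 2 * M ->
  (Pr [set w | (gam * N%:R <= pair_sum h N w)%R] <=
    (expR (- (gam ^+ 2 / (8 * M ^+ 2) * N%:R)))%:E)%E.
Proof.
move=> mh hM hc g0 gM.
have M0 : 0 < M by lra.
(* The exponent 2 t^2 M^2 - gam t is minimal here, with value - gam^2 / (8 M^2); gam <= 2 M gives t
   M <= 1/2, the range of the quadratic bound. *)
have [t tE] : exists t, t = gam / (4 * M ^+ 2) by exists (gam / (4 * M ^+ 2)).
have t0 : 0 < t by rewrite tE divr_gt0// mulr_gt0// exprn_gt0.
have tM : t * M <= 2^-1.
  rewrite tE -(ler_pM2r (_ : 0 < 4 * M)) ?mulr_gt0//.
  have -> : gam / (4 * M ^+ 2) * M * (4 * M) = gam by field; rewrite gt_eqF.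
  lra.
have hi : mu.-integrable setT (EFin \o h).
  apply: measurable_bounded_integrable => //.
    by apply: (@le_lt_trans _ _ 1%E); [exact: probability_le1|exact: ltry].
  by exists M; split; [exact: num_real|move=> x Mx z _ /=; rewrite (le_trans (hM z))// ltW].
pose e z := expR (t * h z).
have me : measurable_fun setT e.
  by apply: measurableT_comp => //; exact: measurable_funM.
have e_le z : e z <= (1 + 2 * t ^+ 2 * M ^+ 2) + t * h z.
  have /andP[h1 h2] : - M <= h z <= M by rewrite -ler_norml.
  have th : t * h z <= 2^-1.
    by apply: le_trans tM; rewrite ler_wpM2l// ltW.
  apply: le_trans (expR_le_quadratic th) _.
  have : (h z) ^+ 2 <= M ^+ 2 by rewrite -real_normK ?num_real// lerXn2r ?nnegrE ?normr_ge0// ltW.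
  move=> /(ler_wpM2l (sqr_ge0 t)); rewrite exprMn; lra.
have ei : (\int[mu]_z (e z)%:E <= (1 + 2 * t ^+ 2 * M ^+ 2)%:E)%E.
  have ci k : mu.-integrable setT (EFin \o (fun=> k : R)).
    apply/integrableP; split; first exact/measurable_EFinP.
    rewrite integral_cst//; apply: (@le_lt_trans _ _ (`|k|%:E * 1)%E); last by rewrite mule1 ltry.
    by rewrite lee_wpmul2l ?lee_fin//; exact: probability_le1.
  have thi : mu.-integrable setT (fun z => (t * h z)%:E).
    by under eq_fun do rewrite EFinM; exact: integrableZl.
  apply: (@le_trans _ _ (\int[mu]_z ((1 + 2 * t ^+ 2 * M ^+ 2) + t * h z)%:E)%E).
    apply: ge0_le_integral => //.
    - by move=> z _; rewrite lee_fin expR_ge0.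
    - exact/measurable_EFinP.
    - by apply/measurable_EFinP; apply: measurable_funD => //; exact: measurable_funM.
    - by move=> z _; rewrite lee_fin.
  under eq_integral do rewrite EFinD.
  have th0 : (\int[mu]_z (t * h z)%:E = 0)%E.
    by under eq_integral do rewrite EFinM; rewrite integralZl// hc mule0.
  rewrite (integralD_EFin measurableT (ci _) thi) th0 adde0 integral_cst//.
  rewrite [X in (_ * X)%E](_ : _ = 1%E) ?mule1//; exact: probability_setT.
have e0 z : 0 <= e z by exact: expR_ge0.
pose m := fine (\int[mu]_z (e z)%:E)%E.
have em : (\int[mu]_z (e z)%:E = m%:E)%E.
  rewrite fineK// ge0_fin_numE ?(le_lt_trans ei) ?ltry//.
  by apply: integral_ge0 => z _; rewrite lee_fin.
rewrite em lee_fin in ei.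
have m0 : 0 <= m.
  by rewrite -lee_fin -em; apply: integral_ge0 => z _; rewrite lee_fin.
have := expectation_prod_perm indepZ (1 : 'S_N)%g me e0 em.
have E w : \prod_(i < N) e (Z w (inl (val i)), Z w (inr (val ((1 : 'S_N)%g i)))) =
    expR (t * pair_sum h N w).
  rewrite /pair_sum mulr_sumr expR_sum; apply: eq_bigr => i _; by rewrite perm1.
under eq_integral do rewrite E.
move=> Em.
have -> : [set w | gam * N%:R <= pair_sum h N w] =
    [set w | expR (t * (gam * N%:R)) <= expR (t * pair_sum h N w)].
  by apply/seteqP; split => w /=; rewrite ler_expR ler_pM2l.
apply: markov_le => //.
- apply: measurableT_comp => //; apply: measurable_funM => //; exact: measurable_pair_sum.
- exact: expR_gt0.
rewrite Em -EFinM lee_fin -expRD.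
apply: (@le_trans _ _ (expR (2 * t ^+ 2 * M ^+ 2) ^+ N)).
  by apply: lerXn2r; rewrite ?nnegrE ?expR_ge0//; apply: le_trans ei _; exact: expR_ge1Dx.
rewrite -expRM_natl ler_expR le_eqVlt; apply/orP; left; apply/eqP.
by rewrite tE; field; rewrite gt_eqF.
Qed.

(** Split [F] at a level where the large part [r] has small L^1 norm. The bounded part, once
    centered, satisfies Chernoff bounds in both directions, and the sum of |r| satisfies Markov's
    inequality. *)
Lemma weak_law_pairs (F : T * T -> R) (del rho : R) :
  mu.-integrable setT (EFin \o F) -> 0 < del -> 0 < rho ->
  exists N0, forall N, (N0 <= N)%N ->
    (Pr [set w | (del < `|N%:R^-1 * pair_sum F N w - \int[mu]_z F z|)%R] <= rho%:E)%E.
Proof.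
move=> iF d0 r0.
have key (x y : R) : x <= 3 * (del / 4) -> y <= del / 4 -> x + y <= del by lra.
have mF : measurable_fun setT F by apply/measurable_EFinP; exact: measurable_int iF.
have mnF : measurable_fun setT (fun z => `|F z|) by exact: measurableT_comp.
(* The first bound keeps the mean of [r] below del / 4; the second makes Markov's inequality at
   threshold del / 4 give probability rho / 2. *)
have e0 : 0 < Num.min (del / 4) (del / 4 * (rho / 2)).
  by rewrite lt_min !mulr_gt0.
have Foo : (\int[mu]_z (`|F z|)%:E < +oo)%E by case/integrableP : iF.
have [M [M0 hM]] := integral_large_values mnF (fun=> normr_ge0 _) Foo e0.
pose h z := if `|F z| <= M%:R then F z else 0.
pose r z := if `|F z| <= M%:R then 0 else F z.
have hrE z : F z = h z + r z by rewrite /h /r; case: ifP; rewrite ?addr0 ?add0r.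
have mle : measurable_fun setT (fun z => `|F z| <= M%:R) by exact: measurable_fun_ler.
have mh : measurable_fun setT h by exact: measurable_fun_ifT.
have mr : measurable_fun setT r by exact: measurable_fun_ifT.
have mnr : measurable_fun setT (fun z => `|r z|) by exact: measurableT_comp.
have hbound z : `|h z| <= M%:R by rewrite /h; case: ifP => //; rewrite normr0.
have iF' (G : T * T -> R) : measurable_fun setT G -> (forall z, `|G z| <= `|F z|) ->
    mu.-integrable setT (EFin \o G).
  move=> mG GF; apply: (le_integrable measurableT _ _ iF); first exact/measurable_EFinP.
  by move=> z _; rewrite /= lee_fin.
have ih : mu.-integrable setT (EFin \o h).
  by apply: iF' => // z; rewrite /h; case: ifP; rewrite ?normr0.
have ir : mu.-integrable setT (EFin \o r).
  by apply: iF' => // z; rewrite /r; case: ifP; rewrite ?normr0.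
have rnE z : `|r z| = if `|F z| <= M%:R then 0 else `|F z|.
  by rewrite /r; case: ifP; rewrite ?normr0.
have hr : (\int[mu]_z (`|r z|)%:E <= (Num.min (del / 4) (del / 4 * (rho / 2)))%:E)%E.
  by apply: le_trans hM; under eq_integral do rewrite rnE.
set m := \int[mu]_z h z.
have mE : (\int[mu]_z (h z)%:E = m%:E)%E.
  by rewrite /m fineK//; exact: integrable_fin_num.
have FmE : \int[mu]_z F z = m + \int[mu]_z r z.
  by rewrite -RintegralD//; apply: eq_Rintegral => z _; rewrite hrE.
have intr : `|\int[mu]_z r z| <= del / 4.
  apply: le_trans (le_normr_Rintegral measurableT ir) _.
  rewrite -lee_fin fineK; last exact: integrable_fin_num (integrable_norm ir).
  by apply: le_trans hr _; rewrite lee_fin ge_min lexx.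
pose h' z := h z - m.
have mh' : measurable_fun setT h' by exact: measurable_funB.
have m1 : (\int[mu]_z (m%:E) = m%:E)%E.
  rewrite integral_cst// [X in (_ * X)%E](_ : _ = 1%E) ?mule1//; exact: probability_setT.
have im : mu.-integrable setT (EFin \o (fun=> m)).
  apply/integrableP; split; first exact/measurable_EFinP.
  rewrite integral_cst//; apply: (@le_lt_trans _ _ (`|m|%:E * 1)%E); last by rewrite mule1 ltry.
  by rewrite lee_wpmul2l ?lee_fin//; exact: probability_le1.
have h'0 : (\int[mu]_z (h' z)%:E = 0)%E.
  under eq_integral do rewrite EFinB.
  by rewrite (integralB_EFin measurableT ih im) mE m1 subee.
have Mm : `|m| <= M%:R.
  apply: le_trans (le_normr_Rintegral measurableT ih) _.
  rewrite -lee_fin fineK; last exact: integrable_fin_num (integrable_norm ih).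
  apply: (@le_trans _ _ (\int[mu]_z (cst M%:R%:E z))%E).
    apply: ge0_le_integral => //.
    - by apply/measurable_EFinP; exact: measurableT_comp.
    - by move=> z _; rewrite lee_fin.
  rewrite integral_cst// [X in (_ * X)%E](_ : _ = 1%E) ?mule1//; exact: probability_setT.
(* The centered function is bounded by 2 M; the extra [del] secures the condition del / 4 <= 2 B of
   [chernoff_bound]. *)
pose B : R := 2 * M%:R + del.
have h'B z : `|h' z| <= B.
  apply: le_trans (ler_normB _ _) _; rewrite /B; have := hbound z; lra.
have B0 : 0 < B by rewrite /B ltr_wpDl// mulr_ge0.
have dB : del / 4 <= 2 * B by rewrite /B; have : 0 <= M%:R :> R by []; lra.
pose kap := (del / 4) ^+ 2 / (8 * B ^+ 2).
have kap0 : 0 < kap by rewrite divr_gt0 ?exprn_gt0 ?mulr_gt0 ?exprn_gt0//; lra.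
exists (Num.bound (4 / (kap * rho))) => N hN.
have bnd0 : 0 <= 4 / (kap * rho) by rewrite divr_ge0// ltW// mulr_gt0.
have N0 : 0 < N%:R :> R.
  by apply: le_lt_trans bnd0 (lt_le_trans (archi_boundP bnd0) _); rewrite ler_nat.
have small : expR (- (kap * N%:R)) <= rho / 4.
  apply: le_trans (expRN_le_inv _) _; first by rewrite mulr_ge0// ltW.
  have k4 : 4 / (kap * rho) <= N%:R.
    by rewrite (le_trans (ltW (archi_boundP bnd0)))// ler_nat.
  have kr0 : 0 < kap * rho by exact: mulr_gt0.
  rewrite ler_pdivrMr// in k4.
  rewrite -[leLHS]mul1r ler_pdivrMr; last by rewrite ltr_wpDl// mulr_gt0.
  move: k4; rewrite mulrDr; lra.
have C1 := chernoff_bound N mh' h'B h'0 (divr_gt0 d0 (ltr0n _ 4)) dB.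
have mNh' : measurable_fun setT (fun z => - h' z) by exact: measurableT_comp.
have C2 := @chernoff_bound (fun z => - h' z) B (del / 4) N mNh'.
have {}C2 : (Pr [set w | (del / 4 * N%:R <= pair_sum (fun z => - h' z) N w)%R] <=
    (expR (- (kap * N%:R)))%:E)%E.
  apply: C2 => //; first by move=> z; rewrite normrN.
    transitivity (\int[mu]_z (m%:E - (h z)%:E))%E.
      by apply: eq_integral => z _; rewrite /h' opprB EFinB.
    by rewrite (integralB_EFin measurableT im ih) mE m1 subee.
  by lra.
have mps (G : T * T -> R) : measurable_fun setT G ->
    measurable_fun setT (fun w => N%:R^-1 * pair_sum G N w).
  by move=> mG; apply: measurable_funM => //; exact: measurable_pair_sum.
have C3 : (Pr [set w | (del / 4 <= N%:R^-1 * pair_sum (fun z => `|r z|) N w)%R] <= (rho / 2)%:E)%E.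
  apply: markov_le => //; first exact: mps.
  - by move=> w; rewrite mulr_ge0 ?invr_ge0//; exact: sumr_ge0.
  - by rewrite divr_gt0.
  under eq_integral do rewrite EFinM.
  rewrite ge0_integralZl ?ge0_expectation_pair_sum//; last 2 first.
  - by apply/measurable_EFinP; exact: measurable_pair_sum.
  - by move=> w _; rewrite lee_fin; exact: sumr_ge0.
  rewrite muleA -EFinM mulVf ?gt_eqF// mul1e.
  by apply: le_trans hr _; rewrite -EFinM lee_fin ge_min lexx orbT.
set A1 := [set w | _] in C1; set A2 := [set w | _] in C2; set A3 := [set w | _] in C3.
have mA1 : measurable A1.
  rewrite -[X in measurable X]setTI; apply: measurable_fun_ler => //.
  exact: measurable_pair_sum.
have mA2 : measurable A2.
  rewrite -[X in measurable X]setTI; apply: measurable_fun_ler => //.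
  exact: measurable_pair_sum.
have mA3 : measurable A3.
  by rewrite -[X in measurable X]setTI; apply: measurable_fun_ler => //; exact: mps.
apply: (@le_trans _ _ (Pr (A1 `|` A2 `|` A3))).
  apply: le_measure; rewrite ?inE.
  - rewrite -[X in measurable X]setTI; apply: measurable_fun_ltr => //.
    by apply: measurableT_comp => //; apply: measurable_funB => //; exact: mps.
  - by apply: measurableU => //; exact: measurableU.
  move=> w /= dw; apply: contrapT => /not_orP[/not_orP[n1 n2] n3].
  move: n1 n2 n3; rewrite /A1 /A2 /A3 /= => /negP + /negP + /negP.
  rewrite -!ltNge => n1 n2 n3; move: dw; apply/negP; rewrite -leNgt.
  have n2E : pair_sum (fun z => - h' z) N w = - pair_sum h' N w by rewrite /pair_sum sumrN.
  have sE : pair_sum F N w = pair_sum h' N w + pair_sum r N w + N%:R * m.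
    rewrite /pair_sum -big_split /= mulr_natl -[X in _ *+ X]card_ord -sumr_const -big_split /=.
    by apply: eq_bigr => i _; rewrite hrE /h'; ring.
  have rle : `|pair_sum r N w| <= pair_sum (fun z => `|r z|) N w by exact: ler_norm_sum.
  have n3' : pair_sum (fun z => `|r z|) N w <= del / 4 * N%:R.
    by rewrite -ler_pdivrMr// mulrC ltW.
  rewrite sE FmE.
  rewrite (_ : _ - _ = N%:R^-1 * (pair_sum h' N w + pair_sum r N w) - \int[mu]_z r z); last first.
    by field; rewrite gt_eqF.
  apply: le_trans (ler_normB _ _) _.
  have : `|N%:R^-1 * (pair_sum h' N w + pair_sum r N w)| <= 3 * (del / 4).
    rewrite normrM ger0_norm ?invr_ge0// mulrC ler_pdivrMr//.
    apply: le_trans (ler_normD _ _) _.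
    have : `|pair_sum h' N w| <= del / 4 * N%:R.
      by rewrite n2E in n2; rewrite ler_norml; apply/andP; split; lra.
    have : 0 <= del / 4 * N%:R by rewrite mulr_ge0// ltW// divr_gt0.
    lra.
  by move=> hk; exact: key hk intr.
apply: le_trans (measureU2 _ _ _) _ => //; first exact: measurableU.
apply: (@le_trans _ _ ((rho / 4)%:E + (rho / 4)%:E + (rho / 2)%:E)%E).
  apply: leeD => //; apply: le_trans (measureU2 _ _ _) _ => //.
  by apply: leeD; [apply: le_trans C1 _|apply: le_trans C2 _]; rewrite lee_fin.
rewrite -!EFinD lee_fin; lra.
Qed.

End weak_law.

(** * Flattening a kernel on cells *)

Section kernels.
Context {R : realType} {d d'} {S : measurableType d} {T : measurableType d'}.

Lemma integral_mkcond_if (mu : {measure set S -> \bar R}) (B : S -> bool) (f : S -> R) :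
  (\int[mu]_(x in [set x | B x]) (f x)%:E = \int[mu]_x (if B x then f x else 0)%:E)%E.
Proof.
rewrite integral_mkcond; apply: eq_integral => x _.
by rewrite patchE mem_setE (_ : (x \in B) = B x)//; case: (B x).
Qed.

Lemma ge0_integral_if (mu : {measure set S -> \bar R}) (B : S -> bool) (f g : S -> R) :
  measurable_fun setT B -> measurable_fun setT f -> measurable_fun setT g ->
  (forall x, 0 <= f x) -> (forall x, 0 <= g x) ->
  (\int[mu]_x (if B x then f x else g x)%:E =
   \int[mu]_x (if B x then f x else 0)%:E + \int[mu]_x (if B x then 0 else g x)%:E)%E.
Proof.
move=> mB mf mg f0 g0; rewrite -ge0_integralD//.
- by apply: eq_integral => x _; rewrite -EFinD; case: (B x); rewrite ?addr0 ?add0r.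
- by move=> x _; rewrite lee_fin; case: ifP.
- by apply/measurable_EFinP; exact: measurable_fun_ifT.
- by move=> x _; rewrite lee_fin; case: ifP.
- by apply/measurable_EFinP; exact: measurable_fun_ifT.
Qed.

Lemma ge0_le_integral_fin (mu : {measure set S -> \bar R}) (f g : S -> R) :
  measurable_fun setT f -> measurable_fun setT g ->
  (forall x, 0 <= f x) -> (forall x, f x <= g x) ->
  (\int[mu]_x (f x)%:E <= \int[mu]_x (g x)%:E)%E.
Proof.
move=> mf mg f0 fg; apply: ge0_le_integral => //.
- by move=> x _; rewrite lee_fin.
- exact/measurable_EFinP.
- exact/measurable_EFinP.
- by move=> x _; rewrite lee_fin.
Qed.

Lemma integral_cst_probability (mu : probability S R) (r : R) :
  (\int[mu]_x r%:E = r%:E)%E.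
Proof.
by rewrite integral_cst// [X in (_ * X)%E](_ : _ = 1%E) ?mule1//; exact: probability_setT.
Qed.

End kernels.

Section flattened_kernel.
Context {R : realType} {d} {T : measurableType d}.
Variables (P Q : probability T R) (xi : T * T -> R).
Hypotheses (mxi : measurable_fun setT xi) (xi0 : forall z, 0 <= xi z).
Hypothesis xiP : forall y, (\int[P]_x (xi (x, y))%:E = 1)%E.
Hypothesis xiQ : forall x, (\int[Q]_y (xi (x, y))%:E = 1)%E.
Local Notation mu := (P \x Q)%E.

Definition kernel_mass (A B : T -> bool) : R :=
  fine (\int[mu]_z (if A z.1 && B z.2 then xi z else 0)%:E).

Lemma kernel_integral1 : (\int[mu]_z (xi z)%:E = 1)%E.
Proof.
rewrite fubini_tonelli1//; first by rewrite /fubini_F; under eq_integral do rewrite xiQ;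
  exact: integral_cst_probability.
exact/measurable_EFinP.
Qed.

Lemma measurable_rect (A B : T -> bool) : measurable_fun setT A -> measurable_fun setT B ->
  measurable_fun setT (fun z : T * T => A z.1 && B z.2).
Proof.
by move=> mA mB; apply: measurable_and; exact: measurableT_comp.
Qed.

Lemma kernel_massE (A B : T -> bool) : measurable_fun setT A -> measurable_fun setT B ->
  (\int[mu]_z (if A z.1 && B z.2 then xi z else 0)%:E = (kernel_mass A B)%:E)%E.
Proof.
move=> mA mB; rewrite fineK// ge0_fin_numE; last first.
  by apply: integral_ge0 => z _; rewrite lee_fin; case: ifP.
apply: (@le_lt_trans _ _ (\int[mu]_z (xi z)%:E)%E); last by rewrite kernel_integral1 ltry.
apply: ge0_le_integral_fin => //.
- by apply: measurable_fun_ifT => //; exact: measurable_rect.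
- by move=> z; case: ifP.
- by move=> z; case: ifP.
Qed.

Variables (K L : T -> bool).
Hypotheses (mK : measurable_fun setT K) (mL : measurable_fun setT L).

(** The conditional probability of [L] given the first coordinate, under the coupling with density
    [xi]; [col_mass] plays the same role for [K] given the second coordinate. *)
Definition row_mass (x : T) : R := fine (\int[Q]_y (if L y then xi (x, y) else 0)%:E).
Definition col_mass (y : T) : R := fine (\int[P]_x (if K x then xi (x, y) else 0)%:E).
Local Notation u := row_mass.
Local Notation v := col_mass.

Lemma measurable_kernel_row x : measurable_fun setT (fun y => xi (x, y)).
Proof. exact: measurable_fun_pair2. Qed.

Lemma measurable_kernel_col y : measurable_fun setT (fun x => xi (x, y)).
Proof. exact: measurable_fun_pair1. Qed.

Lemma row_mass_le x : (\int[Q]_y (if L y then xi (x, y) else 0)%:E <= 1)%E.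
Proof.
rewrite -(xiQ x); apply: ge0_le_integral_fin.
- by apply: measurable_fun_ifT => //; exact: measurable_kernel_row.
- exact: measurable_kernel_row.
- by move=> y; case: ifP.
- by move=> y; case: ifP.
Qed.

Lemma col_mass_le y : (\int[P]_x (if K x then xi (x, y) else 0)%:E <= 1)%E.
Proof.
rewrite -(xiP y); apply: ge0_le_integral_fin.
- by apply: measurable_fun_ifT => //; exact: measurable_kernel_col.
- exact: measurable_kernel_col.
- by move=> x; case: ifP.
- by move=> x; case: ifP.
Qed.

Lemma row_massE x : (\int[Q]_y (if L y then xi (x, y) else 0)%:E = (u x)%:E)%E.
Proof.
rewrite fineK// ge0_fin_numE ?(le_lt_trans (row_mass_le x)) ?ltry//.
by apply: integral_ge0 => y _; rewrite lee_fin; case: ifP.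
Qed.

Lemma col_massE y : (\int[P]_x (if K x then xi (x, y) else 0)%:E = (v y)%:E)%E.
Proof.
rewrite fineK// ge0_fin_numE ?(le_lt_trans (col_mass_le y)) ?ltry//.
by apply: integral_ge0 => x _; rewrite lee_fin; case: ifP.
Qed.

Lemma row_mass_ge0_le1 x : 0 <= u x <= 1.
Proof.
by rewrite -!lee_fin -row_massE row_mass_le andbT; apply: integral_ge0 => y _;
  rewrite lee_fin; case: ifP.
Qed.

Lemma col_mass_ge0_le1 y : 0 <= v y <= 1.
Proof.
by rewrite -!lee_fin -col_massE col_mass_le andbT; apply: integral_ge0 => x _;
  rewrite lee_fin; case: ifP.
Qed.

Lemma measurable_row_mass : measurable_fun setT u.
Proof.
apply: measurableT_comp => //.
apply: (measurable_fun_fubini_tonelli_F (fun z : T * T => (if L z.2 then xi z else 0)%:E)).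
- apply/measurable_EFinP; apply: measurable_fun_ifT => //; exact: measurableT_comp.
- by move=> z; rewrite lee_fin; case: ifP.
Qed.

Lemma measurable_col_mass : measurable_fun setT v.
Proof.
apply: measurableT_comp => //.
apply: (measurable_fun_fubini_tonelli_G (fun z : T * T => (if K z.1 then xi z else 0)%:E)).
- apply/measurable_EFinP; apply: measurable_fun_ifT => //; exact: measurableT_comp.
- by move=> z; rewrite lee_fin; case: ifP.
Qed.

Lemma integral_row_mass (A : T -> bool) : measurable_fun setT A ->
  (\int[P]_x (if A x then u x else 0)%:E = (kernel_mass A L)%:E)%E.
Proof.
move=> mA; rewrite -kernel_massE// fubini_tonelli1//.
- apply: eq_integral => x _; rewrite /fubini_F /=; case: (A x) => /=.
    by rewrite row_massE.
  by rewrite integral0.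
- by apply/measurable_EFinP; apply: measurable_fun_ifT => //; exact: measurable_rect.
- by move=> z; rewrite lee_fin; case: ifP.
Qed.

Lemma integral_col_mass (B : T -> bool) : measurable_fun setT B ->
  (\int[Q]_y (if B y then v y else 0)%:E = (kernel_mass K B)%:E)%E.
Proof.
move=> mB; rewrite -kernel_massE// fubini_tonelli2//.
- apply: eq_integral => y _; rewrite /fubini_G /=; case: (B y) => /=.
    by under [RHS]eq_integral do rewrite andbT; rewrite col_massE.
  by under [RHS]eq_integral do rewrite andbF; rewrite integral0.
- by apply/measurable_EFinP; apply: measurable_fun_ifT => //; exact: measurable_rect.
- by move=> z; rewrite lee_fin; case: ifP.
Qed.

Local Notation m := (kernel_mass K L).
Hypothesis m_gt0 : 0 < m.

(* Rank one on K x L, with the row and column integrals of xi. *)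
Definition flattened (z : T * T) : R :=
  if K z.1 && L z.2 then u z.1 * (v z.2 / m) else xi z.

Let u0 x : 0 <= u x. Proof. by case/andP: (row_mass_ge0_le1 x). Qed.
Let v0 y : 0 <= v y. Proof. by case/andP: (col_mass_ge0_le1 y). Qed.

Lemma measurable_uv : measurable_fun setT (fun z : T * T => u z.1 * (v z.2 / m)).
Proof.
apply: measurable_funM; first exact: (measurableT_comp measurable_row_mass).
by apply: measurable_funM => //; exact: (measurableT_comp measurable_col_mass).
Qed.

Lemma measurable_flattened : measurable_fun setT flattened.
Proof.
by apply: measurable_fun_ifT => //; [exact: measurable_rect|exact: measurable_uv].
Qed.

Lemma flattened_ge0 z : 0 <= flattened z.
Proof. by rewrite /flattened; case: ifP => // _; rewrite mulr_ge0// divr_ge0// ltW. Qed.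

(** For x in [K], v / m has integral 1 over [L], which leaves u(x), the integral of xi(x, .) over
    [L]. Elsewhere the two kernels agree. *)
Lemma flattened_row x : (\int[Q]_y (flattened (x, y))%:E = 1)%E.
Proof.
rewrite /flattened /=; case: (K x) => //=.
rewrite ge0_integral_if//; last 3 first.
- by apply: measurable_funM => //; apply: measurable_funM => //; exact: measurable_col_mass.
- exact: measurable_kernel_row.
- by move=> y; rewrite mulr_ge0// divr_ge0// ltW.
have -> : (\int[Q]_y (if L y then u x * (v y / m) else 0)%:E = (u x)%:E)%E.
  transitivity (\int[Q]_y ((u x / m)%:E * (if L y then v y else 0)%:E))%E.
    apply: eq_integral => y _; rewrite -EFinM; case: ifP => _; last by rewrite mulr0.
    by congr (_%:E); ring.
  rewrite ge0_integralZl//; last 3 first.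
  - by apply/measurable_EFinP; apply: measurable_fun_ifT => //; exact: measurable_col_mass.
  - by move=> y _; rewrite lee_fin; case: ifP.
  - by rewrite lee_fin divr_ge0// ltW.
  by rewrite integral_col_mass// -EFinM divfK// gt_eqF.
rewrite -row_massE -ge0_integral_if//.
- rewrite -[RHS](xiQ x); by apply: eq_integral => y _; case: ifP.
- exact: measurable_kernel_row.
- exact: measurable_kernel_row.
Qed.

Lemma flattened_col y : (\int[P]_x (flattened (x, y))%:E = 1)%E.
Proof.
rewrite /flattened /=; case: (L y) => /=; last by under eq_integral do rewrite andbF.
under eq_integral do rewrite andbT.
rewrite ge0_integral_if//; last 3 first.
- by apply: measurable_funM => //; exact: measurable_row_mass.
- exact: measurable_kernel_col.
- by move=> x; rewrite mulr_ge0// divr_ge0// ltW.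
have -> : (\int[P]_x (if K x then u x * (v y / m) else 0)%:E = (v y)%:E)%E.
  transitivity (\int[P]_x ((v y / m)%:E * (if K x then u x else 0)%:E))%E.
    apply: eq_integral => x _; rewrite -EFinM; case: ifP => _; last by rewrite mulr0.
    by congr (_%:E); ring.
  rewrite ge0_integralZl//; last 3 first.
  - by apply/measurable_EFinP; apply: measurable_fun_ifT => //; exact: measurable_row_mass.
  - by move=> x _; rewrite lee_fin; case: ifP.
  - by rewrite lee_fin divr_ge0// ltW.
  by rewrite integral_row_mass// -EFinM divfK// gt_eqF.
rewrite -col_massE -ge0_integral_if//.
- rewrite -[RHS](xiP y); by apply: eq_integral => x _; case: ifP.
- exact: measurable_kernel_col.
- exact: measurable_kernel_col.
Qed.

Lemma flattened_integral1 : (\int[mu]_z (flattened z)%:E = 1)%E.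
Proof.
rewrite fubini_tonelli1//; first by rewrite /fubini_F; under eq_integral do rewrite flattened_row;
  exact: integral_cst_probability.
- by apply/measurable_EFinP; exact: measurable_flattened.
- by move=> z; rewrite lee_fin flattened_ge0.
Qed.

(** Flattening preserves row integrals inside K x L, so the expected label frequencies under the
    flattened kernel are those under [xi]. *)
Lemma flattened_row_mass (A : T -> bool) : measurable_fun setT A -> (forall x, A x -> K x) ->
  (\int[mu]_(z in [set z | A z.1 && L z.2]) (flattened z)%:E = (kernel_mass A L)%:E)%E.
Proof.
move=> mA AK; rewrite integral_mkcond_if fubini_tonelli1//; last 2 first.
- apply/measurable_EFinP; apply: measurable_fun_ifT => //; first exact: measurable_rect.
  exact: measurable_flattened.
- by move=> z; rewrite lee_fin; case: ifP => // _; exact: flattened_ge0.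
rewrite -integral_row_mass//; apply: eq_integral => x _; rewrite /fubini_F /=.
case: (boolP (A x)) => Ax /=; last by rewrite integral0.
transitivity (\int[Q]_y ((u x / m)%:E * (if L y then v y else 0)%:E))%E.
  apply: eq_integral => y _; rewrite -EFinM /flattened /= AK//=.
  by case: (L y); rewrite ?mulr0//; congr (_%:E); ring.
rewrite ge0_integralZl//; last 3 first.
- by apply/measurable_EFinP; apply: measurable_fun_ifT => //; exact: measurable_col_mass.
- by move=> y _; rewrite lee_fin; case: ifP.
- by rewrite lee_fin divr_ge0// ltW.
by rewrite integral_col_mass// -EFinM divfK// gt_eqF.
Qed.

Lemma flattened_col_mass (B : T -> bool) : measurable_fun setT B -> (forall y, B y -> L y) ->
  (\int[mu]_(z in [set z | K z.1 && B z.2]) (flattened z)%:E = (kernel_mass K B)%:E)%E.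
Proof.
move=> mB BL; rewrite integral_mkcond_if fubini_tonelli2//; last 2 first.
- apply/measurable_EFinP; apply: measurable_fun_ifT => //; first exact: measurable_rect.
  exact: measurable_flattened.
- by move=> z; rewrite lee_fin; case: ifP => // _; exact: flattened_ge0.
rewrite -integral_col_mass//; apply: eq_integral => y _; rewrite /fubini_G /=.
case: (boolP (B y)) => By /=; last first.
  by under eq_integral do rewrite andbF; rewrite integral0.
transitivity (\int[P]_x ((v y / m)%:E * (if K x then u x else 0)%:E))%E.
  apply: eq_integral => x _; rewrite -EFinM /flattened /= BL// !andbT.
  by case: (K x); rewrite ?mulr0//; congr (_%:E); ring.
rewrite ge0_integralZl//; last 3 first.
- by apply/measurable_EFinP; apply: measurable_fun_ifT => //; exact: measurable_row_mass.
- by move=> x _; rewrite lee_fin; case: ifP.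
- by rewrite lee_fin divr_ge0// ltW.
by rewrite integral_row_mass// -EFinM divfK// gt_eqF.
Qed.

(** On K x L the kernel is u v / m <= 1 / m; off it, its square is that of [xi], with integral at
    most [e]. As the kernel has integral 1, its chi-square distance to 1 is the integral of its
    square minus 1. *)
Lemma flattened_chi2 (e : R) :
  (\int[mu]_z (if K z.1 && L z.2 then 0 else xi z ^+ 2)%:E <= e%:E)%E ->
  exists chi : R, (\int[mu]_z ((flattened z - 1) ^+ 2)%:E = chi%:E)%E /\
    chi <= e + m ^- 2 - 1.
Proof.
move=> he.
have mfl2 : measurable_fun setT (fun z => flattened z ^+ 2).
  by apply: measurable_funX; exact: measurable_flattened.
have mfl1 : measurable_fun setT (fun z => (flattened z - 1) ^+ 2).
  by apply: measurable_funX; apply: measurable_funB => //; exact: measurable_flattened.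
have e2 : (\int[mu]_z (flattened z ^+ 2)%:E <= (m ^- 2 + e)%:E)%E.
  rewrite (_ : (fun z => _) = fun z => (if K z.1 && L z.2 then (u z.1 * (v z.2 / m)) ^+ 2
      else xi z ^+ 2)%:E); last by apply/funext => z; rewrite /flattened; case: ifP.
  rewrite ge0_integral_if//; last 5 first.
  - exact: measurable_rect.
  - by apply: measurable_funX; exact: measurable_uv.
  - exact: measurable_funX.
  - by move=> z; rewrite sqr_ge0.
  - by move=> z; rewrite sqr_ge0.
  rewrite EFinD leeD//; apply: (@le_trans _ _ (\int[mu]_z (m ^- 2)%:E)%E); last first.
    by rewrite integral_cst_probability.
  apply: ge0_le_integral_fin => //.
  - apply: measurable_fun_ifT => //; first exact: measurable_rect.
    by apply: measurable_funX; exact: measurable_uv.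
  - by move=> z; case: ifP => // _; rewrite sqr_ge0.
  - move=> z; have mV : 0 <= m^-1 by rewrite invr_ge0 ltW.
    rewrite -exprVn; case: ifP => _; last exact: exprn_ge0.
    rewrite lerXn2r ?nnegrE ?mulr_ge0//.
    have /andP[_ u1] := row_mass_ge0_le1 z.1; have /andP[_ v1] := col_mass_ge0_le1 z.2.
    by rewrite mulrA -[leRHS]mul1r ler_wpM2r// mulr_ile1.
(* The square is expanded as an identity between sums of nonnegative integrals, which avoids
   subtraction in the extended reals. *)
have E : (\int[mu]_z ((flattened z - 1) ^+ 2)%:E + 2%:E =
     \int[mu]_z (flattened z ^+ 2)%:E + 1)%E.
  have i2 : (\int[mu]_z (2 * flattened z)%:E = 2%:E)%E.
    under eq_integral do rewrite EFinM.
    rewrite ge0_integralZl// ?flattened_integral1 ?mule1//.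
    - by apply/measurable_EFinP; exact: measurable_flattened.
    - by move=> z _; rewrite lee_fin flattened_ge0.
  rewrite -{1}i2 -[X in _ = (_ + X)%E](integral_cst_probability mu 1).
  have mE f : measurable_fun setT f -> measurable_fun setT (fun z : T * T => (f z)%:E).
    by move=> mf; exact/measurable_EFinP.
  have m2f : measurable_fun setT (fun z => 2 * flattened z).
    by apply: measurable_funM => //; exact: measurable_flattened.
  have f2 z : (0 <= (2 * flattened z)%:E)%E by rewrite lee_fin mulr_ge0// flattened_ge0.
  have s1 z : (0 <= ((flattened z - 1) ^+ 2)%:E)%E by rewrite lee_fin sqr_ge0.
  have s2 z : (0 <= (flattened z ^+ 2)%:E)%E by rewrite lee_fin sqr_ge0.
  rewrite -!ge0_integralD//; do ?exact: mE.
  by apply: eq_integral => z _; rewrite -!EFinD; congr (_%:E); ring.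
have pos : (0 <= \int[mu]_z ((flattened z - 1) ^+ 2)%:E)%E.
  by apply: integral_ge0 => z _; rewrite lee_fin sqr_ge0.
case: (\int[mu]_z ((flattened z - 1) ^+ 2)%:E)%E pos E => [r| |] // _ E.
- exists r; split => //.
  have : ((r + 2)%:E <= (m ^- 2 + e + 1)%:E)%E.
    by rewrite EFinD E EFinD leeD.
  rewrite lee_fin; lra.
- by case: (\int[mu]_z (flattened z ^+ 2)%:E)%E e2 E.
Qed.

End flattened_kernel.

Lemma measurable_labels {d} {T : measurableType d} (H : finType) (kk : T -> option H) :
  (forall k, measurable_fun setT (fun x => kk x == Some k)) ->
  measurable_fun setT (fun x => kk x : bool).
Proof.
move=> mk; apply: (measurable_fun_bool true); rewrite setTI.
rewrite (_ : _ @^-1` _ = \bigcup_(k in [set: H]) [set x | kk x == Some k]); last first.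
  apply/seteqP; split => x /=; last by case=> k _ /eqP ->.
  by case E : (kk x) => [k|] // _; exists k => //=; rewrite E.
by apply: fin_bigcup_measurable => // k _; exact: measurable_bool_set.
Qed.

Section labeled_lower_bound.
Context {R : realType} {d} {T : measurableType d}.
Variables (P Q : probability T R) (xi : T * T -> R).
Hypotheses (mxi : measurable_fun setT xi) (xi_gt0 : forall z, 0 < xi z).
Hypothesis xiP : forall y, (\int[P]_x (xi (x, y))%:E = 1)%E.
Hypothesis xiQ : forall x, (\int[Q]_y (xi (x, y))%:E = 1)%E.
Variables (F G : finType) (kx : T -> option F) (ky : T -> option G).
Let A k := fun x => kx x == Some k.
Let B l := fun y => ky y == Some l.
Hypotheses (mA : forall k, measurable_fun setT (A k)) (mB : forall l, measurable_fun setT (B l)).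
Hypotheses (A_gt0 : forall k, (0 < P [set x | A k x])%E).
Hypotheses (B_gt0 : forall l, (0 < Q [set y | B l y])%E).
Variable th : R.
Hypothesis osc : forall k l x x' y y', A k x -> A k x' -> B l y -> B l y' ->
  xi (x, y) <= expR th * xi (x', y').
Let K x : bool := kx x.
Let L y : bool := ky y.
Let xi0 z : 0 <= xi z. Proof. exact: ltW. Qed.
Local Notation mu := (P \x Q)%E.
Local Notation mass := (kernel_mass P Q xi).
Local Notation m := (mass K L).
Local Notation u := (row_mass Q xi L).
Local Notation v := (col_mass P xi K).

Let mK : measurable_fun setT K. Proof. exact: measurable_labels. Qed.
Let mL : measurable_fun setT L. Proof. exact: measurable_labels. Qed.

Let sum_labels (H : finType) (kk : T -> option H) (x : T) (r : R) :
  (if kk x then r else 0) = \sum_(k : H) (if kk x == Some k then r else 0).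
Proof.
case: (kk x) => [k|]; last by rewrite big1.
rewrite (bigD1 k)//= eqxx big1 ?addr0// => k' k'k.
by case: eqP => // -[kk']; rewrite kk' eqxx in k'k.
Qed.

Let measurable_rect_xi (C D : T -> bool) : measurable_fun setT C -> measurable_fun setT D ->
  measurable_fun setT (fun z : T * T => if C z.1 && D z.2 then xi z else 0).
Proof. by move=> mC mD; apply: measurable_fun_ifT => //; exact: measurable_rect. Qed.

Lemma kernel_mass_sum_col (C : T -> bool) : measurable_fun setT C ->
  mass C L = \sum_l mass C (B l).
Proof.
move=> mC; apply: EFin_inj; rewrite -sumEFin.
under eq_bigr do rewrite -kernel_massE//.
rewrite -kernel_massE// -ge0_integral_sum//.
- apply: eq_integral => z _; rewrite sumEFin; congr (_%:E).
  by case: (C z.1) => /=; [exact: sum_labels|rewrite big1].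
- by move=> l; apply/measurable_EFinP; exact: measurable_rect_xi.
- by move=> l z _; rewrite lee_fin; case: ifP.
Qed.

Lemma kernel_mass_sum_row (D : T -> bool) : measurable_fun setT D ->
  mass K D = \sum_k mass (A k) D.
Proof.
move=> mD; apply: EFin_inj; rewrite -sumEFin.
under eq_bigr do rewrite -kernel_massE//.
rewrite -kernel_massE// -ge0_integral_sum//.
- apply: eq_integral => z _; rewrite sumEFin; congr (_%:E).
  case: (D z.2); last by under eq_bigr do rewrite andbF; rewrite andbF big1.
  by under eq_bigr do rewrite andbT; rewrite andbT; exact: sum_labels.
- by move=> l; apply/measurable_EFinP; exact: measurable_rect_xi.
- by move=> l z _; rewrite lee_fin; case: ifP.
Qed.

Let a k := fine (P [set x | A k x]).
Let b l := fine (Q [set y | B l y]).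

Let aE k : P [set x | A k x] = (a k)%:E.
Proof. by rewrite /a fineK// fin_num_measure//; exact: measurable_bool_set. Qed.
Let bE l : Q [set y | B l y] = (b l)%:E.
Proof. by rewrite /b fineK// fin_num_measure//; exact: measurable_bool_set. Qed.
Let a_gt0 k : 0 < a k. Proof. by rewrite -lte_fin -aE. Qed.
Let b_gt0 l : 0 < b l. Proof. by rewrite -lte_fin -bE. Qed.

Let integral_rect_cst k l (r : R) : 0 <= r ->
  (\int[mu]_z (if A k z.1 && B l z.2 then r else 0)%:E = (r * (a k * b l))%:E)%E.
Proof.
move=> r0; rewrite -integral_mkcond_if.
have -> : [set z | A k z.1 && B l z.2] = [set x | A k x] `*` [set y | B l y].
  by apply/seteqP; split => -[x y] /= => [/andP[]|[-> ->]].
rewrite integral_cst; last by apply: measurableX; exact: measurable_bool_set.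
rewrite EFinM; congr (_ * _)%E; rewrite EFinM -aE -bE.
by apply: product_measure1E; exact: measurable_bool_set.
Qed.

(** On a cell [xi] is at most exp(th) times its value at any point of the cell; this is integrated
    over the cell. *)
Lemma cell_mass_le k l x y : A k x -> B l y ->
  mass (A k) (B l) <= expR th * xi (x, y) * (a k * b l).
Proof.
move=> Ax By; have c0 : 0 <= expR th * xi (x, y) by rewrite mulr_ge0 ?expR_ge0.
rewrite -lee_fin -kernel_massE// -integral_rect_cst//.
apply: ge0_le_integral_fin.
- exact: measurable_rect_xi.
- by apply: measurable_fun_ifT => //; exact: measurable_rect.
- by move=> z; case: ifP.
- by move=> [x' y'] /=; case: ifP => // /andP[Ax' By']; exact: osc Ax' Ax By' By.
Qed.

Lemma cell_mass_gt0 k l : 0 < mass (A k) (B l).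
Proof.
have [x Ax] : exists x, A k x.
  apply: contrapT => nex; have := A_gt0 k.
  rewrite (_ : [set x | A k x] = set0) ?measure0 ?ltxx//.
  by apply/seteqP; split => // x /= Ax; apply: nex; exists x.
have [y By] : exists y, B l y.
  apply: contrapT => nex; have := B_gt0 l.
  rewrite (_ : [set x | B l x] = set0) ?measure0 ?ltxx//.
  by apply/seteqP; split => // y /= By; apply: nex; exists y.
have c0 : 0 < expR (- th) * xi (x, y) by rewrite mulr_gt0 ?expR_gt0.
apply: (@lt_le_trans _ _ (expR (- th) * xi (x, y) * (a k * b l))).
  by rewrite !mulr_gt0 ?expR_gt0.
rewrite -lee_fin -kernel_massE// -integral_rect_cst; last exact: ltW.
apply: ge0_le_integral_fin.
- by apply: measurable_fun_ifT => //; exact: measurable_rect.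
- exact: measurable_rect_xi.
- by move=> z; case: ifP => // _; exact: ltW.
- move=> [x' y'] /=; case: ifP => // /andP[Ax' By'].
  rewrite expRN mulrC ler_pdivrMr ?expR_gt0// mulrC; exact: osc Ax Ax' By By'.
Qed.

(** For each y in [L] the oscillation bound compares xi(x, y) with xi(x', y) for x' in the same
    cell. Integrating over y and then over x' compares u(x) with its mean over the cell. *)
Lemma row_mass_cell_le k x : A k x -> u x * a k <= expR th * mass (A k) L.
Proof.
move=> Ax; have u0 y := proj1 (andP (row_mass_ge0_le1 mxi xi0 xiQ mL y)).
rewrite -lee_fin EFinM (EFinM (expR th)) -integral_row_mass//.
rewrite -ge0_integral_scaler ?expR_ge0//; last 2 first.
- apply: measurable_fun_ifT => //; exact: measurable_row_mass.
- by move=> y; case: ifP.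
rewrite -aE -integral_cst; last exact: measurable_bool_set.
rewrite integral_mkcond_if; apply: ge0_le_integral_fin.
- exact: measurable_fun_ifT.
- by apply: measurable_funM => //; apply: measurable_fun_ifT => //; exact: measurable_row_mass.
- by move=> y; case: ifP.
- move=> x' /=; case: ifP => Ax'; last by rewrite mulr0.
  rewrite -lee_fin EFinM -!(row_massE mxi xi0 xiQ mL).
  rewrite -ge0_integral_scaler ?expR_ge0//; last 2 first.
  + apply: measurable_fun_ifT => //; exact: measurable_kernel_row.
  + by move=> y; case: ifP.
  apply: ge0_le_integral_fin.
  + apply: measurable_fun_ifT => //; exact: measurable_kernel_row.
  + apply: measurable_funM => //; apply: measurable_fun_ifT => //; exact: measurable_kernel_row.
  + by move=> y; case: ifP.
  + move=> y; case Ly : (L y); last by rewrite mulr0.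
    have [l By] : exists l, B l y by move: Ly; rewrite /L /B; case: (ky y) => // l _; exists l.
    exact: (osc Ax Ax' By By).
Qed.

Lemma col_mass_cell_le l y : B l y -> v y * b l <= expR th * mass K (B l).
Proof.
move=> By; have v0 x := proj1 (andP (col_mass_ge0_le1 mxi xi0 xiP mK x)).
rewrite -lee_fin EFinM (EFinM (expR th)) -integral_col_mass//.
rewrite -ge0_integral_scaler ?expR_ge0//; last 2 first.
- apply: measurable_fun_ifT => //; exact: measurable_col_mass.
- by move=> x; case: ifP.
rewrite -bE -integral_cst; last exact: measurable_bool_set.
rewrite integral_mkcond_if; apply: ge0_le_integral_fin.
- exact: measurable_fun_ifT.
- by apply: measurable_funM => //; apply: measurable_fun_ifT => //; exact: measurable_col_mass.
- by move=> x; case: ifP.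
- move=> y' /=; case: ifP => By'; last by rewrite mulr0.
  rewrite -lee_fin EFinM -!(col_massE mxi xi0 xiP mK).
  rewrite -ge0_integral_scaler ?expR_ge0//; last 2 first.
  + apply: measurable_fun_ifT => //; exact: measurable_kernel_col.
  + by move=> x; case: ifP.
  apply: ge0_le_integral_fin.
  + apply: measurable_fun_ifT => //; exact: measurable_kernel_col.
  + apply: measurable_funM => //; apply: measurable_fun_ifT => //; exact: measurable_kernel_col.
  + by move=> x; case: ifP.
  + move=> x; case Kx : (K x); last by rewrite mulr0.
    have [k Ax] : exists k, A k x by move: Kx; rewrite /K /A; case: (kx x) => // k _; exists k.
    exact: (osc Ax Ax By By').
Qed.

Lemma row_cell_mass_gt0 (l0 : G) k : 0 < mass (A k) L.
Proof.
rewrite kernel_mass_sum_col// (bigD1 l0)//= ltr_wpDr ?cell_mass_gt0//.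
by apply: sumr_ge0 => l _; exact/ltW/cell_mass_gt0.
Qed.

Lemma col_cell_mass_gt0 (k0 : F) l : 0 < mass K (B l).
Proof.
rewrite kernel_mass_sum_row// (bigD1 k0)//= ltr_wpDr ?cell_mass_gt0//.
by apply: sumr_ge0 => k _; exact/ltW/cell_mass_gt0.
Qed.

(** Cell masses divided by m form a coupling of the normalized row and column masses; this is the
    density of that coupling with respect to the product of its marginals. *)
Definition cell_weight k l := mass (A k) (B l) * m / (mass (A k) L * mass K (B l)).

(** The product equals, up to exp(- 3 th), mass(A_k x B_l) u v / (mass(A_k x L) mass(K x B_l)). Each
    of the cell mass, u and v is replaced by its value for a constant kernel at the cost of one
    factor exp(th), hence the 3. *)
Lemma flattened_cell_le (k0 : F) (l0 : G) k l x y : A k x -> B l y -> 0 < m ->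
  expR (- (3 * th)) * cell_weight k l * flattened P Q xi K L (x, y) <= xi (x, y).
Proof.
move=> Ax By m0; rewrite /flattened /=.
have -> : K x by move: Ax; rewrite /A /K => /eqP ->.
have -> : L y by move: By; rewrite /B /L => /eqP ->.
rewrite /= /cell_weight.
have hp := row_cell_mass_gt0 l0 k; have hq := col_cell_mass_gt0 k0 l.
have h1 := cell_mass_le Ax By; have h2 := row_mass_cell_le Ax; have h3 := col_mass_cell_le By.
have u0 := proj1 (andP (row_mass_ge0_le1 mxi xi0 xiQ mL x)).
have v0 := proj1 (andP (col_mass_ge0_le1 mxi xi0 xiP mK y)).
have n0 := ltW (cell_mass_gt0 k l).
have ab : 0 < a k * b l by rewrite mulr_gt0.
have := a_gt0 k; have := b_gt0 l; move: u0 v0 n0 ab h1 h2 h3 hp hq m0.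
move: (mass (A k) L) (mass K (B l)) (mass (A k) (B l)) m (u x) (v y) (a k) (b l) =>
  p q n mm uu vv aa bb u0 v0 n0 ab h1 h2 h3 p0 q0 m0 b0 a0.
have -> : expR (- (3 * th)) * (n * mm / (p * q)) * (uu * (vv / mm)) =
    expR (- (3 * th)) * (n * (uu * vv)) / (p * q).
  by field; rewrite !gt_eqF.
rewrite ler_pdivrMr ?mulr_gt0// -(ler_pM2r ab).
have h23 : (uu * aa) * (vv * bb) <= (expR th * p) * (expR th * q).
  by apply: ler_pM => //; apply: mulr_ge0 => //; exact: ltW.
have h4 : n * ((uu * aa) * (vv * bb)) <=
    (expR th * xi (x, y) * (aa * bb)) * ((expR th * p) * (expR th * q)).
  by apply: ler_pM => //; rewrite !mulr_ge0// ltW.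
have h5 := ler_wpM2l (expR_ge0 (- (3 * th))) h4.
have e3 : expR (- (3 * th)) * (expR th * expR th * expR th) = 1.
  by rewrite -!expRD (_ : _ + _ = 0) ?expR0//; ring.
rewrite [leLHS](_ : _ = expR (- (3 * th)) * (n * (uu * aa * (vv * bb)))); last by ring.
apply: le_trans h5 _.
rewrite [leLHS](_ : _ = (expR (- (3 * th)) * (expR th * expR th * expR th)) *
  (xi (x, y) * (p * q) * (aa * bb))); last by ring.
by rewrite e3 mul1r.
Qed.

End labeled_lower_bound.

(** * The lower tail of permutation averages *)

Section lower_tail.
Context {R : realType} {d d'} {Om : measurableType d} {T : measurableType d'}.
Variables (Pr : probability Om R) (P Q : probability T R).
Variable (Z : Om -> config T (nat + nat)%type).
Hypothesis indepZ : independent_family Pr Z (two_sample_law P Q).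
Variables (xi : T * T -> R).
Hypotheses (mxi : measurable_fun setT xi) (xi_gt0 : forall z, 0 < xi z).
Hypothesis xiP : forall y, (\int[P]_x (xi (x, y))%:E = 1)%E.
Hypothesis xiQ : forall x, (\int[Q]_y (xi (x, y))%:E = 1)%E.
Variables (F G : finType) (kx : T -> option F) (ky : T -> option G).
Hypotheses (mA : forall k, measurable_fun setT (fun x => kx x == Some k)).
Hypotheses (mB : forall l, measurable_fun setT (fun y => ky y == Some l)).
Hypotheses (A_gt0 : forall k, (0 < P [set x | kx x == Some k])%E).
Hypotheses (B_gt0 : forall l, (0 < Q [set y | ky y == Some l])%E).
Variable th : R.
Hypothesis th0 : 0 <= th.
Hypothesis osc : forall k l x x' y y',
  kx x == Some k -> kx x' == Some k -> ky y == Some l -> ky y' == Some l ->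
  xi (x, y) <= expR th * xi (x', y').
Variables (k0 : F) (l0 : G).
Let K x : bool := kx x.
Let L y : bool := ky y.
Let A k := fun x => kx x == Some k.
Let B l := fun y => ky y == Some l.
Let xi0 z : 0 <= xi z. Proof. exact: ltW. Qed.
Local Notation mu := (P \x Q)%E.
Local Notation mass := (kernel_mass P Q xi).
Local Notation m := (mass K L).
Local Notation ze := (flattened P Q xi K L).
Local Notation wt := (cell_weight P Q xi kx ky).

Let mK : measurable_fun setT K. Proof. exact: measurable_labels. Qed.
Let mL : measurable_fun setT L. Proof. exact: measurable_labels. Qed.

Let row_gt0 k : 0 < mass (A k) L.
Proof. exact: (row_cell_mass_gt0 mxi xi_gt0 xiQ mA mB A_gt0 B_gt0 osc l0). Qed.

Let col_gt0 l : 0 < mass K (B l).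
Proof. exact: (col_cell_mass_gt0 mxi xi_gt0 xiQ mA mB A_gt0 B_gt0 osc k0). Qed.

Let m_row : m = \sum_k mass (A k) L.
Proof. exact: (kernel_mass_sum_row P mxi xi_gt0 xiQ mA mL). Qed.

Let m_col : m = \sum_l mass K (B l).
Proof. exact: (kernel_mass_sum_col P mxi xi_gt0 xiQ mB mK). Qed.

Let m_gt0 : 0 < m.
Proof.
rewrite m_row (bigD1 k0)//= ltr_wpDr ?row_gt0//.
by apply: sumr_ge0 => k _; exact/ltW.
Qed.

(** An edge counts for a row label only if its other endpoint lies in [L], and similarly for
    columns: only edges of the block are counted. The Boolean passes to the complement, so that
    upper tails suffice. *)
Definition cell_event (e : (F + G) * bool) (z : T * T) : bool :=
  (match e.1 with
   | inl k => A k z.1 && L z.2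
   | inr l => K z.1 && B l z.2
   end) (+) e.2.

Definition cell_prob (e : (F + G) * bool) : R :=
  let b := match e.1 with inl k => mass (A k) L | inr l => mass K (B l) end in
  if e.2 then 1 - b else b.

Let measurable_cell_event e : measurable_fun setT (cell_event e).
Proof.
have mE : measurable_fun setT (cell_event (e.1, false)).
  case: e => -[k|l] e2.
    rewrite (_ : cell_event _ = fun z => A k z.1 && L z.2).
      exact: (measurable_rect (mA k) mL).
    by apply/funext => z; rewrite /cell_event addbF.
  rewrite (_ : cell_event _ = fun z => K z.1 && B l z.2); first exact: (measurable_rect mK (mB l)).
  by apply/funext => z; rewrite /cell_event addbF.
case: e mE => e1 [] //= mE.
rewrite (_ : cell_event (e1, true) = fun z => ~~ cell_event (e1, false) z); last first.
  by apply/funext => z; rewrite /cell_event /= addbT addbF.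
exact: measurable_neg.
Qed.

Lemma flattened_cell_event e :
  (\int[mu]_(z in [set z | cell_event e z]) (ze z)%:E = (cell_prob e)%:E)%E.
Proof.
have E e1 : (\int[mu]_(z in [set z | cell_event (e1, false) z]) (ze z)%:E =
    (cell_prob (e1, false))%:E)%E.
  case: e1 => [k|l].
    rewrite (_ : [set z | _] = [set z | A k z.1 && L z.2]); last first.
      by apply/seteqP; split => z /=; rewrite /cell_event addbF.
    apply: (flattened_row_mass mxi xi0 xiP xiQ mK mL m_gt0 (mA k)) => x.
    by move=> /eqP; rewrite /K => ->.
  rewrite (_ : [set z | _] = [set z | K z.1 && B l z.2]); last first.
    by apply/seteqP; split => z /=; rewrite /cell_event addbF.
  apply: (flattened_col_mass mxi xi0 xiP xiQ mK mL m_gt0 (mB l)) => y.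
  by move=> /eqP; rewrite /L => ->.
case: e => e1 []; last exact: E.
have -> : cell_prob (e1, true) = 1 - cell_prob (e1, false) by [].
have mze := measurable_flattened P Q mxi xi0 mK mL.
have ze0 z := flattened_ge0 mxi xi0 xiP xiQ mK mL m_gt0 z.
have := ge0_integral_if mu (measurable_cell_event (e1, false)) mze mze ze0 ze0.
under eq_integral do rewrite if_same.
rewrite flattened_integral1// -integral_mkcond_if E integral_mkcond_if.
have -> : (\int[mu]_x (if cell_event (e1, true) x then ze x else 0)%:E =
    \int[mu]_x (if cell_event (e1, false) x then 0 else ze x)%:E)%E.
  apply: eq_integral => z _; rewrite /cell_event /= addbT addbF.
  by case: (match e1 with inl _ => _ | inr _ => _ end).
set I := (\int[mu]_x _)%E; case: I => [r|//|//] [->].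
by rewrite addrAC subrr add0r.
Qed.

Section fixed_sample.
Variables (x y : nat -> T) (N : nat) (gam g' : R).
Hypotheses (g'0 : 0 < g') (g1 : (#|F| + 1)%:R * g' <= gam * m / 2) (g2 : #|F|%:R * g' <= m / 2).

Definition good_perm (s : 'S_N) := [forall e : (F + G) * bool,
  ~~ (N%:R * cell_prob e + g' * N%:R <=
      #|finset (fun i : 'I_N => cell_event e (x i, y (s i)))|%:R)].

Let rows (s : 'S_N) := block_rows (fun i : 'I_N => kx (x i)) (fun j : 'I_N => ky (y j)) s.
(** The default [k0] is never read on the block, whose rows and columns all carry labels; the same
    holds for [l0] in [lam]. *)
Let kap (i : 'I_N) := odflt k0 (kx (x i)).
Let lam (s : 'S_N) (i : 'I_N) := odflt l0 (ky (y (s i))).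

(** Label counts are within g' N of N times the masses. Summed over the row labels, they put the
    block size within |F| g' N of N m, so N may be replaced by the block size divided by m. *)
Lemma good_perm_typical s : good_perm s ->
  typical_labels (fun k => mass (A k) L / m) (fun l => mass K (B l) / m) (rows s) gam kap (lam s)
  /\ N%:R * (m / 2) <= #|rows s|%:R.
Proof.
move=> /forallP gs.
have dev e1 (c : nat) :
    #|finset (fun i : 'I_N => cell_event (e1, false) (x i, y (s i)))| = c ->
    `|c%:R - N%:R * cell_prob (e1, false)| <= g' * N%:R.
  move=> <-; have := gs (e1, false); have := gs (e1, true); rewrite -!ltNge.
  have -> : (#|finset (fun i : 'I_N => cell_event (e1, true) (x i, y (s i)))|%:R : R) =
      N%:R - #|finset (fun i : 'I_N => cell_event (e1, false) (x i, y (s i)))|%:R.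
    have := cardsC (finset (fun i : 'I_N => cell_event (e1, false) (x i, y (s i)))).
    rewrite card_ord => /(congr1 (fun n => n%:R : R)) <-.
    rewrite natrD [RHS]addrAC subrr add0r; congr (_%:R); apply: eq_card => i; rewrite !inE.
    by rewrite /cell_event /= addbT addbF.
  have -> : cell_prob (e1, true) = 1 - cell_prob (e1, false) by [].
  by move=> h1 h2; rewrite ler_norml; apply/andP; split; lra.
have hk k : `|(label_count (rows s) kap k)%:R - N%:R * mass (A k) L| <= g' * N%:R.
  apply: (dev (inl k)); apply: eq_card => i; rewrite !inE /cell_event /= addbF /A /L /kap.
  by case: (kx (x i)) => [k'|//] /=; rewrite andbC.
have hl l : `|(label_count (rows s) (lam s) l)%:R - N%:R * mass K (B l)| <= g' * N%:R.
  apply: (dev (inr l)); apply: eq_card => i; rewrite !inE /cell_event /= addbF /B /K /lam.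
  by case: (ky (y (s i))) => [l'|] /=; rewrite ?andbF ?andbT.
set n : R := #|rows s|%:R.
have N0 : 0 <= N%:R :> R by [].
have nE : n = \sum_k (label_count (rows s) kap k)%:R.
  rewrite -natr_sum /n; congr (_%:R); rewrite -sum1_card (partition_big kap predT)//=.
  by apply: eq_bigr => k _; rewrite /label_count -sum1_card; apply: eq_bigl => i; rewrite inE.
have hn : `|n - N%:R * m| <= #|F|%:R * (g' * N%:R).
  rewrite nE m_row mulr_sumr -sumrB; apply: le_trans (ler_norm_sum _ _ _) _.
  by apply: le_trans (ler_sum _ (fun k _ => hk k)) _; rewrite sumr_const [leRHS]mulr_natl.
have nm : N%:R * (m / 2) <= n.
  move: hn; rewrite ler_norml => /andP[+ _]; have := ler_wpM2r N0 g2; lra.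
(* One error g' N comes from the count and |F| g' N from the block size, hence the factor |F| + 1 in
   [g1]. Since the block has at least N m / 2 rows, the total is at most gam n. *)
have close (c p : R) : 0 < p -> p <= m -> `|c - N%:R * p| <= g' * N%:R ->
    `|c - n * (p / m)| <= gam * n.
  move=> p0 pm h.
  have -> : c - n * (p / m) = (c - N%:R * p) - (p / m) * (n - N%:R * m).
    by field; rewrite gt_eqF.
  apply: le_trans (ler_normB _ _) _; rewrite normrM (ger0_norm (_ : 0 <= p / m)); last first.
    by rewrite divr_ge0// ltW.
  have pm1 : p / m <= 1 by rewrite ler_pdivrMr// mul1r.
  have h2 : p / m * `|n - N%:R * m| <= 1 * (#|F|%:R * (g' * N%:R)).
    by apply: ler_pM => //; rewrite divr_ge0// ltW.
  have g0 : 0 <= gam.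
    have : 0 <= gam * m / 2 by apply: le_trans g1; rewrite mulr_ge0// ltW.
    by rewrite pmulr_lge0// pmulr_lge0.
  have := ler_wpM2l g0 nm; have := ler_wpM2r N0 g1; rewrite natrD; lra.
split => //; apply/andP; split; apply/forallP => k.
  apply: close => //.
  by rewrite m_row (bigD1 k)//= lerDl; apply: sumr_ge0 => k' _; exact/ltW.
apply: close => //.
by rewrite m_col (bigD1 k)//= lerDl; apply: sumr_ge0 => k' _; exact/ltW.
Qed.

(** A permutation that is not good reaches the threshold of some event [e], so its term occurs in
    the deviating average of [e]. *)
Lemma perm_average_split :
  perm_average ze N x y <=
  (N`!)%:R^-1 * \sum_(s : 'S_N | good_perm s) \prod_(i < N) ze (x i, y (s i)) +
  \sum_(e : (F + G) * bool)
     deviating_average ze (cell_event e) (N%:R * cell_prob e + g' * N%:R) N x y.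
Proof.
have ze0 z := flattened_ge0 mxi xi0 xiP xiQ mK mL m_gt0 z.
rewrite /perm_average /deviating_average -mulr_sumr -mulrDr ler_wpM2l ?invr_ge0//.
rewrite [leLHS](bigID good_perm)/= lerD2l.
rewrite (exchange_big_dep predT)//= big_mkcond /=; apply: ler_sum => s _.
have pz : 0 <= \prod_(i < N) ze (x i, y (s i)) by apply: prodr_ge0.
case: ifPn => [|_]; last by apply: sumr_ge0.
rewrite negb_forall => /existsP[e]; rewrite negbK => he.
by rewrite (bigD1 e)//= lerDl; apply: sumr_ge0.
Qed.

(** An instance of [perm_sum_block_ge] with oscillation 3 th, the loss in [flattened_cell_le]. *)
Lemma perm_average_good_le (del : R) : 0 <= del ->
  (forall s, good_perm s -> expR (- (del * #|rows s|%:R)) <=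
     (#|rows s|)`!%:R^-1 * labeled_permanent (rows s) wt kap (lam s)) ->
  expR (- ((3 * th + del) * N%:R)) *
    ((N`!)%:R^-1 * \sum_(s : 'S_N | good_perm s) \prod_(i < N) ze (x i, y (s i)))
  <= perm_average xi N x y.
Proof.
move=> del0 goodP.
have ze0 z := flattened_ge0 mxi xi0 xiP xiQ mK mL m_gt0 z.
rewrite mulrCA /perm_average ler_wpM2l ?invr_ge0//.
apply: (@perm_sum_block_ge R N F G (fun i j => xi (x i, y j)) (fun i j => ze (x i, y j))
  (fun i => kx (x i)) (fun j => ky (y j)) k0 l0 wt (fun i => row_mass Q xi L (x i))
  (fun j => col_mass P xi K (y j) / m)) => //.
- move=> k l; rewrite /cell_weight divr_ge0// mulr_ge0//.
  + by apply: ltW; exact: (cell_mass_gt0 mxi xi_gt0 xiQ mA mB A_gt0 B_gt0 osc).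
  + exact: ltW.
  + by apply: ltW; exact: row_gt0.
  + by apply: ltW; exact: col_gt0.
- by rewrite mulr_ge0.
- by move=> i j; rewrite /flattened /K /L /= => /negbTE ->.
- move=> i j k l /eqP Ax /eqP By.
  exact: (flattened_cell_le mxi xi_gt0 xiP xiQ mA mB A_gt0 B_gt0 osc k0 l0 Ax By m_gt0).
- by move=> i j ki lj; rewrite /flattened /K /L /= ki lj.
Qed.

End fixed_sample.

(** Two exceptional events are discarded. By Markov's inequality for the squared deviation, (D -
    1)^2 >= 1/4 has probability at most 4 chi / (1 - chi) <= 8 rho; the deviating averages sum to at
    least 1/4 with probability at most rho. Otherwise good permutations contribute more than 1/2 -
    1/4, whence the final 1/4 and the 9 rho. *)
Lemma perm_average_lower_tail (del e rho : R) : 0 < del -> 0 < rho -> rho <= 2^-1 ->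
  (\int[mu]_z (if K z.1 && L z.2 then 0 else xi z ^+ 2)%:E <= e%:E)%E ->
  e + m ^- 2 - 1 <= rho ->
  exists N0, forall N, (N0 <= N)%N ->
    (Pr [set w | (perm_average xi N (Z w \o inl) (Z w \o inr) <=
                  expR (- ((3 * th + del) * N%:R)) / 4)%R] <= (9 * rho)%:E)%E.
Proof.
move=> del0 rho0 rho2 he hrho.
have [chi [chiE chi_le]] := flattened_chi2 mxi xi0 xiP xiQ mK mL m_gt0 he.
have {he hrho}chi_rho : chi <= rho by lra.
have chi0 : 0 <= chi.
  by rewrite -lee_fin -chiE; apply: integral_ge0 => z _; rewrite lee_fin sqr_ge0.
have mze := measurable_flattened P Q mxi xi0 mK mL.
have ze0 z := flattened_ge0 mxi xi0 xiP xiQ mK mL m_gt0 z.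
have zeP y := flattened_col mxi xi0 xiP xiQ mK mL m_gt0 y.
have zeQ x := flattened_row mxi xi0 xiP xiQ mK mL m_gt0 x.
have ze1 := flattened_integral1 mxi xi0 xiP xiQ mK mL m_gt0.
have cell0 k l : 0 < mass (A k) (B l).
  exact: (cell_mass_gt0 mxi xi_gt0 xiQ mA mB A_gt0 B_gt0 osc).
have m0 : m != 0 by rewrite gt_eqF.
have rowE k : \sum_l mass (A k) (B l) = mass (A k) L.
  by rewrite -(kernel_mass_sum_col P mxi xi_gt0 xiQ mB (mA k)).
have colE l : \sum_k mass (A k) (B l) = mass K (B l).
  by rewrite -(kernel_mass_sum_row P mxi xi_gt0 xiQ mA (mB l)).
have row_neq0 k : mass (A k) L != 0 by rewrite gt_eqF.
have col_neq0 l : mass K (B l) != 0 by rewrite gt_eqF.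
have wE k l : wt k l = mass (A k) (B l) * m / (mass (A k) L * mass K (B l)) by [].
have [gam [gam0 [n0 hFL]]] : exists gam : R, 0 < gam /\ exists n0 : nat,
    forall (U : finType) (I : {set U}) (kap : U -> F) (lam : U -> G), (n0 <= #|I|)%N ->
      typical_labels (fun k => mass (A k) L / m) (fun l => mass K (B l) / m) I gam kap lam ->
      expR (- (del * #|I|%:R)) <= (#|I|)`!%:R^-1 * labeled_permanent I wt kap lam.
  apply: labeled_permanent_ge => //.
  - by move=> k; rewrite divr_gt0.
  - by move=> l; rewrite divr_gt0.
  - by rewrite -mulr_suml -m_row mulfV.
  - by rewrite -mulr_suml -m_col mulfV.
  - move=> k l; apply: divr_gt0; apply: mulr_gt0.
    + exact: cell0.
    + exact: m_gt0.
    + exact: row_gt0.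
    + exact: col_gt0.
  - move=> k; transitivity ((\sum_l mass (A k) (B l)) / mass (A k) L).
      rewrite mulr_suml; apply: eq_bigr => l _; rewrite wE.
      by field; rewrite m0 !gt_eqF.
    by rewrite rowE mulfV.
  - move=> l; transitivity ((\sum_k mass (A k) (B l)) / mass K (B l)).
      rewrite mulr_suml; apply: eq_bigr => k _; rewrite wE.
      by field; rewrite m0 !gt_eqF.
    by rewrite colE mulfV.
pose c : R := (#|F| + 1)%:R.
have c0 : 0 < c by rewrite ltr0n addn1.
(* The outer minimum keeps g' in the range of the Chernoff bound. The inner one makes c g' at most
   both gam m / 2 and m / 2, the two conditions of [good_perm_typical]. *)
pose g' := Num.min 1 (Num.min 1 gam * m / (2 * c)).
have g1 : 0 < Num.min 1 gam by rewrite lt_min ltr01.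
have g'0 : 0 < g' by rewrite lt_min ltr01 divr_gt0 ?mulr_gt0.
have g'1 : g' <= 1 by rewrite /g' ge_min lexx.
have cg : c * g' <= Num.min 1 gam * m / 2.
  have : g' <= Num.min 1 gam * m / (2 * c) by rewrite /g' ge_min lexx orbT.
  move=> /(ler_wpM2l (ltW c0)); rewrite (_ : c * (_ / _) = Num.min 1 gam * m / 2)//.
  by field; rewrite gt_eqF.
have hg1 : (#|F| + 1)%:R * g' <= gam * m / 2.
  apply: le_trans cg _; rewrite ler_pM2r// ler_pM2r//.
  by rewrite ge_min lexx orbT.
have hg2 : #|F|%:R * g' <= m / 2.
  apply: (@le_trans _ _ (c * g')); first by rewrite ler_pM2r// ler_nat leq_addr.
  apply: le_trans cg _; rewrite ler_pM2r// -[leRHS]mul1r ler_pM2r//.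
  by rewrite ge_min lexx.
pose M : R := (#|F| + #|G|)%:R.
(* The first summand brings the block, of size at least N m / 2, up to [n0]; the second brings the
   sum of the 2 (|F| + |G|) deviation bounds down to rho / 4. *)
pose bnd := 2 * n0%:R / m + 64 * M / (rho * g' ^+ 2).
have b1 : 0 <= 2 * n0%:R / m by rewrite divr_ge0 ?mulr_ge0// ltW.
have rg0 : 0 < rho * g' ^+ 2 by rewrite mulr_gt0// exprn_gt0.
have b2 : 0 <= 64 * M / (rho * g' ^+ 2).
  by apply: divr_ge0; [exact: mulr_ge0|exact: ltW].
have bnd0 : 0 <= bnd by rewrite addr_ge0.
exists (Num.bound bnd) => N hN.
have Nb : bnd <= N%:R by rewrite (le_trans (ltW (archi_boundP bnd0)))// ler_nat.
have Nn0 : n0%:R <= N%:R * (m / 2).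
  have : 2 * n0%:R / m <= N%:R by apply: le_trans Nb; rewrite lerDl.
  by rewrite ler_pdivrMr//; lra.
have Nsmall : (2 * (#|F| + #|G|))%:R * expR (- (g' ^+ 2 / 8 * N%:R)) <= rho / 4.
  have x0 : 0 <= g' ^+ 2 / 8 * N%:R by rewrite mulr_ge0// divr_ge0// sqr_ge0.
  have hM : 64 * M <= N%:R * (rho * g' ^+ 2).
    by rewrite -ler_pdivrMr//; apply: le_trans Nb; rewrite lerDr.
  apply: (@le_trans _ _ (2 * M * (1 + g' ^+ 2 / 8 * N%:R)^-1)).
    by rewrite natrM ler_wpM2l// ?mulr_ge0// expRN_le_inv.
  have x1 : 0 < 1 + g' ^+ 2 / 8 * N%:R by lra.
  rewrite ler_pdivrMr//; move: hM; rewrite -subr_ge0 => hM.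
  have : 0 <= rho / 4 by lra.
  lra.
pose th' (ev : (F + G) * bool) := N%:R * cell_prob ev + g' * N%:R.
pose dev (ev : (F + G) * bool) (w : Om) :=
  deviating_average ze (cell_event ev) (th' ev) N (Z w \o inl) (Z w \o inr).
have mev ev : measurable [set z | cell_event ev z] by exact: measurable_bool_set.
have mdev ev : measurable_fun setT (dev ev).
  by apply: (measurable_deviating_average indepZ) => //; exact: mev.
have dev0 ev w : 0 <= dev ev w.
  by rewrite mulr_ge0 ?invr_ge0//; apply: sumr_ge0 => s _; exact: prodr_ge0.
have Edev ev : (\int[Pr]_w (dev ev w)%:E <= (expR (- (g' ^+ 2 / 8 * N%:R)))%:E)%E.
  apply: (expectation_deviating_average indepZ mze ze0 ze1 (mev ev) (flattened_cell_event ev)).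
    exact: ltW.
  by lra.
pose S w := \sum_ev dev ev w.
have mS : measurable_fun setT S by exact: measurable_sum.
have S0 w : 0 <= S w by apply: sumr_ge0.
have PS : (Pr [set w | (4^-1 <= S w)%R] <= rho%:E)%E.
  apply: markov_le => //.
  rewrite /S; under eq_integral do rewrite -sumEFin.
  rewrite ge0_integral_sum//; last 2 first.
  - by move=> ev; exact/measurable_EFinP.
  - by move=> ev w _; rewrite lee_fin.
  apply: (@le_trans _ _ (\sum_(e : (F + G) * bool) (expR (- (g' ^+ 2 / 8 * N%:R)))%:E)%E).
    by apply: lee_sum => ev _.
  rewrite sumEFin -EFinM lee_fin sumr_const card_prod card_sum card_bool -[leLHS]mulr_natl mulnC.
  by apply: le_trans Nsmall _; lra.
pose D w := perm_average ze N (Z w \o inl) (Z w \o inr).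
have mD : measurable_fun setT D by apply: (measurable_perm_average indepZ).
have mD2 : measurable_fun setT (fun w => (D w - 1) ^+ 2).
  by apply: measurable_funX; exact: measurable_funB.
have PD : (Pr [set w | (4^-1 <= (D w - 1) ^+ 2)%R] <= (8 * rho)%:E)%E.
  apply: markov_le => //; first by move=> w; exact: sqr_ge0.
  have chi1 : chi < 1 by lra.
  apply: le_trans (perm_average_variance indepZ mze ze0 zeP zeQ chiE chi1 N) _.
  rewrite -EFinM lee_fin ler_pdivrMr; nra.
set E1 := [set w | (4^-1 <= S w)%R] in PS; set E2 := [set w | (4^-1 <= (D w - 1) ^+ 2)%R] in PD.
have mE1 : measurable E1 by rewrite -[X in measurable X]setTI; exact: measurable_fun_ler.
have mE2 : measurable E2 by rewrite -[X in measurable X]setTI; exact: measurable_fun_ler.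
apply: (@le_trans _ _ (Pr (E1 `|` E2))); last first.
  apply: le_trans (measureU2 _ _ _) _ => //.
  by apply: le_trans (leeD PS PD) _; rewrite -EFinD lee_fin; lra.
apply: le_measure; rewrite ?inE.
- rewrite -[X in measurable X]setTI; apply: measurable_fun_ler => //.
  exact: (measurable_perm_average indepZ).
- exact: measurableU.
move=> wo /= hw; apply: contrapT => /not_orP[/negP + /negP +]; rewrite -!ltNge => S4 D4.
pose x := Z wo \o inl; pose y := Z wo \o inr.
have Dhalf : 2^-1 < D wo by nra.
have split_ := perm_average_split x y N g'.
have good_ := @perm_average_good_le x y N g' del (ltW del0).
set Dg := (N`!)%:R^-1 * _ in split_ good_.
have Dg4 : 4^-1 < Dg.
  have : D wo <= Dg + S wo by exact: split_.
  lra.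
have {}good_ : expR (- ((3 * th + del) * N%:R)) * Dg <= perm_average xi N x y.
  apply: good_ => s gs; have [typ nN] := good_perm_typical g'0 hg1 hg2 gs.
  apply: hFL => //.
  by have := le_trans Nn0 nN; rewrite ler_nat.
have : expR (- ((3 * th + del) * N%:R)) * 4^-1 < expR (- ((3 * th + del) * N%:R)) * Dg.
  by rewrite ltr_pM2l ?expR_gt0.
by move=> /lt_le_trans/(_ good_)/lt_le_trans/(_ hw); rewrite ltxx.
Qed.

End lower_tail.

(** * Choice of the cells for a kernel with exact marginals *)

Section pruned_labels.
Context {R : realType} {d} {T : measurableType d} (P : probability T R).
Variables (F : finType) (kx : T -> option F).
Hypothesis mk : forall k, measurable_fun setT (fun x => kx x == Some k).

Definition charged (k : F) : bool := (0 < P [set x | kx x == Some k])%E.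

(** The cell ratios need cells of positive mass. Labels of null cells are removed from the type, and
    the points of these cells become unlabeled. *)
Definition pruned_label (x : T) : option {k : F | charged k} := obind insub (kx x).

Lemma pruned_labelE x (k : {k : F | charged k}) :
  (pruned_label x == Some k) = (kx x == Some (val k)).
Proof.
rewrite /pruned_label; case: (kx x) => //= k'.
case: insubP => [k'' _ <-|nk] /=.
  by rewrite !(inj_eq Some_inj) (inj_eq val_inj).
by apply/esym/negbTE; apply: contra nk => /eqP [->]; exact: valP.
Qed.

Lemma measurable_pruned_label k : measurable_fun setT (fun x => pruned_label x == Some k).
Proof. by under eq_fun do rewrite pruned_labelE; exact: mk. Qed.

Lemma pruned_label_charged k : (0 < P [set x | pruned_label x == Some k])%E.
Proof.
rewrite (_ : [set x | _] = [set x | kx x == Some (val k)]); first exact: (valP k).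
by apply/seteqP; split => x /=; rewrite pruned_labelE.
Qed.

(** The newly unlabeled points lie in finitely many null cells. *)
Lemma pruned_unlabeled_le (t : R) : (P [set x | ~~ kx x] <= t%:E)%E ->
  (P [set x | ~~ pruned_label x] <= t%:E)%E.
Proof.
have mset k : measurable [set x | kx x == Some k] by exact: measurable_bool_set.
have mun : measurable [set x | ~~ kx x] by apply: measurable_negb_set; exact: measurable_labels.
have mpr : measurable [set x | ~~ pruned_label x].
  by apply: measurable_negb_set; exact: (measurable_labels measurable_pruned_label).
apply: le_trans.
pose A (k : option F) := if k is Some k then [set x | kx x == Some k] else [set x | ~~ kx x].
have mA k : measurable (A k) by case: k.
pose D := [set k : option F | if k is Some k then ~~ charged k else true].
apply: le_trans (@content_sub_fsum _ _ _ P _ D [set x | ~~ pruned_label x] A _ _ _ _) _ => //.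
  exact: finite_finset.
  move=> x /=; rewrite /pruned_label; case E: (kx x) => [k|] /= nk.
    exists (Some k) => /=; last by rewrite E.
    by move: nk; case: insubP.
  by exists None => //=; rewrite E.
rewrite (fsbigD1 None)//= fsbig1 ?adde0// => -[k|] [//= nk _].
by apply/eqP; rewrite eq_le measure_ge0 andbT leNgt.
Qed.

End pruned_labels.

Section regular_kernels.
Context {R : realType} {d} {T : measurableType d}.
Variables (P Q : probability T R).
Local Notation mu := (P \x Q)%E.

Lemma ge0_integral_fst (f : T -> R) : measurable_fun setT f -> (forall x, 0 <= f x) ->
  (\int[mu]_z (f z.1)%:E = \int[P]_x (f x)%:E)%E.
Proof.
move=> mf f0; rewrite fubini_tonelli1//.
- by apply: eq_integral => x _; rewrite /fubini_F /= integral_cst_probability.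
- by apply/measurable_EFinP; exact: measurableT_comp.
- by move=> z; rewrite lee_fin.
Qed.

Lemma ge0_integral_snd (f : T -> R) : measurable_fun setT f -> (forall x, 0 <= f x) ->
  (\int[mu]_z (f z.2)%:E = \int[Q]_y (f y)%:E)%E.
Proof.
move=> mf f0; rewrite fubini_tonelli2//.
- by apply: eq_integral => x _; rewrite /fubini_G /= integral_cst_probability.
- by apply/measurable_EFinP; exact: measurableT_comp.
- by move=> z; rewrite lee_fin.
Qed.

Lemma integral_unlabeled (nu : probability T R) (K : T -> bool) : measurable_fun setT K ->
  (\int[nu]_x (if K x then 0 else 1)%:E = nu [set x | ~~ K x])%E.
Proof.
move=> mK.
have mS := measurable_negb_set mK.
rewrite -[RHS]mul1e -integral_cst// integral_mkcond; apply: eq_integral => x _.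
by rewrite patchE mem_setE unfold_in /=; case: (K x).
Qed.

(** Where f > M the tail integral applies. Where f <= M, off the rectangle, f is at most [M] times
    the sum of the indicators of leaving [K] and of leaving [L]. *)
Lemma outside_rect_le (K L : T -> bool) (f : T * T -> R) (M t e : R) :
  measurable_fun setT K -> measurable_fun setT L -> measurable_fun setT f ->
  (forall z, 0 <= f z) -> 0 <= M ->
  (P [set x | ~~ K x] <= t%:E)%E -> (Q [set y | ~~ L y] <= t%:E)%E ->
  (\int[mu]_z (if f z <= M then 0 else f z)%:E <= e%:E)%E ->
  (\int[mu]_z (if K z.1 && L z.2 then 0 else f z)%:E <= (e + M * (t + t))%:E)%E.
Proof.
move=> mK mL mf f0 M0 Pt Qt he.
have mO (C : T -> bool) : measurable_fun setT C ->
    measurable_fun setT (fun x => if C x then 0 else 1 : R).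
  by move=> mC; exact: measurable_fun_ifT.
pose o1 (z : T * T) : R := if K z.1 then 0 else 1.
pose o2 (z : T * T) : R := if L z.2 then 0 else 1.
have mo1 : measurable_fun setT o1 by exact: (measurableT_comp (mO K mK)).
have mo2 : measurable_fun setT o2 by exact: (measurableT_comp (mO L mL)).
have o10 z : 0 <= o1 z by rewrite /o1; case: ifP.
have o20 z : 0 <= o2 z by rewrite /o2; case: ifP.
have mt : measurable_fun setT (fun z => if f z <= M then 0 else f z).
  by apply: measurable_fun_ifT => //; exact: measurable_fun_ler.
have t0 z : 0 <= (if f z <= M then 0 else f z) by case: ifP.
apply: (@le_trans _ _ (\int[mu]_z ((if f z <= M then 0 else f z) + M * (o1 z + o2 z))%:E)%E).
  apply: ge0_le_integral_fin.
  - by apply: measurable_fun_ifT => //; exact: measurable_rect.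
  - by apply: measurable_funD => //; apply: measurable_funM => //; exact: measurable_funD.
  - by move=> z; case: ifP.
  - move=> z; case: ifPn => [_|]; first by rewrite addr_ge0// mulr_ge0// addr_ge0.
    rewrite negb_and => h; have h1 : 1 <= o1 z + o2 z.
      by move: h; rewrite /o1 /o2; case: (K _); case: (L _) => //= _; rewrite ?addr0 ?add0r// lerDl.
    case: ifP => [fM|_]; first by rewrite add0r (le_trans fM)// ler_peMr.
    by rewrite lerDl mulr_ge0// addr_ge0.
have mo := measurable_funD mo1 mo2.
have o0 z : 0 <= o1 z + o2 z by rewrite addr_ge0.
rewrite ge0_integral_addr//; last 2 first.
- exact: measurable_funM.
- by move=> z; rewrite mulr_ge0.
rewrite EFinD leeD// ge0_integral_scaler// EFinM lee_wpmul2l// ge0_integral_addr// EFinD leeD//.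
- rewrite (@ge0_integral_fst (fun x => if K x then 0 else 1)) ?integral_unlabeled//.
    exact: mO.
  by move=> x; case: ifP.
- rewrite (@ge0_integral_snd (fun y => if L y then 0 else 1)) ?integral_unlabeled//.
    exact: mO.
  by move=> x; case: ifP.
Qed.

End regular_kernels.

(** Absorbs the factor 1/4 of [perm_average_lower_tail] into the exponential rate. *)
Lemma exp_gap {R : realType} (del : R) : 0 < del -> exists N0 : nat, forall N, (N0 <= N)%N ->
  expR (- (del * N%:R)) <= expR (- (del / 2 * N%:R)) / 4.
Proof.
move=> del0; exists (Num.bound (4 * 2 / del)) => N hN.
have hb : 4 * 2 / del <= N%:R.
  apply: le_trans (ltW (archi_boundP _)) _; last by rewrite ler_nat.
  by rewrite divr_ge0// ltW.
have h4 : 4 <= expR (del / 2 * N%:R).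
  apply: (@le_trans _ _ (1 + del / 2 * N%:R)); last exact: expR_ge1Dx.
  by move: hb; rewrite ler_pdivrMr// => hb; lra.
have -> : del * N%:R = del / 2 * N%:R + del / 2 * N%:R by field.
move: (del / 2 * N%:R) h4 => x h4.
by rewrite opprD expRD ler_wpM2l ?expR_ge0// expRN lef_pV2 ?posrE ?expR_gt0.
Qed.

Lemma measurable_perm_average_le {R : realType} {d d'} {Om : measurableType d}
    {T : measurableType d'} (Pr : probability Om R) (P Q : probability T R)
    (Z : Om -> config T (nat + nat)%type) (g : T * T -> R) N (r : R) :
  independent_family Pr Z (two_sample_law P Q) -> measurable_fun setT g ->
  measurable [set w | perm_average g N (Z w \o inl) (Z w \o inr) <= r].
Proof.
move=> indepZ mg; apply: measurable_bool_set; apply: measurable_fun_ler => //.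
exact: (measurable_perm_average indepZ).
Qed.

Section regular_lower_tail.
Context {R : realType} {d d'} {Om : measurableType d} {T : measurableType d'}.
Variables (Pr : probability Om R) (P Q : probability T R).
Variable (Z : Om -> config T (nat + nat)%type).
Hypothesis indepZ : independent_family Pr Z (two_sample_law P Q).
Variables (xi : T * T -> R).
Hypotheses (mxi : measurable_fun setT xi) (xi_gt0 : forall z, 0 < xi z).
Hypothesis xiP : forall y, (\int[P]_x (xi (x, y))%:E = 1)%E.
Hypothesis xiQ : forall x, (\int[Q]_y (xi (x, y))%:E = 1)%E.
Local Notation mu := (P \x Q)%E.
Hypothesis xi2 : (\int[mu]_z (xi z ^+ 2)%:E < +oo)%E.
Hypothesis cells : forall th t : R, 0 < th -> 0 < t ->
  exists (F G : finType) (kx : T -> option F) (ky : T -> option G),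
  [/\ forall k, measurable_fun setT (fun x => kx x == Some k),
      forall l, measurable_fun setT (fun y => ky y == Some l),
      (P [set x | ~~ kx x] <= t%:E)%E, (Q [set y | ~~ ky y] <= t%:E)%E &
      forall k l x x' y y',
        kx x == Some k -> kx x' == Some k -> ky y == Some l -> ky y' == Some l ->
        xi (x, y) <= expR th * xi (x', y')].

Let xi0 z : 0 <= xi z. Proof. exact: ltW. Qed.

Let label_exists (nu : probability T R) (F : finType) (kx : T -> option F) (t : R) :
  t < 1 -> (nu [set x | ~~ kx x] <= t%:E)%E -> exists k : F, True.
Proof.
move=> t1 ht; have [[x kxx]|] := pselect (exists x, kx x : bool).
  by case: (kx x) kxx => // k _; exists k.
move=> nex; suff : (1%:E <= t%:E)%E by rewrite lee_fin leNgt t1.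
apply: le_trans ht; rewrite (_ : [set x | _] = setT); last first.
  by apply/seteqP; split => x //= _; apply/negP => kxx; apply: nex; exists x.
rewrite [leRHS](_ : _ = 1%E)//; exact: probability_setT.
Qed.

Let inverse_square_bound (r m : R) : 0 < r -> r <= 2^-1 -> 1 - r / 8 <= m ->
  r / 4 + m ^- 2 - 1 <= r.
Proof.
move=> r0 r2 hm; have m0 : 0 < m by lra.
have a0 : 0 < 1 - r / 8 by lra.
suff : m ^- 2 <= 1 + r / 2 by lra.
apply: (@le_trans _ _ ((1 - r / 8) ^- 2)).
  by rewrite lef_pV2 ?posrE ?exprn_gt0// lerXn2r// nnegrE ltW.
rewrite -[_ ^- 2]mul1r ler_pdivrMr ?exprn_gt0//.
nra.
Qed.

Lemma regular_lower_tail (del rho : R) : 0 < del -> 0 < rho ->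
  exists N0, forall N, (N0 <= N)%N ->
    (Pr [set w | (perm_average xi N (Z w \o inl) (Z w \o inr) <=
                  expR (- (del * N%:R)))%R] <= rho%:E)%E.
Proof.
move=> del0 rho0.
have [r [r0 r2 r9]] : exists r : R, [/\ 0 < r, r <= 2^-1 & 9 * r <= rho].
  exists (Num.min (rho / 9) 2^-1); split.
  - by rewrite lt_min divr_gt0//=.
  - by rewrite ge_min lexx orbT.
  - by rewrite mulrC -ler_pdivlMr// ge_min lexx.
have mx2 : measurable_fun setT (fun z => xi z ^+ 2) by exact: measurable_funX.
(* Off the rectangle, the square of [xi] is allowed r / 16 from its values above M and M (t + t) <=
   r / 32 from its values below M. *)
have r16 : 0 < r / 16 by rewrite divr_gt0.
have [M [M0 hM]] := integral_large_values mx2 (fun z => sqr_ge0 (xi z)) xi2 r16.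
have M0' : 1 <= M%:R :> R by rewrite (ler_nat _ 1).
have [t [t0 hMt]] : exists t : R, 0 < t /\ M%:R * (t + t) <= r / 32.
  exists (r / 32 / (M%:R * 2)); split; first by rewrite !divr_gt0// mulr_gt0// (lt_le_trans _ M0').
  by rewrite [leLHS](_ : _ = r / 32)//; field; rewrite gt_eqF// (lt_le_trans _ M0').
have tt : t + t <= r / 32 by apply: le_trans hMt; rewrite ler_peMl// addr_ge0// ltW.
(* Three oscillation losses of del / 12 and a permanent loss of del / 4 make del / 2; the other del
   / 2 pays for the factor 1/4 through [exp_gap]. *)
have th0 : 0 < del / 12 by rewrite divr_gt0.
have [F [G [kx [ky [mA mB Pt Qt osc]]]]] := cells th0 t0.
have mA' k : measurable_fun setT (fun x => pruned_label P kx x == Some k).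
  exact: measurable_pruned_label.
have mB' l : measurable_fun setT (fun y => pruned_label Q ky y == Some l).
  exact: measurable_pruned_label.
have Pt' := pruned_unlabeled_le mA Pt; have Qt' := pruned_unlabeled_le mB Qt.
have t1 : t < 1 by lra.
have [k0 _] := label_exists t1 Pt'; have [l0 _] := label_exists t1 Qt'.
have mK := measurable_labels mA'; have mL := measurable_labels mB'.
have osc' k l x x' y y' : pruned_label P kx x == Some k -> pruned_label P kx x' == Some k ->
    pruned_label Q ky y == Some l -> pruned_label Q ky y' == Some l ->
    xi (x, y) <= expR (del / 12) * xi (x', y').
  by rewrite !pruned_labelE; exact: osc.
have ML0 : 0 <= M%:R :> R by [].
have h2 := outside_rect_le mK mL mx2 (fun z => sqr_ge0 (xi z)) ML0 Pt' Qt' hM.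
have {}h2 : (\int[mu]_z (if pruned_label P kx z.1 && pruned_label Q ky z.2 then 0 else xi z ^+ 2)%:E
    <= (r / 16 + r / 32)%:E)%E.
  by apply: le_trans h2 _; rewrite lee_fin lerD2l.
have hm : 1 - r / 8 <= kernel_mass P Q xi (pruned_label P kx) (pruned_label Q ky).
  have h1 : (\int[mu]_z (if pruned_label P kx z.1 && pruned_label Q ky z.2 then 0 else 1)%:E
      <= (r / 32)%:E)%E.
    have := @outside_rect_le _ _ _ P Q _ _ (cst 1) 1 t 0 mK mL (measurable_cst _)
      (fun _ => ler01) ler01 Pt' Qt'.
    rewrite add0r mul1r => h; apply: (@le_trans _ _ (t + t)%:E); last by rewrite lee_fin.
    apply: h; rewrite /cst; under eq_integral do rewrite lexx.
    by rewrite integral0.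
  (* Off the rectangle xi <= 1 + xi^2, so the two preceding bounds add up to r / 8. The rectangle
     then has mass at least 1 - r / 8, which [inverse_square_bound] turns into a chi-square distance
     of at most r. *)
  have h12 : (\int[mu]_z (if pruned_label P kx z.1 && pruned_label Q ky z.2 then 0 else xi z)%:E
      <= (r / 8)%:E)%E.
    have mKL := measurable_rect mK mL.
    rewrite (_ : r / 8 = r / 32 + (r / 16 + r / 32)); last by field.
    rewrite EFinD; apply: le_trans (leeD h1 h2).
    have if0 (g : T * T -> R) (B : T * T -> bool) : (forall z, 0 <= g z) ->
        forall z, 0 <= (if B z then 0 else g z) by move=> g0 z; case: ifP.
    have mif (g : T * T -> R) : measurable_fun setT g -> measurable_fun setT (fun z =>
        if pruned_label P kx z.1 && pruned_label Q ky z.2 then 0 else g z).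
      by move=> mg; exact: measurable_fun_ifT.
    rewrite -ge0_integral_addr; [|exact: mif|exact: mif|exact: if0|].
      apply: ge0_le_integral_fin; [exact: mif|by apply: measurable_funD; exact: mif|exact: if0|].
      move=> z; case: ifP => _; first by rewrite addr0.
      by have := sqr_ge0 (xi z - 1); nra.
    by apply: if0 => z; exact: sqr_ge0.
  rewrite lerBlDr -lee_fin EFinD -kernel_massE//.
  apply: le_trans (leeD (lexx _) h12).
  rewrite -(ge0_integral_if mu (measurable_rect mK mL) mxi mxi xi0 xi0).
  by under eq_integral do rewrite if_same; rewrite (@kernel_integral1 _ _ _ P Q).
have {}h2 : (\int[mu]_z (if pruned_label P kx z.1 && pruned_label Q ky z.2 then 0 else xi z ^+ 2)%:E
    <= (r / 4)%:E)%E.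
  by apply: le_trans h2 _; rewrite lee_fin; lra.
have del4 : 0 < del / 4 by rewrite divr_gt0.
have [N1 hN1] := perm_average_lower_tail indepZ mxi xi_gt0 xiP xiQ mA' mB'
  (@pruned_label_charged _ _ _ P _ kx) (@pruned_label_charged _ _ _ Q _ ky) (ltW th0)
  osc' k0 l0 del4 r0 r2 h2
  (inverse_square_bound r0 r2 hm).
have [N2 hN2] := exp_gap del0.
exists (maxn N1 N2) => N; rewrite geq_max => /andP[/hN1 h1 /hN2 h3].
apply: (@le_trans _ _ (9 * r)%:E); last by rewrite lee_fin.
apply: le_trans h1; apply: le_measure; rewrite ?inE.
- exact: (measurable_perm_average_le _ _ indepZ).
- exact: (measurable_perm_average_le _ _ indepZ).
- move=> w /= hw; apply: le_trans hw _; apply: le_trans h3 _.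
  by rewrite (_ : 3 * (del / 12) + del / 4 = del / 2)//; field.
Qed.

End regular_lower_tail.

(** * Cells on which the Schroedinger kernel is almost constant *)

Lemma compact_unif_continuous {R : realType} {U : pseudoMetricType R} (K : set U) (f : U -> R)
    (e : R) : compact K -> continuous f -> 0 < e ->
  exists2 r : R, 0 < r & forall x x', K x -> ball x r x' -> `|f x - f x'| < e.
Proof.
move=> /compact_near_coveringP cK cf e0.
have e20 : 0 < e / 2 by rewrite divr_gt0.
have := cK R (0^'+) (fun r x => forall x', ball x r x' -> `|f x - f x'| < e) _ _.
case=> [x0 _|].
  have /cvgrPdist_lt/(_ _ e20) := cf x0.
  case/nbhs_ballP => d /= d0 hd.
  have d20 : 0 < d / 2 by rewrite divr_gt0.
  (* Half of the radius is spent between [x0] and [x], the other half between [x] and [x']; thus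
     [x'] may leave the compact set. *)
  exists (ball x0 (d / 2), [set r | r < d / 2]) => /=.
    split; first exact: nbhsx_ballx.
    exact: nbhs_right_lt.
  move=> [x r] /= [x0x rd] x' xx'.
  have h1 := hd _ (le_ball _ x0x).
  have h2 : `|f x0 - f x'| < e / 2.
    apply: hd; rewrite (splitr d); apply: ball_triangle x0x _.
    exact: le_ball (ltW rd) _ xx'.
  have {}h1 : `|f x0 - f x| < e / 2 by apply: h1; rewrite ler_pdivrMr// ler_peMr ?ltW// ltr1n.
  rewrite (_ : f x - f x' = (f x0 - f x') - (f x0 - f x)); last by ring.
  by rewrite (le_lt_trans (ler_normB _ _))// (splitr e) ltrD.
move=> r0 /= r00 hr.
exists (r0 / 2); first by rewrite divr_gt0.
move=> x x' Kx; apply: hr => //=; last by rewrite divr_gt0.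
  by rewrite sub0r normrN gtr0_norm ?divr_gt0// ltr_pdivrMr// ltr_pMr// ltr1n.
Qed.

Section grid_labels.
Context {R : realType} {d} {T : measurableType d}.

Lemma measurable_forallb (I : finType) (g : I -> T -> bool) :
  (forall i, measurable_fun setT (g i)) -> measurable_fun setT (fun x => [forall i, g i x]).
Proof.
move=> mg; apply: (measurable_fun_bool true); rewrite setTI.
rewrite (_ : _ @^-1` _ = \bigcap_(i in [set: I]) [set x | g i x]); last first.
  apply/seteqP; split => x /=; first by move=> /forallP h i _; exact: h.
  by move=> h; apply/forallP => i; exact: h.
by apply: fin_bigcap_measurable => // i _; exact: measurable_bool_set.
Qed.

Variables (I : finType) (f : I -> T -> R) (g : T -> bool).
Hypotheses (mf : forall i, measurable_fun setT (f i)) (mg : measurable_fun setT g).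

Let measurable_norm_le i (M : R) : measurable_fun setT (fun x => `|f i x| <= M).
Proof. by apply: measurable_fun_ler => //; exact: measurableT_comp. Qed.

(** A label records which thresholds of a grid of mesh [r] each function reaches. Two values more
    than [r] apart are separated by a threshold, so points with equal labels have close values;
    points outside the box or outside [g] get no label. *)
Lemma grid_labels (M r : R) : 0 < r ->
  exists (F : finType) (kx : T -> option F),
    [/\ forall k, measurable_fun setT (fun x => kx x == Some k),
        forall x, kx x = g x && [forall i, `|f i x| <= M] :> bool &
        forall k x x' i, kx x == Some k -> kx x' == Some k -> `|f i x - f i x'| <= r].
Proof.
(* The threshold just above the value at [x] has index j + 1, where j is at most the truncation of 2
   M / r; hence the offset 2. *)
move=> r0; pose n := (Num.truncn ((M + M) / r)).+2.
pose lab x : {ffun I * 'I_n -> bool} := [ffun p => - M + (val p.2)%:R * r <= f p.1 x].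
pose kx x := if g x && [forall i, `|f i x| <= M] then Some (lab x) else None.
exists {ffun I * 'I_n -> bool}, kx; split.
- move=> k; rewrite (_ : (fun x => _) = fun x => (g x && [forall i, `|f i x| <= M]) &&
      [forall p, (- M + (val p.2)%:R * r <= f p.1 x) == k p]); last first.
    apply/funext => x; rewrite /kx; case: ifP => //= _; apply/eqP/forallP => [[<-] p|h].
      by rewrite ffunE.
    by congr Some; apply/ffunP => p; rewrite ffunE; apply/eqP; exact: (h p).
  apply: measurable_and.
    by apply: measurable_and => //; exact: measurable_forallb.
  apply: measurable_forallb => p.
  have mp : measurable_fun setT (fun x => - M + (val p.2)%:R * r <= f p.1 x).
    exact: measurable_fun_ler.
  case: (k p); first by under eq_fun do rewrite eqb_id.
  by under eq_fun do rewrite eqbF_neg; exact: measurable_neg.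
- by move=> x; rewrite /kx; case: ifP.
- have key k x x' i : kx x == Some k -> kx x' == Some k -> f i x' - f i x <= r.
    have labE y : kx y == Some k -> `|f i y| <= M /\ lab y = k.
      by rewrite /kx; case: ifP => // /andP[_ /forallP/(_ i) ?] /eqP/Some_inj.
    move=> /labE[Mx xk] /labE[Mx' xk'].
    rewrite leNgt; apply/negP => hlt.
    have Mx0 : 0 <= (f i x + M) / r.
      by move: Mx; rewrite ler_norml => /andP[h _]; rewrite divr_ge0 ?(ltW r0)// -lerBlDr sub0r.
    have /andP[j1 j2] := truncn_itv Mx0.
    move: j1 j2; set j := Num.truncn _ => j1 j2.
    have {}j1 : j%:R * r <= f i x + M by rewrite -ler_pdivlMr.
    have {}j2 : f i x + M < j.+1%:R * r by rewrite -ltr_pdivrMr.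
    have Mx'2 : f i x' <= M by move: Mx'; rewrite ler_norml => /andP[].
    have jn : (j.+1 < n)%N.
      rewrite /n !ltnS.
      rewrite Num.Theory.le_truncn// ler_pM2r ?invr_gt0// lerD2r.
      by move: Mx; rewrite ler_norml => /andP[].
    have e : lab x (i, Ordinal jn) = lab x' (i, Ordinal jn) by rewrite xk xk'.
    move: e; rewrite !ffunE /= => e.
    have : - M + j.+1%:R * r <= f i x'.
      apply: (@le_trans _ _ (f i x + r)); last by lra.
      by rewrite -natr1 mulrDl mul1r addrA lerD2r addrC lerBlDr.
    by rewrite -e => h; move: j2; lra.
  move=> k x x' i xk xk'; rewrite ler_norml lerNl opprB.
  by rewrite (key k x x' i)// (key k x' x i).
Qed.

(** Continuity from above: finitely many real functions are jointly bounded at each point, so the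
    exceptional sets decrease to the empty set. *)
Lemma bounded_tail (P : probability T R) (t : R) : P [set x | ~~ g x] = 0%E -> 0 < t ->
  exists M : R, (P [set x | ~~ (g x && [forall i, (`|f i x| <= M)%R])] <= t%:E)%E.
Proof.
move=> Pg t0.
pose B n x := [forall i, `|f i x| <= n%:R].
have mB n : measurable_fun setT (B n) by exact: measurable_forallb.
have : P \o (fun n => [set x | ~~ B n x]) @ \oo --> P (\bigcap_n [set x | ~~ B n x]).
  apply: nonincreasing_cvg_mu => //=.
  - by rewrite (le_lt_trans (probability_le1 _ _)) ?ltry//; exact: measurable_negb_set.
  - by move=> n; exact: measurable_negb_set.
  - by apply: bigcap_measurable => // n _; exact: measurable_negb_set.
  - move=> m n mn; apply/subsetPset => x /=; apply: contra => /forallP h.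
    by apply/forallP => i; rewrite (le_trans (h i))// ler_nat.
rewrite (_ : \bigcap_n _ = classical_sets.set0); last first.
  apply/seteqP; split => // x /(_ (\max_i Num.bound (`|f i x|))%N Logic.I) /=; case/negP.
  apply/forallP => i; apply: le_trans (ltW (archi_boundP (normr_ge0 _))) _.
  by rewrite ler_nat; exact: (@leq_bigmax _ (fun i => Num.bound (`|f i x|))).
rewrite measure0 => /fine_cvgP[fin /cvgrPdist_le/(_ t t0) near1].
have [n [/= finn hn]] := filter_ex (filterI fin near1).
exists n%:R; apply: le_trans (_ : P [set x | ~~ g x] + P [set x | ~~ B n x] <= _)%E.
  rewrite (_ : [set x | _] = [set x | ~~ g x] `|` [set x | ~~ B n x]); last first.
    by apply/seteqP; split => x /=; rewrite negb_and => /orP.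
  by apply: measureU2; exact: measurable_negb_set.
rewrite Pg add0e -(fineK finn) lee_fin.
by move: hn; rewrite sub0r normrN; apply: le_trans; exact: ler_norm.
Qed.
End grid_labels.

Section borel_rows.
Context {R : realType} {d : nat}.
Local Notation T := 'rV[R]_d.

Lemma continuous_measurable_rV (f : T -> R) : continuous f -> measurable_fun setT f.
Proof.
move=> /continuousP cf mD; apply: (measurability _ (RGenOInfty.measurableE R)) => //.
move=> _ [_ [x ->] <-]; rewrite setTI; apply: sub_sigma_algebra.
apply: cf; exact: rray_open.
Qed.

Lemma compact_box (M : R) : compact [set v : T | forall i, `|v ord0 i| <= M].
Proof.
rewrite (_ : [set v | _] = [set v : T | forall i, `[- M, M]%classic (v ord0 i)]).
  by apply: (@rV_compact R d (fun=> `[- M, M]%classic)) => i; exact: segment_compact.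
by apply/seteqP; split => v /= h i; move: (h i); rewrite /= in_itv /= ler_norml.
Qed.

End borel_rows.

Section schrodinger_cells.
Context {R : realType} {d : nat}.
Local Notation T := 'rV[R]_d.
Variables (P Q : probability T R) (eps : R) (c : T * T -> R) (a b : T -> R).
Hypotheses (eps_gt0 : 0 < eps) (c_cont : continuous c).
Hypotheses (a_meas : measurable_fun setT a) (b_meas : measurable_fun setT b).
Variables (gx gy : T -> bool).
Hypotheses (mgx : measurable_fun setT gx) (mgy : measurable_fun setT gy).
Hypotheses (gx1 : P [set x | ~~ gx x] = 0%E) (gy1 : Q [set y | ~~ gy y] = 0%E).

(** The form of [unit_kernel], for arbitrary full sets [gx] and [gy]. The value 1 elsewhere keeps
    the kernel positive. *)
Definition exact_kernel (z : T * T) : R :=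
  if gx z.1 && gy z.2 then schrodinger_density eps c a b z else 1.

(** The coordinates serve the uniform continuity of [c]; the index [None] adds the potential, which
    is only measurable and has to be cut by its own values. *)
Let row_features (h : T -> R) (i : option 'I_d) (x : T) : R :=
  if i is Some i then x ord0 i else h x.

Let measurable_row_features h i : measurable_fun setT h -> measurable_fun setT (row_features h i).
Proof.
by case: i => [i|] // _; apply: continuous_measurable_rV; exact: coord_continuous.
Qed.

(** On a product of cells each of c, a and b varies by at most eps th / 3: for [c] because the
    coordinates lie in compact boxes and vary by less than the modulus of continuity, for a and b by
    the labels themselves. The exponent then varies by at most [th]. *)
Lemma exact_kernel_cells (th t : R) : 0 < th -> 0 < t ->
  exists (F G : finType) (kx : T -> option F) (ky : T -> option G),
  [/\ forall k, measurable_fun setT (fun x => kx x == Some k),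
      forall l, measurable_fun setT (fun y => ky y == Some l),
      (P [set x | ~~ kx x] <= t%:E)%E, (Q [set y | ~~ ky y] <= t%:E)%E &
      forall k l x x' y y',
        kx x == Some k -> kx x' == Some k -> ky y == Some l -> ky y' == Some l ->
        exact_kernel (x, y) <= expR th * exact_kernel (x', y')].
Proof.
move=> th0 t0.
have ma i : measurable_fun setT (row_features a i) by exact: measurable_row_features.
have mb i : measurable_fun setT (row_features b i) by exact: measurable_row_features.
have [M hM] := bounded_tail ma mgx gx1 t0.
have [M' hM'] := bounded_tail mb mgy gy1 t0.
have e0 : 0 < eps * th / 3 by rewrite divr_gt0// mulr_gt0.
have [r r0 hr] := compact_unif_continuous
  (compact_setX (@compact_box R d M) (@compact_box R d M')) c_cont e0.
have [s [s0 sr se]] : exists s : R, [/\ 0 < s, s < r & s <= eps * th / 3].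
  exists (Num.min (r / 2) (eps * th / 3)); split.
  - by rewrite lt_min e0 divr_gt0.
  - by rewrite gt_min ltr_pdivrMr// ltr_pMr// ltr1n.
  - by rewrite ge_min lexx orbT.
have [F [kx [mkx kxE kxs]]] := grid_labels ma mgx M s0.
have [G [ky [mky kyE kys]]] := grid_labels mb mgy M' s0.
exists F, G, kx, ky; split => //.
- by rewrite (_ : [set x | _] = [set x | ~~ (gx x && [forall i, `|row_features a i x| <= M])])//;
    apply/seteqP; split => x /=; rewrite kxE.
- by rewrite (_ : [set x | _] = [set x | ~~ (gy x && [forall i, `|row_features b i x| <= M'])])//;
    apply/seteqP; split => x /=; rewrite kyE.
move=> k l x x' y y' kx1 kx2 ky1 ky2.
have ux u : kx u == Some k -> gx u /\ forall i, `|row_features a i u| <= M.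
  by move=> /eqP E; have := kxE u; rewrite E /= => /esym/andP[-> /forallP].
have uy u : ky u == Some l -> gy u /\ forall i, `|row_features b i u| <= M'.
  by move=> /eqP E; have := kyE u; rewrite E /= => /esym/andP[-> /forallP].
have [gx1' xM] := ux _ kx1; have [gx2' _] := ux _ kx2.
have [gy1' yM] := uy _ ky1; have [gy2' _] := uy _ ky2.
rewrite /exact_kernel /= gx1' gx2' gy1' gy2' /= /schrodinger_density /= -expRD ler_expR.
have hc : `|c (x, y) - c (x', y')| < eps * th / 3.
  apply: hr.
    by split => i /=; [exact: (xM (Some i))|exact: (yM (Some i))].
  split; split => // i j; rewrite (ord1 i) /ball /=.
    exact: le_lt_trans (kxs _ _ _ (Some j) kx1 kx2) sr.
  exact: le_lt_trans (kys _ _ _ (Some j) ky1 ky2) sr.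
have ha : `|a x - a x'| <= eps * th / 3 := le_trans (kxs _ _ _ None kx1 kx2) se.
have hb : `|b y - b y'| <= eps * th / 3 := le_trans (kys _ _ _ None ky1 ky2) se.
move: hc ha hb; rewrite ltr_norml !ler_norml => /andP[c1 _] /andP[_ a2] /andP[_ b2].
have e_neq0 : eps != 0 by rewrite gt_eqF.
rewrite -subr_ge0 (_ : _ - _ = eps^-1 * (eps * th +
    (c (x, y) - c (x', y')) - (a x - a x') - (b y - b y'))); last by field.
by rewrite mulr_ge0 ?invr_ge0 ?(ltW eps_gt0)//; lra.
Qed.

End schrodinger_cells.

(** * From almost everywhere to exact unit marginals *)

Section unit_density.
Context {R : realType} {d} {T : measurableType d}.
Implicit Types (P Q : probability T R) (F : T -> \bar R).

(** Uniqueness of densities: [P] has density 1 with respect to itself. *)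
Lemma unit_density P F : measurable_fun setT F ->
  (forall A, measurable A -> (P A = \int[P]_(x in A) F x)%E) ->
  P [set x | ~~ (F x == 1%E)] = 0%E.
Proof.
move=> mF hF.
have mN : measurable [set x | ~~ (F x == 1%E)].
  by rewrite -[X in measurable X]setTI; exact: emeasurable_neq.
apply: measure_negligible => //.
have : ae_eq P setT (cst 1%E) F.
  apply: integral_ae_eq => //.
    by apply: finite_measure_integrable_cst.
  by move=> E _ mE; rewrite -hF// integral_cst// mul1e.
case=> B [mB B0 hB]; exists B; split => // x /= Fx.
by apply: hB => /= h; move: Fx; rewrite -(h Logic.I) eqxx.
Qed.

Lemma integral_if_full Q (g : T -> bool) (f : T -> R) : measurable_fun setT g ->
  measurable_fun setT f -> (forall y, 0 <= f y) -> Q [set y | ~~ g y] = 0%E ->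
  (\int[Q]_y (if g y then f y else 1)%:E = \int[Q]_y (f y)%:E)%E.
Proof.
move=> mg mf f0 g1; apply: ge0_ae_eq_integral => //.
- by apply/measurable_EFinP; exact: measurable_fun_ifT.
- exact/measurable_EFinP.
- by move=> y _; case: ifP; rewrite lee_fin.
- by move=> y _; rewrite lee_fin.
- exists [set y | ~~ g y]; split => //; first exact: measurable_negb_set.
  by move=> y /=; apply: contra_notN => ->.
Qed.

End unit_density.

Section coupling_density.
Context {R : realType} {d} {T : measurableType d} (P Q : probability T R).
Variables (mu : probability (T * T)%type R) (xi : T * T -> R).
Hypotheses (mxi : measurable_fun setT xi) (xi0 : forall z, 0 <= xi z).
Hypothesis mu_density : forall A, measurable A ->
  (mu A = \int[(P \x Q)%E]_(z in A) (xi z)%:E)%E.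
Hypothesis mu_coupling : coupling P Q mu.

Definition unit_row (x : T) : bool := (\int[Q]_y (xi (x, y))%:E == 1)%E.
Definition unit_col (y : T) : bool := (\int[P]_x (xi (x, y))%:E == 1)%E.

Let mrow : measurable_fun setT (fun x => (\int[Q]_y (xi (x, y))%:E)%E).
Proof.
apply: (measurable_fun_fubini_tonelli_F (fun z : T * T => (xi z)%:E)) => //.
by apply/measurable_EFinP.
Qed.

Let mcol : measurable_fun setT (fun y => (\int[P]_x (xi (x, y))%:E)%E).
Proof.
apply: (measurable_fun_fubini_tonelli_G (fun z : T * T => (xi z)%:E)) => //.
by apply/measurable_EFinP.
Qed.

Lemma measurable_unit_row : measurable_fun setT unit_row.
Proof. exact: measurable_fun_eqe. Qed.

Lemma measurable_unit_col : measurable_fun setT unit_col.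
Proof. exact: measurable_fun_eqe. Qed.

Let mmem (A : set T) : measurable A -> measurable_fun setT (fun x => x \in A).
Proof.
move=> mA; apply: (measurable_fun_bool true); rewrite setTI.
by rewrite (_ : _ @^-1` _ = A)//; apply/seteqP; split => x; [exact: set_mem|exact: mem_set].
Qed.

(** By Tonelli, the first marginal of [mu] has the row integral of [xi] as density with respect to
    [P]; this marginal is [P]. *)
Lemma unit_row_full : P [set x | ~~ unit_row x] = 0%E.
Proof.
apply: unit_density => // A mA.
have mA1 : measurable (@fst T T @^-1` A).
  by rewrite -[X in measurable X]setTI; exact: measurable_fst.
rewrite -(mu_coupling.1 A mA) mu_density// integral_mkcond [RHS]integral_mkcond.
transitivity (\int[(P \x Q)%E]_z (if z.1 \in A then xi z else 0)%:E)%E.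
  apply: eq_integral => z _; rewrite patchE.
  have -> : (z \in fst @^-1` A) = (z.1 \in A) by [];
  by case: ifP.
rewrite fubini_tonelli1//.
- apply: eq_integral => x _; rewrite /fubini_F patchE /=; case: ifP => // _.
  by rewrite integral0.
- apply/measurable_EFinP; apply: measurable_fun_ifT => //.
  exact: (measurableT_comp (mmem mA)).
- by move=> z; rewrite lee_fin; case: ifP.
Qed.

Lemma unit_col_full : Q [set y | ~~ unit_col y] = 0%E.
Proof.
apply: unit_density => // A mA.
have mA1 : measurable (@snd T T @^-1` A).
  by rewrite -[X in measurable X]setTI; exact: measurable_snd.
rewrite -(mu_coupling.2 A mA) mu_density// integral_mkcond [RHS]integral_mkcond.
transitivity (\int[(P \x Q)%E]_z (if z.2 \in A then xi z else 0)%:E)%E.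
  apply: eq_integral => z _; rewrite patchE.
  have -> : (z \in snd @^-1` A) = (z.2 \in A) by [];
  by case: ifP.
rewrite fubini_tonelli2//.
- apply: eq_integral => y _; rewrite /fubini_G patchE /=; case: ifP => // _.
  by rewrite integral0.
- apply/measurable_EFinP; apply: measurable_fun_ifT => //.
  exact: (measurableT_comp (mmem mA)).
- by move=> z; rewrite lee_fin; case: ifP.
Qed.

(* xi has unit marginal integrals only almost everywhere; the reset makes them exact. *)
Definition unit_kernel (z : T * T) : R := if unit_row z.1 && unit_col z.2 then xi z else 1.

Lemma measurable_unit_kernel : measurable_fun setT unit_kernel.
Proof.
apply: measurable_fun_ifT => //.
apply: measurable_rect; [exact: measurable_unit_row|exact: measurable_unit_col].
Qed.

(** In a unit row the values reset to 1 lie over a Q-null set of columns; any other row is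
    constantly 1. *)
Lemma unit_kernel_row x : (\int[Q]_y (unit_kernel (x, y))%:E = 1)%E.
Proof.
rewrite /unit_kernel /=; case: (boolP (unit_row x)) => [/eqP <-|_] /=.
  apply: (@integral_if_full _ _ _ Q unit_col (fun y => xi (x, y))) => //.
  - exact: measurable_unit_col.
  - exact: measurable_kernel_row.
  - exact: unit_col_full.
exact: integral_cst_probability.
Qed.

Lemma unit_kernel_col y : (\int[P]_x (unit_kernel (x, y))%:E = 1)%E.
Proof.
rewrite /unit_kernel /=; case: (boolP (unit_col y)) => [/eqP <-|_] /=; last first.
  by under eq_integral do rewrite andbF; exact: integral_cst_probability.
under eq_integral do rewrite andbT.
apply: (@integral_if_full _ _ _ P unit_row (fun x => xi (x, y))) => //.
- exact: measurable_unit_row.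
- exact: measurable_kernel_col.
- exact: unit_row_full.
Qed.

Lemma unit_kernel_square : (\int[(P \x Q)%E]_z (xi z ^+ 2)%:E < +oo)%E ->
  (\int[(P \x Q)%E]_z (unit_kernel z ^+ 2)%:E < +oo)%E.
Proof.
move=> xi2; have mx2 : measurable_fun setT (fun z => xi z ^+ 2) by exact: measurable_funX.
apply: (@le_lt_trans _ _ (\int[(P \x Q)%E]_z (xi z ^+ 2 + 1)%:E)%E).
  apply: ge0_le_integral_fin.
  - by apply: measurable_funX; exact: measurable_unit_kernel.
  - exact: measurable_funD.
  - by move=> z; rewrite sqr_ge0.
  - move=> z; rewrite /unit_kernel; case: ifP => _; first by rewrite lerDl.
    by rewrite expr1n lerDr sqr_ge0.
rewrite ge0_integral_addr//; last by move=> z; rewrite sqr_ge0.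
by rewrite lte_add_pinfty// integral_cst_probability ltry.
Qed.

Context {dO} {Om : measurableType dO} (Pr : probability Om R).
Variable (Z : Om -> config T (nat + nat)%type).
Hypothesis indepZ : independent_family Pr Z (two_sample_law P Q).

Lemma coordinate_law v (A : set T) : measurable A ->
  (Pr [set w | A (Z w v)] = two_sample_law P Q v A)%E.
Proof.
move=> mA; have := indepZ.2 [:: v] (fun=> A) isT (fun=> mA).
rewrite big_seq1 => <-; congr (Pr _); apply/seteqP; split => w /=.
  by move=> h j; rewrite inE => /eqP ->.
by apply; rewrite inE.
Qed.

(** Outside a countable union of null events, every draw from [P] is a unit row and every draw from
    [Q] a unit column, and then the two averages coincide. *)
Lemma perm_average_unit_kernel_ae (N : nat) (r : R) :
  (Pr [set w | (perm_average xi N (Z w \o inl) (Z w \o inr) <= r)%R] <=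
   Pr [set w | (perm_average unit_kernel N (Z w \o inl) (Z w \o inr) <= r)%R])%E.
Proof.
pose bad (v : nat + nat) := [set w | (match v with inl _ => ~~ unit_row (Z w v)
  | inr _ => ~~ unit_col (Z w v) end)].
have bad0 v : Pr.-negligible (bad v).
  have mr := measurable_negb_set measurable_unit_row.
  have mc := measurable_negb_set measurable_unit_col.
  have mZ := indepZ.1 v.
  case: v mZ => i mZ.
    apply/negligibleP; last first.
      by rewrite -[RHS]unit_row_full; exact: (coordinate_law (inl i) mr).
    by have := mZ measurableT _ mr; rewrite setTI.
  apply/negligibleP; last first.
      by rewrite -[RHS]unit_col_full; exact: (coordinate_law (inr i) mc).
  by have := mZ measurableT _ mc; rewrite setTI.
have [B [mB B0 hB]] : Pr.-negligible (\bigcup_n (bad (inl n) `|` bad (inr n))).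
  by apply: negligible_bigcup => n; exact: negligibleU.
have mu0 := measurable_perm_average_le N r indepZ measurable_unit_kernel.
apply: (@le_trans _ _ (Pr ([set w | perm_average unit_kernel N (Z w \o inl) (Z w \o inr) <= r]
   `|` B))); last first.
  by apply: le_trans (measureU2 _ _ _) _ => //; rewrite [X in (_ + X)%E](_ : _ = 0%E) ?adde0.
apply: le_measure; rewrite ?inE.
- exact: (measurable_perm_average_le _ _ indepZ).
- exact: measurableU.
move=> w /= hw; have [wB|wB] := pselect (B w); [by right|left].
suff -> : perm_average unit_kernel N (Z w \o inl) (Z w \o inr) =
  perm_average xi N (Z w \o inl) (Z w \o inr) by [].
have gr n : unit_row (Z w (inl n)).
  by apply/negPn/negP => h; apply: wB; apply: hB; exists n => //; left.
have gc n : unit_col (Z w (inr n)).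
  by apply/negPn/negP => h; apply: wB; apply: hB; exists n => //; right.
rewrite /perm_average; congr (_ * _); apply: eq_bigr => s _; apply: eq_bigr => i _.
by rewrite /unit_kernel /= gr gc.
Qed.

End coupling_density.

Section schrodinger_lower_tail.
Context {R : realType} {d : nat}.
Local Notation T := 'rV[R]_d.
Variables (P Q : probability T R) (eps : R) (c : T * T -> R) (a b : T -> R).
Hypotheses (eps_gt0 : 0 < eps) (c_cont : continuous c).
Hypotheses (a_meas : measurable_fun setT a) (b_meas : measurable_fun setT b).
Variable mu : probability (T * T)%type R.
Local Notation xi := (schrodinger_density eps c a b).
Hypothesis mxi : measurable_fun setT xi.
Hypothesis mu_density : forall A, measurable A ->
  (mu A = \int[(P \x Q)%E]_(z in A) (xi z)%:E)%E.
Hypothesis mu_coupling : coupling P Q mu.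
Hypothesis xi2 : (\int[(P \x Q)%E]_z (xi z ^+ 2)%:E < +oo)%E.
Context {dO} {Om : measurableType dO} (Pr : probability Om R).
Variable (Z : Om -> config T (nat + nat)%type).
Hypothesis indepZ : independent_family Pr Z (two_sample_law P Q).

Lemma schrodinger_lower_tail (del rho : R) : 0 < del -> 0 < rho ->
  exists N0, forall N, (N0 <= N)%N ->
    (Pr [set w | (perm_average xi N (Z w \o inl) (Z w \o inr) <=
                  expR (- (del * N%:R)))%R] <= rho%:E)%E.
Proof.
move=> del0 rho0; have xi_gt0 z : 0 < xi z by exact: expR_gt0.
have xi0 z : 0 <= xi z by exact: ltW.
have mr := measurable_unit_row Q mxi xi0; have mc := measurable_unit_col P mxi xi0.
have fr := unit_row_full mxi xi0 mu_density mu_coupling.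
have fc := unit_col_full mxi xi0 mu_density mu_coupling.
have [||||||N0 hN0] := @regular_lower_tail _ _ _ _ _ Pr P Q Z indepZ
  (unit_kernel P Q xi) _ _ _ _ _ _ del rho del0 rho0.
- exact: measurable_unit_kernel.
- by move=> z; rewrite /unit_kernel; case: ifP.
- by move=> y; exact: (unit_kernel_col mxi xi0 mu_density mu_coupling).
- by move=> x; exact: (unit_kernel_row mxi xi0 mu_density mu_coupling).
- exact: (unit_kernel_square mxi xi0 xi2).
- exact: (exact_kernel_cells eps_gt0 c_cont a_meas b_meas mr mc fr fc).
exists N0 => N /hN0; apply: le_trans.
exact: (perm_average_unit_kernel_ae mxi xi0 mu_density mu_coupling indepZ).
Qed.

End schrodinger_lower_tail.

(** * Integrability of the potentials *)

Section density.
Local Open Scope charge_scope.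
Context {R : realType} {d} {T : measurableType d} (nu pi : probability T R) (xi : T -> R).
Hypotheses (mxi : measurable_fun setT xi) (xi0 : forall z, 0 <= xi z).
Hypothesis dens : forall A, measurable A -> (nu A = \int[pi]_(z in A) (xi z)%:E)%E.

Lemma density_dominates : nu `<< pi.
Proof.
apply/null_content_dominatesP => A mA A0; rewrite dens//.
have : (\int[pi]_(z in A) (xi z)%:E <= 0)%E; last first.
  by move=> h; apply/eqP; rewrite eq_le h; apply: integral_ge0 => z _; rewrite lee_fin.
rewrite (_ : \int[pi]_(z in A) _ = 0)%E//.
apply: null_set_integral => //; apply/measurable_EFinP; exact: measurable_funTS.
Qed.

Let xi_integral : (\int[pi]_z (xi z)%:E = 1)%E.
Proof. by rewrite -dens//; exact: probability_setT. Qed.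

Lemma density_ae_eq : ae_eq pi setT (fun z => (xi z)%:E)
  ('d (charge_of_finite_measure nu) '/d pi).
Proof.
apply: integral_ae_eq => //.
- apply/integrableP; split; first exact/measurable_EFinP.
  under eq_integral do rewrite /= ger0_norm//.
  by rewrite xi_integral ltry.
- by apply: measurable_int; apply: Radon_Nikodym_integrable; exact: density_dominates.
- by move=> E _ mE; rewrite -Radon_Nikodym_integral//; [rewrite -dens|exact: density_dominates].
Qed.

Lemma ge0_integral_density (f : T -> R) : measurable_fun setT f -> (forall z, 0 <= f z) ->
  (\int[nu]_z (f z)%:E = \int[pi]_z (f z * xi z)%:E)%E.
Proof.
move=> mf f0.
have f0' z : (0 <= (f z)%:E)%E by rewrite lee_fin.
have mf' : measurable_fun setT (fun z => (f z)%:E) by exact/measurable_EFinP.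
rewrite -(@Radon_Nikodym_SigmaFinite.change_of_variables _ _ _ nu pi
  density_dominates (fun z => (f z)%:E) setT f0' measurableT mf').
apply: ae_eq_integral => //.
- apply: emeasurable_funM; first exact/measurable_EFinP.
  by apply: measurable_int; apply: Radon_Nikodym_SigmaFinite.f_integrable; exact: density_dominates.
- by apply/measurable_EFinP; exact: measurable_funM.
have := ae_eq_Radon_Nikodym_SigmaFinite density_dominates measurableT.
have := density_ae_eq.
apply: filterS2 => z h1 h2 _; rewrite EFinM h1// -h2//.
Qed.

Lemma KL_density : (forall z, 0 < xi z) -> (KL nu pi = \int[nu]_z (ln (xi z))%:E)%E.
Proof.
move=> xi_gt0; rewrite /KL asboolT; last exact: density_dominates.
have mRN : measurable_fun setT ('d (charge_of_finite_measure nu) '/d pi).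
  by apply: measurable_int; apply: Radon_Nikodym_integrable; exact: density_dominates.
apply: ae_eq_integral => //.
- apply/measurable_EFinP; apply: measurableT_comp; first exact: measurable_ln.
  exact: measurableT_comp.
- by apply/measurable_EFinP; apply: measurableT_comp => //; exact: measurable_ln.
have := null_dominates_ae_eq measurableT density_dominates density_ae_eq.
by apply: filterS => z h _; rewrite -h.
Qed.

(** From ln x <= x - 1 and - ln x <= 1/x - 1 one gets |ln x| x <= x^2 + 1, to be integrated against
    the product measure. *)
Lemma ln_density_integrable : (forall z, 0 < xi z) -> (\int[pi]_z (xi z ^+ 2)%:E < +oo)%E ->
  nu.-integrable setT (EFin \o (fun z => ln (xi z))).
Proof.
move=> xi_gt0 xi2.
have mln : measurable_fun setT (fun z => ln (xi z)).
  by apply: measurableT_comp => //; exact: measurable_ln.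
apply/integrableP; split; first exact/measurable_EFinP.
rewrite (ge0_integral_density (f := fun z => `|ln (xi z)|))//; last exact: measurableT_comp.
apply: (@le_lt_trans _ _ (\int[pi]_z (xi z ^+ 2 + 1)%:E)%E).
  apply: ge0_le_integral_fin.
  - by apply: measurable_funM => //; exact: measurableT_comp.
  - by apply: measurable_funD => //; exact: measurable_funX.
  - by move=> z; rewrite mulr_ge0.
  - move=> z; have x0 := xi_gt0 z; rewrite -(gtr0_norm x0) -normrM ler_norml gtr0_norm//.
    have h1 : ln (xi z) <= xi z - 1.
      by rewrite -[X in ln X](subrK 1) addrC le_ln1Dx// ltrBDr addrC subrr.
    have h2 : - ln (xi z) <= (xi z)^-1 - 1.
      rewrite -lnV ?posrE// -[X in ln X](subrK 1) addrC le_ln1Dx// ltrBDr addrC subrr.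
      by rewrite invr_gt0.
    have h3 : - ln (xi z) * xi z <= 1 - xi z.
      have -> : 1 - xi z = ((xi z)^-1 - 1) * xi z by field; rewrite gt_eqF.
      by rewrite ler_pM2r.
    have h4 : ln (xi z) * xi z <= (xi z - 1) * xi z by rewrite ler_pM2r.
    apply/andP; split; nra.
rewrite ge0_integral_addr//; [|exact: measurable_funX|by move=> z; rewrite sqr_ge0].
by rewrite lte_add_pinfty// integral_cst_probability ltry.
Qed.

End density.

Lemma ge0_integral_same_law {R : realType} {d d'} {S : measurableType d} {T : measurableType d'}
    (nu : probability S R) (P : probability T R) (phi : S -> T) (f : T -> R) :
  measurable_fun setT phi -> (forall A, measurable A -> nu (phi @^-1` A) = P A) ->
  measurable_fun setT f -> (forall x, 0 <= f x) ->
  (\int[nu]_z (f (phi z))%:E = \int[P]_x (f x)%:E)%E.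
Proof.
move=> mphi law mf f0.
rewrite -(@eq_measure_integral _ _ _ setT P (pushforward nu phi)); last first.
  by move=> A mA _; exact: law.
rewrite ge0_integral_pushforward//.
- exact/measurable_EFinP.
- by move=> y _; rewrite lee_fin.
Qed.

Section truncation.
Context {R : realType}.

(** The cut at [n] keeps all integrals finite until [n] tends to infinity. Being 1-Lipschitz, the
    function lets |f - g| control the difference of two excesses, and it vanishes below [t]. *)
Definition truncated_excess (t : R) (n : nat) (r : R) : R := Num.min (Num.max (r - t) 0) n%:R.

Lemma truncated_excess_itv t n r : 0 <= truncated_excess t n r <= n%:R.
Proof. by rewrite /truncated_excess le_min le_max lexx orbT ler0n ge_min lexx orbT. Qed.

Lemma truncated_excess_gt0 t n r : 0 <= t -> 0 < truncated_excess t n r -> t < `|r|.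
Proof.
move=> t0; rewrite /truncated_excess lt_min lt_max ltxx orbF subr_gt0 => /andP[tr _].
by rewrite (lt_le_trans tr)// ler_norm.
Qed.

Lemma truncated_excess_lip t n r s :
  `|truncated_excess t n r - truncated_excess t n s| <= `|r - s|.
Proof.
have lip x y : x <= y ->
    truncated_excess t n x <= truncated_excess t n y <= truncated_excess t n x + (y - x).
  move=> xy; have d0 : 0 <= y - x by rewrite subr_ge0.
  rewrite /truncated_excess; apply/andP; split.
    by rewrite le_min ge_min ge_max le_max lerD2r xy le_max lexx orbT/= ge_min lexx orbT.
  rewrite addr_minl addr_maxl add0r le_min !ge_min lerDl d0 orbT andbT.
  apply/orP; left; rewrite ge_max !le_max d0 orbT andbT.
  by rewrite (_ : x - t + (y - x) = y - t) ?lexx//; ring.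
have [rs|/ltW sr] := leP r s.
  have /andP[h1 h2] := lip _ _ rs.
  by rewrite distrC (distrC r) !ger0_norm ?subr_ge0// lerBlDl.
have /andP[h1 h2] := lip _ _ sr.
by rewrite !ger0_norm ?subr_ge0// lerBlDl.
Qed.

End truncation.

Section potentials_integrable.
Context {R : realType} {d} {T : measurableType d} (P Q : probability T R).
Variables (nu : probability (T * T)%type R) (xi : T * T -> R).
Hypotheses (mxi : measurable_fun setT xi) (xi0 : forall z, 0 <= xi z).
Local Notation pi := (P \x Q)%E.
Hypothesis dens : forall A, measurable A -> (nu A = \int[pi]_(z in A) (xi z)%:E)%E.
Hypothesis nu_coupling : coupling P Q nu.
Hypothesis xi2 : (\int[pi]_z (xi z ^+ 2)%:E < +oo)%E.

Lemma ge0_integral_coupling_fst (f : T -> R) : measurable_fun setT f -> (forall x, 0 <= f x) ->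
  (\int[nu]_z (f z.1)%:E = \int[P]_x (f x)%:E)%E.
Proof. exact: (ge0_integral_same_law measurable_fst nu_coupling.1). Qed.

Lemma ge0_integral_coupling_snd (f : T -> R) : measurable_fun setT f -> (forall x, 0 <= f x) ->
  (\int[nu]_z (f z.2)%:E = \int[Q]_y (f y)%:E)%E.
Proof. exact: (ge0_integral_same_law measurable_snd nu_coupling.2). Qed.

Lemma ge0_integral_tensor (f g : T -> R) (p q : R) :
  measurable_fun setT f -> measurable_fun setT g -> (forall x, 0 <= f x) -> (forall y, 0 <= g y) ->
  (\int[P]_x (f x)%:E = p%:E)%E -> (\int[Q]_y (g y)%:E = q%:E)%E ->
  (\int[pi]_z (f z.1 * g z.2)%:E = (p * q)%:E)%E.
Proof.
move=> mf mg f0 g0 fp gq.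
rewrite fubini_tonelli1//; last 2 first.
- apply/measurable_EFinP; apply: measurable_funM; exact: measurableT_comp.
- by move=> z; rewrite lee_fin mulr_ge0.
have q0 : 0 <= q by rewrite -lee_fin -gq; apply: integral_ge0 => y _; rewrite lee_fin.
transitivity (\int[P]_x (q * f x)%:E)%E.
  apply: eq_integral => x _; rewrite /fubini_F /=.
  by rewrite ge0_integral_scaler// gq -EFinM mulrC.
rewrite ge0_integral_scaler//; by rewrite fp -EFinM mulrC.
Qed.

(** The set where |f| exceeds [t] has small P-mass for large [t], and [outside_rect_le], with all of
    the second factor as [L], converts this into a small integral of the square of [xi]. *)
Lemma small_tail (f : T -> R) (e : R) : measurable_fun setT f -> 0 < e ->
  exists t : R, 0 <= t /\
    (\int[pi]_z (if (`|f z.1| <= t)%R then 0 else xi z ^+ 2)%:E <= e%:E)%E.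
Proof.
move=> mf e0; have e2 : 0 < e / 2 by rewrite divr_gt0.
have mx2 : measurable_fun setT (fun z => xi z ^+ 2) by exact: measurable_funX.
have [M [M0 hM]] := integral_large_values mx2 (fun z => sqr_ge0 (xi z)) xi2 e2.
have M0' : 1 <= M%:R :> R by rewrite (ler_nat _ 1).
have [s [s0 hs]] : exists s : R, 0 < s /\ M%:R * (s + s) <= e / 2.
  exists (e / 2 / (M%:R * 2)); split; first by rewrite !divr_gt0// mulr_gt0// (lt_le_trans _ M0').
  by rewrite [leLHS](_ : _ = e / 2)//; field; rewrite gt_eqF// (lt_le_trans _ M0').
have mtt (S : measurableType d) : measurable_fun [set: S] (fun=> true) by [].
have P0 : P [set x | ~~ true] = 0%E.
  by rewrite (_ : [set x | _] = classical_sets.set0) ?measure0//; apply/seteqP; split.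
have Q0 : (Q [set x | ~~ true] <= s%:E)%E.
  rewrite (_ : [set x | _] = classical_sets.set0) ?measure0 ?lee_fin ?ltW//.
  by apply/seteqP; split.
have [t ht] := @bounded_tail _ _ _ unit (fun=> f) (fun=> true) (fun=> mf) (mtt _) P s P0 s0.
have allE x : [forall i : unit, `|f x| <= Num.max t 0] = (`|f x| <= Num.max t 0).
  by apply/forallP/idP => [/(_ tt)|h _].
have mK : measurable_fun setT (fun x => `|f x| <= Num.max t 0).
  by apply: measurable_fun_ler => //; exact: measurableT_comp.
have ht' : (P [set x | ~~ (`|f x| <= Num.max t 0)%R] <= s%:E)%E.
  apply: le_trans ht; apply: le_measure; rewrite ?inE.
  - exact: measurable_negb_set.
  - apply: measurable_negb_set; apply: measurable_and => //; apply: measurable_forallb => _.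
    by apply: measurable_fun_ler => //; exact: measurableT_comp.
  - move=> x /=; apply: contra => /forallP/(_ tt) h.
    by rewrite le_max h.
exists (Num.max t 0); split; first by rewrite le_max lexx orbT.
have ML0 : 0 <= M%:R :> R by [].
have := outside_rect_le mK (mtt _) mx2 (fun z => sqr_ge0 (xi z)) ML0 ht' Q0 hM.
under eq_integral do rewrite andbT.
by move=> h; apply: le_trans h _; rewrite lee_fin; lra.
Qed.

(* Let F, G be the truncated excesses of f, g and m = E F + E G. Then
   F + G = |F - G| + 2 min(F, G), and 2 min(F, G) xi <= m xi^2 + F G / m where
   F > 0; the two terms integrate to at most m / 4 each, so m <= D + m / 2. *)
Lemma positive_parts_bounded (f g : T -> R) (D : R) :
  measurable_fun setT f -> measurable_fun setT g ->
  (\int[nu]_z `|f z.1 - g z.2|%:E <= D%:E)%E ->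
  exists t : R, 0 <= t /\ forall n,
    (\int[P]_x (truncated_excess t n (f x))%:E + \int[Q]_y (truncated_excess t n (g y))%:E
      <= (2 * D)%:E)%E.
Proof.
move=> mf mg hD.
have [t [t0 ht]] := @small_tail f 4^-1 mf ltac:(by rewrite invr_gt0).
exists t; split => // n.
pose F x := truncated_excess t n (f x); pose G y := truncated_excess t n (g y).
have mte (h : T -> R) : measurable_fun setT h ->
    measurable_fun setT (fun x => truncated_excess t n (h x)).
  move=> mh; apply: measurable_minr => //; apply: measurable_maxr => //; exact: measurable_funB.
have mF := mte _ mf; have mG := mte _ mg; rewrite -/F -/G in mF mG.
have F0 x : 0 <= F x by have /andP[] := truncated_excess_itv t n (f x).
have G0 y : 0 <= G y by have /andP[] := truncated_excess_itv t n (g y).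
have fin (S : probability T R) (h : T -> R) : measurable_fun setT h ->
    exists p : R, 0 <= p /\ (\int[S]_x (truncated_excess t n (h x))%:E = p%:E)%E.
  move=> mh.
  have I0 : (0 <= \int[S]_x (truncated_excess t n (h x))%:E)%E.
    by apply: integral_ge0 => x _; rewrite lee_fin; case/andP: (truncated_excess_itv t n (h x)).
  have Ioo : (\int[S]_x (truncated_excess t n (h x))%:E < +oo)%E.
    apply: (@le_lt_trans _ _ (\int[S]_x n%:R%:E)%E); last by rewrite integral_cst_probability ltry.
    by apply: ge0_le_integral_fin => //; [exact: mte|move=> x|move=> x];
      case/andP: (truncated_excess_itv t n (h x)).
  exists (fine (\int[S]_x (truncated_excess t n (h x))%:E)); split; first exact: fine_ge0.
  by rewrite fineK// ge0_fin_numE.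
have [p [p0 pE]] := fin P f mf; have [q [q0 qE]] := fin Q g mg.
rewrite pE qE -EFinD lee_fin.
have {}pE : (\int[P]_x (F x)%:E = p%:E)%E by exact: pE.
have {}qE : (\int[Q]_y (G y)%:E = q%:E)%E by exact: qE.
(* The sum p + q is about to become a divisor; when it vanishes the claim only says that [D] is
   nonnegative. *)
have [m0|m0] := leP (p + q) 0.
  apply: le_trans m0 _; rewrite mulr_ge0//.
  by rewrite -lee_fin; apply: le_trans hD; apply: integral_ge0 => z _; rewrite lee_fin.
have [m mE] : exists m, m = p + q by exists (p + q).
rewrite -mE in m0 *.
pose S2 z := if `|f z.1| <= t then 0 else xi z ^+ 2.
have S20 z : 0 <= S2 z by rewrite /S2; case: ifP; rewrite ?sqr_ge0.
have mabs : measurable_fun setT (fun z : T * T => `|f z.1 - g z.2|).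
  by apply: measurableT_comp => //; apply: measurable_funB; exact: measurableT_comp.
have mS2 : measurable_fun setT S2.
  apply: measurable_fun_ifT => //; last exact: measurable_funX.
  apply: measurable_fun_ler => //; do 2 (apply: measurableT_comp => //).
have mF1 : measurable_fun setT (fun z : T * T => F z.1) by exact: measurableT_comp.
have mG2 : measurable_fun setT (fun z : T * T => G z.2) by exact: measurableT_comp.
have key z : (F z.1 + G z.2) * xi z <=
    `|f z.1 - g z.2| * xi z + (m * S2 z + m^-1 * (F z.1 * G z.2)).
  have Flip : `|F z.1 - G z.2| <= `|f z.1 - g z.2| by exact: truncated_excess_lip.
  have xz := xi0 z; have := S20 z; rewrite /S2; case: ifPn => [ft|_] S2z.
    have F00 : F z.1 = 0.
      apply/eqP; rewrite eq_le F0 andbT leNgt; apply/negP => /(truncated_excess_gt0 t0).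
      by rewrite ltNge ft.
    rewrite F00 mulr0 add0r mul0r mulr0 !addr0 ler_wpM2r//.
    by apply: le_trans Flip; rewrite F00 sub0r normrN ler_norm.
  (* The inequality 2 a0 xi <= m xi^2 + a0^2 / m, followed by a0^2 <= a0 b0, as [a0] is the smaller
     of the two excesses. *)
  have aux a0 b0 : 0 <= a0 -> a0 <= b0 -> 2 * (a0 * xi z) <= m * xi z ^+ 2 + m^-1 * (a0 * b0).
    move=> a00 ab; have h1 : m^-1 * a0 ^+ 2 <= m^-1 * (a0 * b0).
      by rewrite ler_pM2l ?invr_gt0// expr2 ler_wpM2l.
    have h2 : 0 <= m^-1 * (m * xi z - a0) ^+ 2 by rewrite mulr_ge0 ?sqr_ge0// invr_ge0 ltW.
    have h3 : m^-1 * (m * xi z - a0) ^+ 2 = m * xi z ^+ 2 - 2 * (a0 * xi z) + m^-1 * a0 ^+ 2.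
      by field; rewrite gt_eqF.
    lra.
  have h : F z.1 + G z.2 <= `|f z.1 - g z.2| + 2 * Num.min (F z.1) (G z.2).
    by move: Flip; case: (leP (F z.1) (G z.2)) => FG; rewrite ler_norml => /andP[]; lra.
  apply: le_trans (ler_wpM2r xz h) _; rewrite mulrDl lerD2l -mulrA.
  case: (leP (F z.1) (G z.2)) => FG; first exact: aux.
  by rewrite [F _ * G _]mulrC; apply: aux => //; exact: ltW.
clearbody F G.
have step : (m%:E <= D%:E + ((m * 4^-1)%:E + (m^-1 * (p * q))%:E))%E.
  rewrite {1}mE EFinD -pE -qE -ge0_integral_coupling_fst// -ge0_integral_coupling_snd//.
  rewrite -ge0_integral_addr//.
  rewrite (ge0_integral_density mxi xi0 dens (f := fun z => F z.1 + G z.2))//; last 2 first.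
  - exact: measurable_funD.
  - by move=> z; rewrite addr_ge0.
  apply: (@le_trans _ _ (\int[pi]_z (`|f z.1 - g z.2| * xi z +
      (m * S2 z + m^-1 * (F z.1 * G z.2)))%:E)%E).
    apply: ge0_le_integral_fin => //.
    - by apply: measurable_funM => //; exact: measurable_funD.
    - by do ![apply: measurable_funD => //|apply: measurable_funM => //].
    - by move=> z; rewrite mulr_ge0 ?addr_ge0.
  have mV : 0 <= m^-1 by rewrite invr_ge0 ltW.
  have m0' := ltW m0.
  have mFG := measurable_funM mF1 mG2.
  have FG0 z : 0 <= F z.1 * G z.2 by rewrite mulr_ge0.
  have m1 : measurable_fun setT (fun z => m * S2 z) by exact: measurable_funM.
  have m2 : measurable_fun setT (fun z => m^-1 * (F z.1 * G z.2)) by exact: measurable_funM.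
  have n1 z : 0 <= m * S2 z by rewrite mulr_ge0.
  have n2 z : 0 <= m^-1 * (F z.1 * G z.2) by rewrite mulr_ge0.
  rewrite ge0_integral_addr//; last 4 first.
  - exact: measurable_funM.
  - exact: measurable_funD.
  - by move=> z; rewrite mulr_ge0.
  - by move=> z; rewrite addr_ge0.
  apply: leeD; first by rewrite -(ge0_integral_density mxi xi0 dens).
  rewrite ge0_integral_addr//; apply: leeD.
    by rewrite ge0_integral_scaler// EFinM lee_wpmul2l.
  rewrite ge0_integral_scaler//; by rewrite (ge0_integral_tensor mF mG F0 G0 pE qE) -EFinM.
have pq : m^-1 * (p * q) <= m / 4.
  rewrite mulrC ler_pdivrMr// mE.
  by have := sqr_ge0 (p - q); nra.
by move: step; rewrite -!EFinD lee_fin; lra.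
Qed.

End potentials_integrable.

(** Monotone convergence in [n] bounds the integral of the excess over [t], and the positive part
    exceeds that excess by at most [t]. *)
Lemma ge0_integral_positive_part_fin {R : realType} {d} {T : measurableType d}
    (S : probability T R) (h : T -> R) (t C : R) :
  measurable_fun setT h -> 0 <= t ->
  (forall n, \int[S]_x (truncated_excess t n (h x))%:E <= C%:E)%E ->
  (\int[S]_x (Num.max (h x) 0)%:E < +oo)%E.
Proof.
move=> mh t0 hC.
have mmax (u : R) : measurable_fun setT (fun x => Num.max (h x - u) 0).
  by apply: measurable_maxr => //; exact: measurable_funB.
have hlim : (\int[S]_x (Num.max (h x - t) 0)%:E <= C%:E)%E.
  have cv x : (truncated_excess t n (h x))%:E @[n --> \oo] --> (Num.max (h x - t) 0)%:E.
    apply: cvg_near_cst; near=> n; congr (_%:E); rewrite /truncated_excess min_l//.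
    near: n; exists (Num.bound (Num.max (h x - t) 0)) => // n /= hn.
    rewrite (le_trans (ltW (archi_boundP _)))// ?ler_nat//.
    by rewrite le_max lexx orbT.
  have -> : (\int[S]_x (Num.max (h x - t) 0)%:E =
      \int[S]_x (limn (fun n => (truncated_excess t n (h x))%:E)))%E.
    by apply: eq_integral => x _; apply/esym/cvg_lim.
  have cvI : (\int[S]_x (truncated_excess t n (h x))%:E)%E @[n --> \oo] -->
      (\int[S]_x (limn (fun n => (truncated_excess t n (h x))%:E)))%E.
    apply: cvg_monotone_convergence => //.
    - move=> n; apply/measurable_EFinP; exact: measurable_minr.
    - by move=> n x _; rewrite lee_fin; case/andP: (truncated_excess_itv t n (h x)).
    - move=> x _ m n mn; rewrite lee_fin /truncated_excess le_min ge_min lexx/= ge_min.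
      by rewrite ler_nat mn orbT.
  by apply: (cvge_to_le cvI); apply: nearW => n.
apply: (@le_lt_trans _ _ (\int[S]_x (Num.max (h x - t) 0 + t)%:E)%E).
  apply: ge0_le_integral_fin.
  - by have := mmax 0; under eq_fun do rewrite subr0.
  - exact: measurable_funD.
  - by move=> x; rewrite le_max lexx orbT.
  - by move=> x; rewrite addr_maxl subrK add0r ge_max !le_max lexx t0 orbT.
rewrite ge0_integral_addr//; last by move=> x; rewrite le_max lexx orbT.
rewrite integral_cst_probability; apply: (@le_lt_trans _ _ (C + t)%:E); last exact: ltry.
by rewrite EFinD leeD.
Unshelve. all: by end_near. Qed.

Lemma integral_same_law {R : realType} {d d'} {S : measurableType d} {T : measurableType d'}
    (nu : probability S R) (P : probability T R) (phi : S -> T) (f : T -> R) :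
  measurable_fun setT phi -> (forall A, measurable A -> nu (phi @^-1` A) = P A) ->
  P.-integrable setT (EFin \o f) ->
  nu.-integrable setT (EFin \o (fun z => f (phi z))) /\
  (\int[nu]_z (f (phi z))%:E = \int[P]_x (f x)%:E)%E.
Proof.
move=> mphi law fi; have mf : measurable_fun setT f.
  by apply/measurable_EFinP; exact: measurable_int fi.
have hi : nu.-integrable setT (EFin \o (fun z => f (phi z))).
  apply/integrableP; split; first by apply/measurable_EFinP; exact: measurableT_comp.
  rewrite (@ge0_integral_same_law _ _ _ _ _ nu P phi (fun x => `|f x|)) => //.
    by case/integrableP: fi.
  exact: measurableT_comp.
split => //.
rewrite -(@eq_measure_integral _ _ _ setT P (pushforward nu phi)); last first.
  by move=> A mA _; exact: law.
have mfE : measurable_fun setT (EFin \o f) by exact/measurable_EFinP.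
by rewrite (@integral_pushforward _ _ _ _ _ phi mphi nu setT (EFin \o f) mfE).
Qed.

Section transport_cost.
Context {R : realType} {d} {T : measurableType d} (P Q : probability T R).
Variables (nu : probability (T * T)%type R) (xi : T * T -> R).
Hypotheses (mxi : measurable_fun setT xi) (xi_gt0 : forall z, 0 < xi z).
Local Notation pi := (P \x Q)%E.
Hypothesis dens : forall A, measurable A -> (nu A = \int[pi]_(z in A) (xi z)%:E)%E.
Hypothesis nu_coupling : coupling P Q nu.
Hypothesis xi2 : (\int[pi]_z (xi z ^+ 2)%:E < +oo)%E.
Let xi0 z : 0 <= xi z. Proof. exact: ltW. Qed.

Lemma product_coupling : coupling P Q pi.
Proof.
split => [A mA|B mB].
  rewrite (_ : fst @^-1` A = A `*` setT); last by apply/seteqP; split => -[x y] //= [].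
  transitivity (P A * Q setT)%E; first exact: product_measure1E.
  by rewrite [X in (_ * X)%E](_ : _ = 1%E) ?mule1//; exact: probability_setT.
rewrite (_ : snd @^-1` B = setT `*` B); last by apply/seteqP; split => -[x y] //= [].
transitivity (P setT * Q B)%E; first exact: product_measure1E.
by rewrite [X in (X * _)%E](_ : _ = 1%E) ?mul1e//; exact: probability_setT.
Qed.

(** [positive_parts_bounded] is applied to the pairs (a, -b) and (-a, b). For both, |f - g| = |a +
    b|, and together they yield the positive and negative parts of [a] and of [b]. *)
Lemma integrable_potentials (a b : T -> R) : measurable_fun setT a -> measurable_fun setT b ->
  nu.-integrable setT (EFin \o (fun z => a z.1 + b z.2)) ->
  P.-integrable setT (EFin \o a) /\ Q.-integrable setT (EFin \o b).
Proof.
move=> ma mb /integrableP[mab fin].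
have pos (f g : T -> R) : measurable_fun setT f -> measurable_fun setT g ->
    (forall z : T * T, `|f z.1 - g z.2| = `|a z.1 + b z.2|) ->
    (\int[P]_x (Num.max (f x) 0)%:E < +oo)%E /\ (\int[Q]_y (Num.max (g y) 0)%:E < +oo)%E.
  move=> mf mg fg.
  have [D DE] : exists D : R, (\int[nu]_z `|f z.1 - g z.2|%:E <= D%:E)%E.
    exists (fine (\int[nu]_z `|a z.1 + b z.2|%:E)); under eq_integral do rewrite fg.
    by rewrite fineK// ge0_fin_numE//; apply: integral_ge0 => z _; rewrite lee_fin.
  have [t [t0 ht]] := positive_parts_bounded mxi xi0 dens nu_coupling xi2 mf mg DE.
  have te0 (S : probability T R) (h : T -> R) n :
      (0 <= \int[S]_x (truncated_excess t n (h x))%:E)%E.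
    by apply: integral_ge0 => x _; rewrite lee_fin; case/andP: (truncated_excess_itv t n (h x)).
  split; apply: (@ge0_integral_positive_part_fin _ _ _ _ _ t (2 * D)) => // n;
    apply: le_trans (ht n).
  - by rewrite leeDl.
  - by rewrite leeDr.
have abs_fin (S : probability T R) (f : T -> R) : measurable_fun setT f ->
    (\int[S]_x (Num.max (f x) 0)%:E < +oo)%E -> (\int[S]_x (Num.max (- f x) 0)%:E < +oo)%E ->
    S.-integrable setT (EFin \o f).
  move=> mf h1 h2; apply/integrableP; split; first exact/measurable_EFinP.
  have -> : (\int[S]_x `|(EFin \o f) x| =
      \int[S]_x ((Num.max (f x) 0)%:E + (Num.max (- f x) 0)%:E))%E.
    apply: eq_integral => x _; rewrite -EFinD /=; congr (_%:E).
    have [f0|f0] := leP 0 (f x).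
      by rewrite ger0_norm// (max_r (_ : - f x <= 0)) ?oppr_le0// addr0.
    by rewrite ltr0_norm// add0r max_l// oppr_ge0 ltW.
  rewrite ge0_integralD//; first exact: lte_add_pinfty.
  - by move=> x _; rewrite lee_fin le_max lexx orbT.
  - by apply/measurable_EFinP; exact: measurable_maxr.
  - by move=> x _; rewrite lee_fin le_max lexx orbT.
  - by apply/measurable_EFinP; apply: measurable_maxr => //; exact: measurableT_comp.
have [ap bn] := pos a (fun y => - b y) ma ltac:(exact: measurableT_comp)
  (fun z => ltac:(by rewrite opprK)).
have [an bp] := pos (fun x => - a x) b ltac:(exact: measurableT_comp) mb
  (fun z => ltac:(by rewrite -opprD normrN)).
by split; exact: abs_fin.
Qed.

(** Both [nu] and the product measure are couplings of [P] and [Q]. Once a and b are integrable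
    separately, the integral of a + b depends on the marginals only. *)
Lemma integral_potentials (a b : T -> R) : measurable_fun setT a -> measurable_fun setT b ->
  nu.-integrable setT (EFin \o (fun z => a z.1 + b z.2)) ->
  pi.-integrable setT (EFin \o (fun z => a z.1 + b z.2)) /\
  (\int[pi]_z (a z.1 + b z.2)%:E = \int[nu]_z (a z.1 + b z.2)%:E)%E.
Proof.
move=> ma mb abi; have [ai bi] := integrable_potentials ma mb abi.
have sum (rho : probability (T * T)%type R) : coupling P Q rho ->
    rho.-integrable setT (EFin \o (fun z => a z.1 + b z.2)) /\
    (\int[rho]_z (a z.1 + b z.2)%:E = \int[P]_x (a x)%:E + \int[Q]_y (b y)%:E)%E.
  move=> [c1 c2]; have [i1 <-] := integral_same_law measurable_fst c1 ai.
  have [i2 <-] := integral_same_law measurable_snd c2 bi.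
  split.
    rewrite (_ : EFin \o _ = (EFin \o (fun z => a z.1)) \+ (EFin \o (fun z => b z.2))).
      exact: integrableD.
    by apply/funext => z; rewrite /= EFinD.
  by under eq_integral do rewrite EFinD; rewrite integralD.
have [i1 ->] := sum _ product_coupling; by have [_ ->] := sum _ nu_coupling.
Qed.

End transport_cost.

Section schrodinger_cost.
Context {R : realType} {d} {T : measurableType d} (P Q : probability T R).
Variables (eps : R) (c : T * T -> R) (a b : T -> R) (nu : probability (T * T)%type R).
Hypotheses (eps_gt0 : 0 < eps) (c_ge0 : forall z, 0 <= c z).
Hypotheses (ma : measurable_fun setT a) (mb : measurable_fun setT b).
Local Notation pi := (P \x Q)%E.
Local Notation xi := (schrodinger_density eps c a b).
Hypothesis mxi : measurable_fun setT xi.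
Hypothesis dens : forall A, measurable A -> (nu A = \int[pi]_(z in A) (xi z)%:E)%E.
Hypothesis xi2 : (\int[pi]_z (xi z ^+ 2)%:E < +oo)%E.
Hypothesis cost_fin : (entropic_objective eps c P Q nu < +oo)%E.

(** Pointwise a + b = c + eps ln xi, and the entropy is the integral of ln xi, finite by
    [ln_density_integrable]. A finite objective therefore forces the nonnegative [c] to be
    integrable, and the identity can be integrated term by term. *)
Lemma schrodinger_cost :
  nu.-integrable setT (EFin \o (fun z => a z.1 + b z.2)) /\
  (\int[nu]_z (a z.1 + b z.2)%:E = entropic_objective eps c P Q nu)%E.
Proof.
have xi_gt0 z : 0 < xi z by exact: expR_gt0.
have xi0 z : 0 <= xi z by exact: ltW.
have e0 : eps != 0 by rewrite gt_eqF.
have lnE z : eps * ln (xi z) = a z.1 + b z.2 - c z.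
  by rewrite /schrodinger_density expRK mulrA mulrN mulfV// mulN1r; ring.
have li := ln_density_integrable mxi xi0 dens xi_gt0 xi2.
have mln : measurable_fun setT (fun z => ln (xi z)).
  by apply/measurable_EFinP; exact: measurable_int li.
have mab : measurable_fun setT (fun z : T * T => a z.1 + b z.2).
  by apply: measurable_funD; exact: measurableT_comp.
have mc : measurable_fun setT c.
  rewrite (_ : c = fun z => a z.1 + b z.2 - eps * ln (xi z)).
    by apply: measurable_funB => //; exact: measurable_funM.
  by apply/funext => z; rewrite lnE; ring.
have c0 : (0 <= \int[nu]_z (c z)%:E)%E by apply: integral_ge0 => z _; rewrite lee_fin.
have KLfin := integrable_fin_num measurableT li.
have KLE := KL_density mxi xi0 dens xi_gt0.
move: cost_fin; rewrite /entropic_objective KLE => fin.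
have ci : nu.-integrable setT (EFin \o c).
  apply/integrableP; split; first exact/measurable_EFinP.
  under eq_integral do rewrite /= ger0_norm//.
  move: fin; rewrite -(fineK KLfin) -EFinM.
  by case: (\int[nu]_z (c z)%:E)%E c0 => // r _ _; exact: ltry.
have eli : nu.-integrable setT (EFin \o (fun z => eps * ln (xi z))).
  rewrite (_ : EFin \o _ = fun z => (eps%:E * (EFin \o (fun z => ln (xi z))) z)%E).
    exact: integrableZl.
  by apply/funext => z; rewrite /= EFinM.
have abE : (fun z => a z.1 + b z.2) = (fun z => c z + eps * ln (xi z)).
  by apply/funext => z; rewrite lnE; ring.
split.
  rewrite abE (_ : EFin \o _ = (EFin \o c) \+ (EFin \o (fun z => eps * ln (xi z)))).
    exact: integrableD.
  by apply/funext => z; rewrite /= EFinD.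
transitivity (\int[nu]_z ((c z)%:E + (eps * ln (xi z))%:E))%E.
  by apply: eq_integral => z _; rewrite -EFinD lnE; congr (_%:E); ring.
rewrite integralD//; congr (_ + _)%E.
under eq_integral do rewrite EFinM.
by rewrite integralZl.
Qed.

End schrodinger_cost.

Lemma Lfun2_square_fin {R : realType} {d} {T : measurableType d} (mu : probability T R)
    (f : T -> R) :
  f \in Lfun mu 2%:E -> measurable_fun setT f /\ (\int[mu]_z (f z ^+ 2)%:E < +oo)%E.
Proof.
move=> hf; have /integrableP[_ h] := Lfun2_integrable_sqr hf.
split; first by move: hf; rewrite inE => /andP[]; rewrite inE.
by move: h; under eq_integral do rewrite /= ger0_norm ?sqr_ge0//.
Qed.

(** * Convergence in probability *)

Section two_sample_family.
Context {R : realType} {d d'} {Om : measurableType d} {T : measurableType d'}.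
Variables (Pr : probability Om R) (P Q : probability T R) (X Y : nat -> {mfun Om >-> T}).
Hypotheses (X_iid : iid_from Pr X P) (Y_iid : iid_from Pr Y Q).
Hypothesis XY_indep : independent_sequences Pr X Y.

Definition two_sample (w : Om) : config T (nat + nat)%type :=
  fun v => match v with inl i => X i w | inr j => Y j w end.

Let sample_event (S : nat -> {mfun Om >-> T}) (J : seq nat) (A : nat -> set T) :=
  \bigcap_(j in [set` J]) (S j @^-1` A j).

Let generated_sample_event S J A : (forall j, measurable (A j)) ->
  generated_sigma S (sample_event S J A).
Proof.
move=> mA.
have gT : generated_sigma S setT.
  by rewrite -(setC0); apply: sigma_algebraC; exact: sigma_algebra0.
elim: J => [|j J IH].
  by rewrite (_ : sample_event S [::] A = setT)//; apply/seteqP; split.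
rewrite (_ : sample_event S (j :: J) A = S j @^-1` A j `&` sample_event S J A).
  have [_ _ _ gI] := (sigma_algebraP (fun B _ => @subsetT _ B)).1 (smallest_sigma_algebra setT
    [set E | exists i A, measurable A /\ E = S i @^-1` A]).
  by apply: gI => //; apply: sub_sigma_algebra; exists j, (A j).
apply/seteqP; split => w.
  by move=> h; split; [exact: (h j (mem_head _ _))|move=> i iJ; apply: h; rewrite /= inE iJ orbT].
by move=> [h1 h2] i /=; rewrite inE => /predU1P[->//|/h2].
Qed.

Let iid_prod S (L : probability T R) J A : iid_from Pr S L -> uniq J ->
  (forall j, measurable (A j)) -> (Pr (sample_event S J A) = \prod_(j <- J) L (A j))%E.
Proof.
move=> [ind law] uJ mA; rewrite ind//; apply: eq_bigr => j _.
exact: law.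
Qed.

(** A finite set of indices splits into its left and right parts, whose events belong to the
    sigma-algebras generated by [X] and by [Y]. Independence of the two sequences separates the
    parts, and each part factors within its own sample. *)
Lemma two_sample_independent : independent_family Pr two_sample (two_sample_law P Q).
Proof.
split=> [[i|j]|J A uJ mA]; [exact: measurable_funP|exact: measurable_funP|].
pose lefts := pmap (fun v : nat + nat => if v is inl i then Some i else None) J.
pose rights := pmap (fun v : nat + nat => if v is inr j then Some j else None) J.
have lK : ocancel (fun v : nat + nat => if v is inl i then Some i else None) inl by case.
have rK : ocancel (fun v : nat + nat => if v is inr j then Some j else None) inr by case.
have inlefts i : (i \in lefts) = (inl i \in J) by exact: (can2_mem_pmap lK).
have inrights j : (j \in rights) = (inr j \in J) by exact: (can2_mem_pmap rK).
have ul : uniq lefts by exact: (pmap_uniq lK).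
have ur : uniq rights by exact: (pmap_uniq rK).
rewrite (_ : [set w | _] = sample_event X lefts (fun i => A (inl i)) `&`
    sample_event Y rights (fun j => A (inr j))); last first.
  apply/seteqP; split => w /=.
    move=> h; split => [i|j] /=; first by rewrite inlefts => /h.
    by rewrite inrights => /h.
  move=> [h1 h2] [i|j] hJ; first by apply: h1; rewrite /= inlefts.
  by apply: h2; rewrite /= inrights.
rewrite XY_indep; [|exact: generated_sample_event|exact: generated_sample_event].
rewrite (iid_prod X_iid)// (iid_prod Y_iid)//.
rewrite /lefts /rights {lefts rights inlefts inrights ul ur uJ}; elim: J => [|[i|j] J IH] /=.
- by rewrite !big_nil mule1.
- by rewrite !big_cons -muleA IH.
- by rewrite !big_cons muleCA IH.
Qed.

End two_sample_family.

Section gibbs_average.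
Context {R : realType} {T : Type}.
Variables (eps : R) (c : T * T -> R) (a b : T -> R).
Local Notation xi := (fun z => expR (- eps^-1 * (c z - a z.1 - b z.2))).

Lemma log_permutation_averageE N (x y : nat -> T) :
  log_permutation_average eps c N x y =
  N%:R^-1 * ln (perm_average (fun z => expR (- eps^-1 * c z)) N x y).
Proof.
rewrite /log_permutation_average /perm_average; congr (_ * _); congr ln; congr (_ * _).
by apply: eq_bigr => s _; rewrite mulr_sumr expR_sum.
Qed.

Lemma perm_average_gt0 (g : T * T -> R) N x y : (forall z, 0 < g z) -> 0 < perm_average g N x y.
Proof.
move=> g0; rewrite mulr_gt0 ?invr_gt0 ?ltr0n ?fact_gt0//.
rewrite (bigD1 1%g)//= ltr_wpDr ?prodr_gt0//.
by apply: sumr_ge0 => s _; apply: prodr_ge0 => i _; exact: ltW.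
Qed.

Lemma gibbs_perm_average N (x y : nat -> T) :
  perm_average (fun z => expR (- eps^-1 * c z)) N x y =
  perm_average xi N x y * expR (- eps^-1 * \sum_(i < N) (a (x i) + b (y i))).
Proof.
rewrite /perm_average -mulrA; congr (_ * _); rewrite mulr_suml; apply: eq_bigr => s _.
have -> : \sum_(i < N) (a (x i) + b (y i)) = \sum_(i < N) (a (x i) + b (y (s i))).
  rewrite !big_split /=; congr (_ + _).
  by rewrite (reindex_inj (@perm_inj _ s)).
rewrite mulr_sumr expR_sum -big_split /=; apply: eq_bigr => i _.
by rewrite -expRD -mulrDr; congr (expR (_ * _)); ring.
Qed.

Lemma log_permutation_average_split N (x y : nat -> T) :
  log_permutation_average eps c N x y =
  N%:R^-1 * ln (perm_average xi N x y)
  - eps^-1 * (N%:R^-1 * \sum_(i < N) (a (x i) + b (y i))).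
Proof.
rewrite log_permutation_averageE gibbs_perm_average lnM ?posrE ?expR_gt0//; last first.
  by apply: perm_average_gt0 => z; exact: expR_gt0.
by rewrite expRK; ring.
Qed.

End gibbs_average.

Lemma cvg_measure0 {R : realType} {d} {Om : measurableType d} (Pr : probability Om R)
    (E : nat -> set Om) : (forall N, measurable (E N)) ->
  (forall rho : R, 0 < rho -> exists N0, forall N, (N0 <= N)%N -> (Pr (E N) <= rho%:E)%E) ->
  Pr (E N) @[N --> \oo] --> 0%E.
Proof.
move=> mE hE; apply/fine_cvgP; split; first by apply: nearW => N; exact: fin_num_measure.
apply/cvgrPdist_le => rho rho0; have [N0 hN0] := hE rho rho0.
exists N0 => // N /= hN; rewrite sub0r normrN ger0_norm ?fine_ge0//.
by rewrite -lee_fin fineK ?hN0//; exact: fin_num_measure.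
Qed.

Lemma expRN_mul_small {R : realType} (del rho : R) : 0 < del -> 0 < rho ->
  exists N0 : nat, forall N, (N0 <= N)%N -> expR (- (del * N%:R)) <= rho.
Proof.
move=> del0 rho0; exists (Num.bound (rho^-1 / del)) => N hN.
rewrite expRN -[leRHS]invrK lef_pV2 ?posrE ?invr_gt0 ?expR_gt0//.
apply: (@le_trans _ _ (1 + del * N%:R)); last exact: expR_ge1Dx.
apply: (@le_trans _ _ (del * N%:R)); last by rewrite lerDr.
rewrite mulrC -ler_pdivrMr// (le_trans (ltW (archi_boundP _))) ?ler_nat//.
by rewrite divr_ge0 ?invr_ge0 ?ltW.
Qed.

Theorem corollary3 (R : realType) (d : nat)
  (P Q : probability 'rV[R]_d R)
  (eps : R) (eps_gt0 : 0 < eps)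
  (c : 'rV[R]_d * 'rV[R]_d -> R)
  (c_ge0 : forall z, 0 <= c z)
  (c_cont : continuous c)
  (c_eq0 : forall x y, c (x, y) = 0 <-> x = y)
  (cost_fin : (entropic_cost eps c P Q < +oo)%E)
  (mu : probability ('rV[R]_d * 'rV[R]_d)%type R)
  (mu_bridge : schrodinger_bridge eps c P Q mu)
  (a b : 'rV[R]_d -> R)
  (a_meas : measurable_fun setT a) (b_meas : measurable_fun setT b)
  (xi : 'rV[R]_d * 'rV[R]_d -> R)
  (xi_def : xi = schrodinger_density eps c a b)
  (mu_density : forall A, measurable A ->
     (mu A = \int[(P \x Q)%E]_(z in A) (xi z)%:E)%E)
  (xi_L2 : xi \in Lfun (P \x Q)%E 2%:E)
  (s : nat -> R) (alpha beta : nat -> 'rV[R]_d -> R)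
  (eig_AstarA : eigenvalue_list P (fun f => opA_adj Q xi (opA P xi f))
                  (fun k => s k ^+ 2) alpha)
  (eig_AAstar : eigenvalue_list Q (fun g => opA P xi (opA_adj Q xi g))
                  (fun k => s k ^+ 2) beta)
  (s0 : s 0%N = 1) (alpha0 : alpha 0%N = cst 1) (beta0 : beta 0%N = cst 1)
  (s_itv : forall k, 0 <= s k <= 1)
  (gap : (forall k, (1 <= k)%N -> s k <= s 1%N) /\ s 1%N < 1)
  (dOm : measure_display) (Om : measurableType dOm) (Pr : probability Om R)
  (X Y : nat -> {mfun Om >-> 'rV[R]_d})
  (X_iid : iid_from Pr X P) (Y_iid : iid_from Pr Y Q)
  (XY_indep : independent_sequences Pr X Y) :
  cvg_in_probability Pr
    (fun N w => log_permutation_average eps c N (X ^~ w) (Y ^~ w))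
    (- eps^-1 * fine (entropic_cost eps c P Q)).
Proof.
have [mu_coup objE] := mu_bridge.
rewrite xi_def in mu_density xi_L2.
set xi0 := schrodinger_density eps c a b in mu_density xi_L2.
have [mxi xi2] := Lfun2_square_fin xi_L2.
have xi_gt0 z : 0 < xi0 z by exact: expR_gt0.
have obj_fin : (entropic_objective eps c P Q mu < +oo)%E by rewrite objE.
have [abi abE] := schrodinger_cost eps_gt0 c_ge0 a_meas b_meas mxi mu_density xi2 obj_fin.
have [Fi FE] := integral_potentials mxi xi_gt0 mu_density mu_coup xi2 a_meas b_meas abi.
pose F (z : 'rV[R]_d * 'rV[R]_d) := a z.1 + b z.2.
pose C := fine (entropic_cost eps c P Q).
(* The weak law samples a + b under the product measure, whereas the optimal cost is its integral
   under the bridge; [FE] identifies the two. *)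
have CE : \int[(P \x Q)%E]_z F z = C.
  by rewrite /Rintegral [X in fine X]FE abE objE.
have indepZ := two_sample_independent X_iid Y_iid XY_indep.
pose Z := two_sample X Y.
have xi1 : (\int[(P \x Q)%E]_z (xi0 z)%:E = 1)%E.
  by rewrite -mu_density//; exact: probability_setT.
pose L N w := log_permutation_average eps c N (X ^~ w) (Y ^~ w).
have LE N w : L N w = N%:R^-1 * ln (perm_average xi0 N (Z w \o inl) (Z w \o inr))
    - eps^-1 * (N%:R^-1 * pair_sum Z F N w).
  exact: (log_permutation_average_split eps c a b N (X ^~ w) (Y ^~ w)).
have mF : measurable_fun setT F by apply: measurable_funD; exact: measurableT_comp.
have mL N : measurable_fun setT (L N).
  rewrite (funext (LE N)).
  apply: measurable_funB.
    apply: measurable_funM => //; apply: measurableT_comp => //.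
    exact: (measurable_perm_average indepZ).
  by do 2 (apply: measurable_funM => //); exact: (measurable_pair_sum indepZ).
move=> del del0.
have mE (f : Om -> R) (u : R) : measurable_fun setT f -> measurable [set w | u < `|f w|].
  move=> mf; apply: measurable_bool_set; apply: measurable_fun_ltr => //.
  exact: measurableT_comp.
apply: cvg_measure0 => [N|rho rho0].
  by apply: mE; apply: measurable_funB => //; exact: mL.
have del2 : 0 < del / 2 by rewrite divr_gt0.
have rho3 : 0 < rho / 3 by rewrite divr_gt0.
(* The empirical mean of a + b enters the logarithm divided by [eps], so this deviation accounts for
   del / 2. *)
have ed0 : 0 < eps * (del / 2) by rewrite mulr_gt0.
have [N1 hN1] := weak_law_pairs indepZ Fi ed0 rho3.
have [N2 hN2] := schrodinger_lower_tail eps_gt0 c_cont a_meas b_meas mxi mu_density mu_coup xi2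
  indepZ del2 rho3.
have [N3 hN3] := expRN_mul_small del2 rho3.
(* The 1 excludes N = 0, for which division by N is meaningless. *)
exists (maxn 1 (maxn N1 (maxn N2 N3))) => N; rewrite !geq_max => /and4P[N0 /hN1 h1 /hN2 h2 /hN3 h3].
have {}h3 : (Pr [set w | (expR (del / 2 * N%:R) <=
    perm_average xi0 N (Z w \o inl) (Z w \o inr))%R] <= (rho / 3)%:E)%E.
  apply: le_trans (perm_average_upper_tail indepZ (del / 2) N mxi (fun z => ltW (xi_gt0 z)) xi1) _.
  by rewrite lee_fin.
pose E1 := [set w | eps * (del / 2) < `|N%:R^-1 * pair_sum Z F N w - \int[(P \x Q)%E]_z F z|].
pose E2 := [set w | perm_average xi0 N (Z w \o inl) (Z w \o inr) <= expR (- (del / 2 * N%:R))].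
pose E3 := [set w | expR (del / 2 * N%:R) <= perm_average xi0 N (Z w \o inl) (Z w \o inr)].
have mD := measurable_perm_average indepZ N mxi.
have m1 : measurable E1.
  apply: (mE (fun w => N%:R^-1 * pair_sum Z F N w - \int[(P \x Q)%E]_z F z)).
  apply: measurable_funB => //; apply: measurable_funM => //.
  exact: (measurable_pair_sum indepZ).
have m2 : measurable E2 by exact: (measurable_perm_average_le _ _ indepZ).
have m3 : measurable E3 by apply: measurable_bool_set; exact: measurable_fun_ler.
apply: (@le_trans _ _ (Pr (E1 `|` (E2 `|` E3)))); last first.
  apply: le_trans (measureU2 _ _ _) _ => //; first exact: measurableU.
  rewrite (_ : rho = rho / 3 + (rho / 3 + rho / 3)); last by field.
  rewrite !EFinD; apply: leeD; first exact: h1.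
  by apply: le_trans (measureU2 _ _ _) _ => //; apply: leeD; [exact: h2|exact: h3].
apply: le_measure; rewrite ?inE.
- by apply: mE; apply: measurable_funB => //; exact: mL.
- by apply: measurableU => //; exact: measurableU.
move=> w /= hw.
have [w1|w1] := ltP (eps * (del / 2)) (`|N%:R^-1 * pair_sum Z F N w - \int[(P \x Q)%E]_z F z|).
  by left.
right; have D0 : 0 < perm_average xi0 N (Z w \o inl) (Z w \o inr) by exact: perm_average_gt0.
have N0' : 0 < N%:R :> R by rewrite ltr0n.
have [w2|w2] := leP (perm_average xi0 N (Z w \o inl) (Z w \o inr)) (expR (- (del / 2 * N%:R))).
  by left.
(* Off the three events, (1/N) ln D_N lies within del / 2 of 0 and the potential term within del / 2
   of its limit, contradicting a total deviation above [del]. *)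
right; rewrite /E3 /=; rewrite leNgt; apply/negP => w3.
move: hw; rewrite -/(L N w) LE -/C; apply/negP; rewrite -leNgt.
have -> : N%:R^-1 * ln (perm_average xi0 N (Z w \o inl) (Z w \o inr)) -
    eps^-1 * (N%:R^-1 * pair_sum Z F N w) - - eps^-1 * C =
  N%:R^-1 * ln (perm_average xi0 N (Z w \o inl) (Z w \o inr)) -
    eps^-1 * (N%:R^-1 * pair_sum Z F N w - C) by ring.
rewrite (splitr del); apply: le_trans (ler_normB _ _) _; apply: lerD.
  rewrite normrM ger0_norm ?invr_ge0// mulrC ler_pdivrMr// ler_norml.
  rewrite -[X in _ && (_ <= X)]expRK ler_ln ?posrE ?expR_gt0// (ltW w3) andbT.
  by rewrite -[leLHS]expRK ler_ln ?posrE ?expR_gt0// ltW.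
rewrite normrM gtr0_norm ?invr_gt0// mulrC ler_pdivrMr// [leRHS]mulrC.
by move: w1; rewrite CE.
Qed.
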